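(* Let $M\ge 1$ be an integer, let $\mathbf{M}=\{1,\dots,M\}$, and let $\mathbf{H}=(\mathbf{H}_{m',m})_{m',m\in\mathbf{M}}$ be a matrix with nonnegative real entries whose spectral radius is strictly smaller than $1$. Then there exists $\xi>0$, depending only on $\mathbf{H}$, such that for every stationary linear Hawkes process $(N^m)_{m\in\mathbf{M}}$ with base rates $(\mu_m)_{m\in\mathbf{M}}\subset\mathbb{R}_+$ and measurable interaction functions $h^m_{m'}:\mathbb{R}_+\to\mathbb{R}_+$ satisfying $\|h^m_{m'}\|_1=\mathbf{H}_{m',m}$ for all $m,m'\in\mathbf{M}$, and for every bounded (Borel) set $B\subset\mathbb{R}$, $$\mathbb{E}\left[e^{\xi N(B)}\right]<\infty ,\qquad\text{where } N(B)=\sum_{m\in\mathbf{M}}\mathrm{Card}(N^m\cap B).$$ More precisely, let $0<r<1$ and $0\le K<\infty$ be such that $\|\mathbf{H}^n\|_{\infty,\mathrm{op}}\le K r^n$ for all integers $n\ge 1$, and set $$\xi_{r,K}=\frac{\log\left(\frac{1+r}{2r}\right)}{1+\frac{2K}{1-r}} .$$ If $B\subset[s,s+L)$ for some $s\in\mathbb{R}$ and $L>0$, then for every such Hawkes process and all $u\in[0,1]$, $$\mathbb{E}\left[e^{u\,\xi_{r,K}N(B)}\right]\le \exp\left(\left[\left(\frac{1+r}{2r}\right)^{u}-1\right]L\sum_{m\in\mathbf{M}}\mu_m\right).$$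
   Context: Hawkes process. A point process on $\mathbb{R}$ is a random subset of $\mathbb{R}$ that is almost surely locally finite. Given base rates $\mu_m\ge 0$ and measurable interaction functions $h^m_{m'}:\mathbb{R}_+\to\mathbb{R}_+$ ($m,m'\in\mathbf{M}$), a (linear) Hawkes process with these parameters, on a probability space with filtration $(\mathcal{F}_t)_{t\in\mathbb{R}}$, is a family $(N^m)_{m\in\mathbf{M}}$ of point processes on $\mathbb{R}$ that is adapted to $(\mathcal{F}_t)$, such that almost surely $N^m$ and $N^{m'}$ have no common points when $m\ne m'$, and which has the predictable stochastic intensity $(\lambda^m)_{m\in\mathbf{M}}$ given by $$\lambda^m_t=\mu_m+\sum_{m'\in\mathbf{M}}\int_{-\infty}^{t^-}h^m_{m'}(t-s)\,dN^{m'}_s,\qquad m\in\mathbf{M},\ t\in\mathbb{R}.$$ Here $\|h\|_1=\int_0^\infty h(t)\,dt$, and $\mathbf{H}_{m',m}=\|h^m_{m'}\|_1$ (row $m'$, column $m$). Stationary process and its law (known facts, due to Brémaud–Massoulié and Hawkes–Oakes). When the spectral radius of $\mathbf{H}$ is $<1$, the stationary Hawkes process exists, and its law is that of the following cluster construction, which is the Hawkes process meant in the statement. Let $\mathcal{U}=\bigcup_{n\ge 0}(\mathbb{N}^* )^n$ be the set of Ulam–Harris–Neveu labels, with $\mathbb{N}^*=\{1,2,\dots\}$ and $(\mathbb{N}^* )^0=\{\varnothing\}$. A cluster with root of type $m_0\in\mathbf{M}$ born at time $t_0\in\mathbb{R}$ is a random family $((u,\mathrm{tp}(u),\mathrm{bd}(u)))_{u\in\mathcal{T}}$,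 where $\mathcal{T}\subset\mathcal{U}$ is a random tree, $\mathrm{tp}(u)\in\mathbf{M}$ is the type and $\mathrm{bd}(u)\in\mathbb{R}$ the birth date of $u$, such that: the root $\varnothing$ has type $m_0$; independently for all individuals $u$ and all types $m$, the number of children of $u$ of type $m$ is Poisson with parameter $\mathbf{H}_{\mathrm{tp}(u),m}$; $\mathrm{bd}(\varnothing)=t_0$; and conditionally on the typed tree, independently for all pairs with $v$ a child of $u$, $\mathrm{bd}(v)-\mathrm{bd}(u)$ has density $h^{\mathrm{tp}(v)}_{\mathrm{tp}(u)}(s)\mathbf{1}_{s>0}/\int_0^\infty h^{\mathrm{tp}(v)}_{\mathrm{tp}(u)}(t)\,dt$. Take independent homogeneous Poisson processes $\pi^m$ on $\mathbb{R}$ with rates $\mu_m$ and, conditionally on them, independent clusters $G^m_x$ with root of type $m$ born at time $x$, for $m\in\mathbf{M}$ and $x\in\pi^m$. Then $N^m$ is the set of birth dates of all individuals of type $m$ in all these clusters. Norm. $\|A\|_{\infty,\mathrm{op}}$ is the operator norm associated with the sup norm $\|\cdot\|_\infty$ on vectors, i.e. $\|A\|_{\infty,\mathrm{op}}=\max_i\sum_j|A_{ij}|$. By Gelfand's theorem, if the spectral radius of $\mathbf{H}$ is $<1$, such $r\in(0,1)$ and $K<\infty$ exist. *)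

(* Defs.v *)
From HB Require Import structures.
From mathcomp Require Import all_boot all_order all_algebra.
From mathcomp Require Import complex.
From mathcomp Require Import all_classical all_reals all_analysis measurable_realfun.

Set Implicit Arguments.
Unset Strict Implicit.
Unset Printing Implicit Defensive.

Import Order.TTheory GRing.Theory Num.Theory.
Import numFieldNormedType.Exports.

Local Open Scope classical_set_scope.
Local Open Scope ring_scope.

Definition opnorm_inf (R : realType) (M : nat) (A : 'M[R]_M) : R :=
  \big[Num.max/0]_(i < M) \sum_(j < M) `|A i j|.

(* Largest modulus of the complex eigenvalues (a nonempty finite set as soon
   as 0 < M, so that the supremum is a maximum). *)
Definition spectral_radius (R : realType) (M : nat) (A : 'M[R]_M) : R :=
  sup [set Normc.normc z | z in
         [set z : R[i]%C | eigenvalue (map_mx (real_complex R) A) z]].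

(* [poisson_prob] ignores its second argument; it is the Dirac mass at 0 when
   the rate is 0. *)
Definition poisson_mass (R : realType) (rate : R) (k : nat) : \bar R :=
  poisson_prob rate 0%N [set k].

Definition mutually_independent (R : realType) (d : measure_display)
    (T : measurableType d) (P : probability T R) (I : choiceType)
    (F : I -> set (set T)) : Prop :=
  forall (s : seq I) (E : I -> set T), uniq s -> (forall i, F i (E i)) ->
    P (\bigcap_(i in [set` s]) E i) = (\prod_(i <- s) P (E i))%E.

(* Local finiteness is almost sure, so counts take values in [0, +oo]. *)
Definition point_process (R : realType) (d : measure_display)
    (T : measurableType d) (P : probability T R) (N : T -> set R) : Prop :=
  (forall B : set R, measurable B ->
     measurable_fun [set: T] (fun w => counting (N w `&` B) : \bar R)) /\
  {ae P, forall w, forall B : set R, bounded_set B -> finite_set (N w `&` B)}.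

Definition poisson_process (R : realType) (d : measure_display)
    (T : measurableType d) (P : probability T R) (rate : R)
    (N : T -> set R) : Prop :=
  point_process P N /\
  forall (n : nat) (B : 'I_n -> set R) (k : 'I_n -> nat),
    (forall i, measurable (B i) /\ bounded_set (B i)) ->
    trivIset [set: 'I_n] B ->
    P [set w | forall i, counting (N w `&` B i) = (k i)%:R%:E :> \bar R] =
    (\prod_(i < n)
       poisson_mass (rate * fine (lebesgue_measure (B i))) (k i))%E.

(* N : 'I_M -> T -> set R is a family of random sets, N m being the points of
   type m.  Two such families, possibly on different probability spaces, have
   the same law when their counts have the same finite-dimensional
   distributions. *)
Definition same_law (R : realType) (M : nat)
    (d : measure_display) (T : measurableType d) (P : probability T R)
    (N : 'I_M -> T -> set R)
    (d' : measure_display) (T' : measurableType d') (P' : probability T' R)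
    (N' : 'I_M -> T' -> set R) : Prop :=
  forall (n : nat) (m : 'I_n -> 'I_M) (B : 'I_n -> set R) (k : 'I_n -> nat),
    (forall i, measurable (B i) /\ bounded_set (B i)) ->
    P [set w | forall i, counting (N (m i) w `&` B i) = (k i)%:R%:E :> \bar R]
    =
    P' [set w | forall i, counting (N' (m i) w `&` B i) = (k i)%:R%:E :> \bar R].

Definition total_count (R : realType) (M : nat) (T : Type)
    (N : 'I_M -> T -> set R) (B : set R) (w : T) : \bar R :=
  (\sum_(m < M) counting (N m w `&` B))%E.

(* h i j is the interaction function from type i to type j, written h^j_i on
   paper; only its values on [0, +oo[ matter. *)
Definition l1norm (R : realType) (f : R -> R) : \bar R :=
  (\int[lebesgue_measure]_(t in `[0%R, +oo[) (f t)%:E)%E.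

Definition hawkes_parameters (R : realType) (M : nat) (mu : 'I_M -> R)
    (h : 'I_M -> 'I_M -> R -> R) : Prop :=
  (forall m, 0 <= mu m) /\
  (forall i j, measurable_fun `[(0 : R), +oo[ (h i j)) /\
  (forall i j (t : R), 0 <= t -> 0 <= h i j t).

Definition offspring_mean (R : realType) (M : nat)
    (h : 'I_M -> 'I_M -> R -> R) (i j : 'I_M) : R := fine (l1norm (h i j)).

(* When the L1 norm is 0 the density is x / 0 = 0; there are then almost surely
   no individuals to which it applies. *)
Definition displacement_density (R : realType) (M : nat)
    (h : 'I_M -> 'I_M -> R -> R) (i j : 'I_M) (x : R) : R :=
  (if 0 < x then h i j x else 0) / offspring_mean h i j.

(* The label [:: i1; ...; in] is the individual i1...in, [::] is the root and
   rcons u i the i-th child of u. *)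
Definition label : Type := seq nat.

(* A family ((u, tp u, bd u))_(u in tree) is encoded as a partial function:
   g u = Some (tp u, bd u) if u belongs to the tree, and None otherwise. *)
Definition cluster (R : realType) (M : nat) : Type := label -> option ('I_M * R).

Definition ctype (R : realType) (M : nat) (g : cluster R M) (u : label) :
  option 'I_M := omap fst (g u).

Definition nchildren (R : realType) (M : nat) (g : cluster R M) (u : label)
    (m : 'I_M) : \bar R :=
  counting [set i : nat | ctype g (rcons u i) = Some m].

Definition cluster_events (R : realType) (M : nat) (T : Type)
    (G : T -> cluster R M) : set (set T) :=
  [set E | exists (u : label) (m : 'I_M) (A : set R), measurable A /\
     E = [set w | exists b, A b /\ G w u = Some (m, b)]].

Definition typed_tree_events (R : realType) (M : nat) (T : Type)
    (G : T -> cluster R M) : set (set T) :=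
  [set E | exists (u : label) (m : 'I_M),
     E = [set w | ctype (G w) u = Some m]].

(* Children need not be numbered consecutively. *)
Definition is_typed_tree (R : realType) (M : nat) (g : cluster R M) : Prop :=
  g [::] <> None /\
  (forall u i, g (rcons u i) <> None -> g u <> None /\ (0 < i)%N).

(* Galton-Watson property.  E is the event that the typed tree up to
   generation n is given by t.  Given E, the numbers of children of type m of
   the individuals u of generation n are independent over all (u, m), and
   Poisson with parameter H_{tp(u), m}. *)
Definition poisson_offspring (R : realType) (M : nat) (d : measure_display)
    (T : measurableType d) (P : probability T R)
    (h : 'I_M -> 'I_M -> R -> R) (G : T -> cluster R M) : Prop :=
  forall (n : nat) (t : label -> option 'I_M) (ty : label -> 'I_M)
         (s : seq label) (k : label -> 'I_M -> nat),
    uniq s ->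
    (forall u, u \in s -> size u = n /\ t u = Some (ty u)) ->
    let E := [set w | forall u, (size u <= n)%N -> ctype (G w) u = t u] in
    P (E `&` [set w | forall u m, u \in s ->
                        nchildren (G w) u m = (k u m)%:R%:E]) =
    (P E * \prod_(u <- s) \prod_(m < M)
             poisson_mass (offspring_mean h (ty u) m) (k u m))%E.

(* A pair (u, i) stands for the parent u and its child rcons u i.  E ranges
   over the events depending only on the typed tree; ty fixes the types of the
   individuals involved. *)
Definition independent_displacements (R : realType) (M : nat)
    (d : measure_display) (T : measurableType d) (P : probability T R)
    (h : 'I_M -> 'I_M -> R -> R) (G : T -> cluster R M) : Prop :=
  forall (E : set T) (s : seq (label * nat)) (ty : label -> 'I_M)
         (A : label * nat -> set R),
    <<s typed_tree_events G >> E -> uniq s -> (forall p, measurable (A p)) ->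
    let F := E `&` [set w | forall p, p \in s ->
        ctype (G w) p.1 = Some (ty p.1) /\
        ctype (G w) (rcons p.1 p.2) = Some (ty (rcons p.1 p.2))] in
    P (F `&` [set w | forall p, p \in s -> exists a b,
        omap snd (G w p.1) = Some a /\
        omap snd (G w (rcons p.1 p.2)) = Some b /\ A p (b - a)]) =
    (P F * \prod_(p <- s) \int[lebesgue_measure]_(x in A p)
       (displacement_density h (ty p.1) (ty (rcons p.1 p.2)) x)%:E)%E.

Record is_cluster (R : realType) (M : nat) (d : measure_display)
    (T : measurableType d) (P : probability T R)
    (h : 'I_M -> 'I_M -> R -> R) (m0 : 'I_M) (t0 : R)
    (G : T -> cluster R M) : Prop := {
  cluster_measurable : cluster_events G `<=` measurable;
  cluster_tree : forall w, is_typed_tree (G w);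
  cluster_root : forall w, G w [::] = Some (m0, t0);
  cluster_offspring : poisson_offspring P h G;
  cluster_displacements : independent_displacements P h G }.

(* X m enumerates the points of the Poisson process pi^m: X m k w is the k-th
   point, or None if there is no such point (pi^m may be empty). *)
Definition root_set (R : realType) (M : nat) (T : Type)
    (X : 'I_M -> nat -> T -> option R) (m : 'I_M) (w : T) : set R :=
  [set x | exists k, X m k w = Some x].

Definition root_events (R : realType) (M : nat) (T : Type)
    (X : 'I_M -> nat -> T -> option R) (m : 'I_M) : set (set T) :=
  [set E | exists (k : nat) (A : set R), measurable A /\
     E = [set w | exists x, A x /\ X m k w = Some x]].

(* The cluster attached to the point x = X m k w is the translate by x of
   G m k w, a cluster with root of type m born at time 0; conditionally on the
   Poisson processes it is thus a cluster with root of type m born at x. *)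
Record cluster_construction (R : realType) (M : nat) (d : measure_display)
    (T : measurableType d) (P : probability T R)
    (mu : 'I_M -> R) (h : 'I_M -> 'I_M -> R -> R)
    (X : 'I_M -> nat -> T -> option R)
    (G : 'I_M -> nat -> T -> cluster R M) : Prop := {
  roots_measurable : forall m, root_events X m `<=` measurable;
  roots_distinct : forall m k l w,
    X m k w <> None -> X m k w = X m l w -> k = l;
  roots_poisson : forall m, poisson_process P (mu m) (root_set X m);
  clusters_law : forall m k, is_cluster P h m 0 (G m k);
  construction_independent :
    mutually_independent P (fun i : 'I_M + 'I_M * nat =>
      match i with
      | inl m => <<s root_events X m >>
      | inr (m, k) => <<s cluster_events (G m k) >>
      end) }.

Definition birth_dates (R : realType) (M : nat) (T : Type)
    (X : 'I_M -> nat -> T -> option R) (G : 'I_M -> nat -> T -> cluster R M)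
    (m : 'I_M) (w : T) : set R :=
  [set y | exists (m0 : 'I_M) (k : nat) (x : R) (u : label) (b : R),
     [/\ X m0 k w = Some x, G m0 k w u = Some (m, b) & y = x + b]].

(* The stationary linear Hawkes process with base rates mu and interaction
   functions h, characterised by its law, which is that of the cluster
   construction. *)
Definition stationary_hawkes (R : realType) (M : nat) (d : measure_display)
    (T : measurableType d) (P : probability T R)
    (mu : 'I_M -> R) (h : 'I_M -> 'I_M -> R -> R)
    (N : 'I_M -> T -> set R) : Prop :=
  [/\ hawkes_parameters mu h,
      forall m, point_process P (N m) &
      exists (d' : measure_display) (T' : measurableType d')
        (P' : probability T' R)
        (X : 'I_M -> nat -> T' -> option R)
        (G : 'I_M -> nat -> T' -> cluster R M),
        cluster_construction P' mu h X G /\ same_law P N P' (birth_dates X G)].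

Definition xi_rK (R : realType) (r K : R) : R :=
  ln ((1 + r) / (2 * r)) / (1 + 2 * K / (1 - r)).

(* Main.v *)
Require Import Defs.
From HB Require Import structures.
From mathcomp Require Import all_boot all_order all_algebra.
From mathcomp Require Import all_classical all_reals all_analysis measurable_realfun.
From mathcomp Require Import complex ring lra unstable.

Set Implicit Arguments.
Unset Strict Implicit.
Unset Printing Implicit Defensive.

Import Order.TTheory GRing.Theory Num.Theory.
Import numFieldNormedType.Exports.

Local Open Scope classical_set_scope.
Local Open Scope ring_scope.

(* With rho = (1 + r) / (2 r) and weight a = u * xi per point, set
   lam_0 = 0 and lam_(n+1),i (y) = a 1_B(y) + sum_j int h_ij(t) (exp(lam_n,j (y + t)) - 1) dt.
   Since exp(x) - 1 <= rho x for 0 <= x <= ln rho, lam_n is dominated by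
   a sum_(k < n) rho^k H^k 1, which is at most u ln rho by the choice of xi
   (rho r < 1), and has integral at most L times this bound; convexity then gives
   int (exp(lam_n) - 1) <= L (rho^u - 1).  Integrating out the generations of a
   cluster from the last one to the root, first the displacements, then the Poisson
   numbers of children, bounds the exponential moment of its first n generations by
   exp(lam_n), and the exponential formula for the Poisson processes of the roots
   gives exp(mu_m L (rho^u - 1)) for each type.  Truncations to finitely many
   individuals are removed by Fatou's lemma.  The powers of H are
   controlled by the spectral radius through the Cayley-Hamilton theorem. *)

(** * Independence and integration *)

(** The law of a cluster is known only through finite data: offspring numbers given the typed tree
    up to a generation, and displacements given the typed tree. Poisson masses sum to 1, so
    generations are almost surely finite and the typed tree up to generation [n] takes countably
    many values up to a null set. On each of these atoms the types are deterministic and every birth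
    date is a finite sum of displacements. Independence given an atom is expressed with the
    restriction of [P] to it, a finite measure, and the inequalities obtained on the atoms are added
    up.

    The decisive independence is between the numbers of children of generation [k] and the
    displacements of the earlier generations, on each atom of the tree up to [k]. It comes from
    displacements being independent of the whole typed tree, and it lets displacements and offspring
    be integrated out alternately.

    Inequalities rather than equalities are propagated: a finite list of labels may miss children,
    several individuals may share a birth date, and only finitely many roots are kept. All factors
    are at least 1, so every omission goes in the right direction. *)

Lemma integral_mrestr d (T : measurableType d) (R : realType)
    (mu : {measure set T -> \bar R}) (E : set T) (mE : measurable E)
    (f : T -> \bar R) :
  measurable_fun setT f -> (forall x, 0 <= f x)%E ->
  (\int[mrestr mu mE]_x f x = \int[mu]_(x in E) f x)%E.
Proof.
move=> mf f0.
rewrite (@ge0_negligible_integral _ _ _ (mrestr mu mE) setT (~` E))//.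
- rewrite setTD setCK; apply: eq_measure_integral => A mA AE.
  by rewrite /= /mrestr setIidl.
- exact: measurableC.
- by rewrite /= /mrestr setICl measure0.
Qed.

(** The law of [(Z, D)] and the product measure agree on rectangles, hence everywhere, and Tonelli
    concludes. Since [mu] is only finite, it can be a probability restricted to an event; [nu] is
    then the conditional law of [D] on this event. *)
Lemma indep_integral d d1 d2 (T : measurableType d) (S1 : measurableType d1)
    (S2 : measurableType d2) (R : realType)
    (mu : {finite_measure set T -> \bar R})
    (nu : {sigma_finite_measure set S2 -> \bar R})
    (Z : T -> S1) (D : T -> S2) (phi : S1 * S2 -> \bar R) :
  measurable_fun setT Z -> measurable_fun setT D -> measurable_fun setT phi ->
  (forall z, 0 <= phi z)%E ->
  (forall A B, measurable A -> measurable B ->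
    mu (Z @^-1` A `&` D @^-1` B) = mu (Z @^-1` A) * nu B)%E ->
  (\int[mu]_w phi (Z w, D w) = \int[mu]_w \int[nu]_y phi (Z w, y))%E.
Proof.
move=> mZ mD mphi phi0 ind.
pose ZD w := (Z w, D w).
have mZD : measurable_fun setT ZD by exact: measurable_fun_pair.
pose m1' : {measure set S1 -> \bar R} :=
  measure_function_pushforward__canonical__measure_function_Measure mu mZ.
have m1fin : fin_num_fun m1'.
  move=> A mA; rewrite /m1' /pushforward; apply: fin_num_measure.
  by rewrite -[X in measurable X]setTI; apply: (mZ measurableT).
pose m1 : {finite_measure set S1 -> \bar R} :=
  HB.pack_for (FiniteMeasure.type S1 R) (Measure.sort m1')
    (Measure_isFinite.Build _ _ _ _ m1fin).
pose m12 : {measure set (S1 * S2)%type -> \bar R} :=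
  measure_function_pushforward__canonical__measure_function_Measure mu mZD.
have m12E : forall X, measurable X -> (m1 \x nu)%E X = m12 X.
  apply: product_measure_unique => A B mA mB.
  by rewrite /m12 /m1 /= /pushforward /= -ind.
have -> : (\int[mu]_w phi (Z w, D w) = \int[m12]_z phi z)%E.
  by rewrite ge0_integral_pushforward.
transitivity (\int[(m1 \x nu)%E]_z phi z)%E.
  by apply: eq_measure_integral => A mA _; apply/esym/m12E.
rewrite fubini_tonelli1//.
have mF : measurable_fun setT (fubini_F nu phi).
  exact: measurable_fun_fubini_tonelli_F.
rewrite /m1 /= ge0_integral_pushforward// => y _.
by rewrite /fubini_F; apply: integral_ge0.
Qed.

(** Uniqueness of measures on a pi-system, the constant sequence [setT] being the exhausting family
    of finite mass. *)
Lemma g_sigma_finite_measure_eq d (T : measurableType d) (R : realType)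
    (G : set (set T)) (m1 m2 : {measure set T -> \bar R}) :
  G `<=` measurable -> setI_closed G -> G setT -> (m1 setT < +oo)%E ->
  (forall A, G A -> m1 A = m2 A) -> forall A, <<s G >> A -> m1 A = m2 A.
Proof.
move=> Gm GI GT moo m12; apply: (@g_sigma_algebra_measure_unique _ _ _ G Gm
  (fun=> setT)) => //.
by apply/seteqP; split => // x _; exists 0%N.
Qed.

(** A sub-sigma-algebra is encoded as another measurable structure on the same carrier. Composition
    with this identity turns a function measurable for the sub-sigma-algebra into a measurable
    one. *)
Lemma measurable_id_g_sigma d (T : measurableType d) (G : set (set T)) :
  G `<=` measurable ->
  measurable_fun setT (id : T -> g_sigma_algebraType G).
Proof.
move=> Gm _ A mA; rewrite setTI preimage_id.
exact: (smallest_sub (@sigma_algebra_measurable _ T) Gm).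
Qed.

(** A pi-system generating the sigma-algebra spanned jointly by the classes [F i] for [i] in [J].
    Its members involve finitely many indices, so independence hypotheses on finite families apply
    to them. *)
Definition cylinders (T : Type) (I : choiceType) (F : I -> set (set T))
    (J : set I) : set (set T) :=
  [set Q | exists (s : seq I) (A : I -> set T),
     [/\ uniq s, (forall i, i \in s -> J i), (forall i, F i (A i)) &
         Q = \bigcap_(i in [set` s]) A i]].

Lemma cylinders_setI (T : Type) (I : choiceType) (F : I -> set (set T)) J :
  (forall i, F i setT) -> (forall i, setI_closed (F i)) ->
  setI_closed (cylinders F J).
Proof.
move=> FT FI _ _ [s [A [us sJ FA ->]]] [t [B [ut tJ FB ->]]].
(* An index present in only one of the two lists gets [setT] from the other. *)
pose C i := (if i \in s then A i else setT) `&` (if i \in t then B i else setT).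
exists (undup (s ++ t)), C; split.
- exact: undup_uniq.
- by move=> i; rewrite mem_undup mem_cat => /orP[/sJ|/tJ].
- by move=> i; apply: FI; case: ifP.
- apply/seteqP; split => w.
    by move=> [ws wt] i _; split; case: ifP => // ?; [exact: ws|exact: wt].
  move=> h; split => i /= iI.
    have /h : i \in undup (s ++ t) by rewrite mem_undup mem_cat iI.
    by move=> []; rewrite iI.
  have /h : i \in undup (s ++ t) by rewrite mem_undup mem_cat iI orbT.
  by move=> [_]; rewrite iI.
Qed.

Lemma cylinders_setT (T : Type) (I : choiceType) (F : I -> set (set T)) J :
  (forall i, F i setT) -> cylinders F J setT.
Proof.
move=> FT; exists [::], (fun=> setT); split => //.
by apply/seteqP; split.
Qed.

Lemma cylinders_sub (T : Type) (I : choiceType) (F : I -> set (set T)) J i :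
  (forall i, F i setT) -> J i -> F i `<=` cylinders F J.
Proof.
move=> FT Ji A FA; exists [:: i], (fun j => if j == i then A else setT); split => //.
- by move=> j; rewrite inE => /eqP ->.
- by move=> j; case: eqP => [->|].
- apply/seteqP; split => w; last by move=> /(_ i); rewrite /= inE !eqxx; apply.
  by move=> Aw j /=; rewrite inE => ->.
Qed.

Lemma cylinders_measurable d (T : measurableType d) (I : choiceType)
    (F : I -> set (set T)) J :
  (forall i, F i `<=` measurable) -> cylinders F J `<=` measurable.
Proof.
move=> Fm _ [s [A [_ _ FA ->]]].
rewrite [X in measurable X](_ : _ = \big[setI/setT]_(i <- s) A i).
  by apply: bigsetI_measurable => i _; exact: Fm.
by rewrite -bigcap_seq.
Qed.

(** The variable [w] plays two roles: through the classes of [J] in the first argument of [phi], and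
    through [D] in the second. Independence on cylinders alone allows [D w] to be replaced by an
    independent variable of law [nu] while [w] stays frozen. *)
Lemma cylinders_indep_integral d d2 (T : measurableType d)
    (S2 : measurableType d2) (R : realType)
    (mu : {finite_measure set T -> \bar R})
    (nu : {finite_measure set S2 -> \bar R})
    (I : choiceType) (F : I -> set (set T)) (J : set I) (D : T -> S2)
    (phi : g_sigma_algebraType (cylinders F J) * S2 -> \bar R) :
  (forall i, F i setT) -> (forall i, setI_closed (F i)) ->
  (forall i, F i `<=` measurable) ->
  measurable_fun setT D -> measurable_fun setT phi ->
  (forall z, 0 <= phi z)%E ->
  (forall (s : seq I) (A : I -> set T) (B : set S2), uniq s ->
     (forall i, i \in s -> J i) -> (forall i, F i (A i)) -> measurable B ->
     mu ((\bigcap_(i in [set` s]) A i) `&` D @^-1` B) =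
     mu (\bigcap_(i in [set` s]) A i) * nu B)%E ->
  (\int[mu]_w phi (w, D w) = \int[mu]_w \int[nu]_y phi (w, y))%E.
Proof.
move=> FT FI Fm mD mphi phi0 ind.
have Cm := cylinders_measurable (J := J) Fm.
apply: (@indep_integral _ _ _ T (g_sigma_algebraType (cylinders F J)) S2 R mu nu
  id D) => //; first exact: measurable_id_g_sigma.
move=> A B mA mB; rewrite preimage_id.
have mDB : measurable (D @^-1` B) by rewrite -[X in measurable X]setTI; exact: mD.
have nuB : nu B \is a fin_num by exact: fin_num_measure.
pose r : {nonneg R} := NngNum (fine_ge0 (measure_ge0 nu B)).
have rE : (r%:num)%:E = nu B by rewrite /r /= fineK.
(* For fixed [B], both sides are finite measures in [A], so it is enough to compare them on
   cylinders. *)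
suff E : mrestr mu mDB A = mscale r mu A.
  by rewrite -[LHS]/(mrestr mu mDB A) E muleC /mscale /= -/(r%:num) rE.
apply: (g_sigma_finite_measure_eq (m1 := mrestr mu mDB) (m2 := mscale r mu) Cm
  (cylinders_setI (J := J) FT FI) (cylinders_setT J FT)) => //.
- by rewrite ltey_eq fin_num_measure.
- move=> _ [s [C [us sJ FC ->]]].
  by rewrite -[LHS]/(mu _) -[RHS]/(_ * _)%E ind// muleC rE.
Qed.

Lemma ge0_nneseriesZl (R : realType) (x : \bar R) (f : nat -> \bar R) :
  (0 <= x)%E -> (forall k, 0 <= f k)%E ->
  (\sum_(k <oo) (x * f k) = x * \sum_(k <oo) f k)%E.
Proof.
move=> x0 f0; rewrite -!ge0_integral_count//; last by move=> k; exact: mule_ge0.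
by rewrite ge0_integralZl.
Qed.

Lemma prode_ge0 (R : realType) (I : Type) (s : seq I) (f : I -> \bar R) :
  (forall i, 0 <= f i)%E -> (0 <= \prod_(i <- s) f i)%E.
Proof. by move=> f0; elim/big_ind : _ => // x y; exact: mule_ge0. Qed.

Lemma measurable_prode d (T : measurableType d) (R : realType) (I : Type)
    (s : seq I) (f : I -> T -> \bar R) :
  (forall i, measurable_fun setT (f i)) ->
  measurable_fun setT (fun w => \prod_(i <- s) f i w)%E.
Proof.
move=> mf; elim: s => [|i s IH].
  by under eq_fun do rewrite big_nil; exact: measurable_cst.
by under eq_fun do rewrite big_cons; exact: emeasurable_funM.
Qed.

Lemma measurable_nneseries d (T : measurableType d) (R : realType)
    (f : nat -> T -> \bar R) :
  (forall k, measurable_fun setT (f k)) -> (forall k w, 0 <= f k w)%E ->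
  measurable_fun setT (fun w => \sum_(k <oo) f k w)%E.
Proof.
move=> mf f0; apply: (eq_measurable_fun
    (fun w => \sum_(0 <= k <oo | k \in xpredT) f k w)%E) => //.
by apply: ge0_emeasurable_sum.
Qed.

(* [C] is the class of functions against which the events [A i k] behave as
   independent events of weights [p i k]; it is stable under the factors [phi],
   so that the indices [i] can be integrated out one at a time. *)
Lemma integral_prod_series d (T : measurableType d) (R : realType)
    (mu : {measure set T -> \bar R}) (I : eqType) (C : set (T -> \bar R))
    (A : I -> nat -> set T) (phi : I -> nat -> T -> \bar R)
    (p : I -> nat -> \bar R) (E : set T) :
  measurable E -> (forall i k, measurable (A i k)) ->
  (forall f, C f -> measurable_fun setT f /\ forall w, 0 <= f w)%E ->
  (forall i k, measurable_fun setT (phi i k)) ->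
  (forall i k w, 0 <= phi i k w)%E ->
  (forall i k f, C f -> C (fun w => f w * phi i k w)%E) ->
  (forall i k, 0 <= p i k)%E ->
  forall (l : seq I) (E' : set T) (c : \bar R),
  measurable E' -> (0 <= c)%E -> uniq l ->
  (forall f (k : I -> nat), C f ->
     \int[mu]_(w in E' `&` \bigcap_(i in [set` l]) A i (k i)) f w =
     c * (\prod_(i <- l) p i (k i)) * \int[mu]_(w in E) f w)%E ->
  forall f, C f ->
  (\int[mu]_(w in E')
     (f w * \prod_(i <- l) \sum_(k <oo) (phi i k w * (\1_(A i k) w)%:E)) =
   c * \int[mu]_(w in E)
     (f w * \prod_(i <- l) \sum_(k <oo) (p i k * phi i k w)))%E.
Proof.
move=> mE mA Cm mphi phi0 Cphi p0; elim=> [|a l IH] E' c mE' c0 ul H f Cf.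
  have := H f (fun=> 0%N) Cf; rewrite big_nil mule1.
  rewrite [X in E' `&` X](_ : _ = setT) ?setIT; last by apply/seteqP; split.
  have E1 D g : (\int[mu]_(w in D) (f w * \prod_(i <- [::]) g i w) =
      \int[mu]_(w in D) f w)%E.
    by apply: eq_integral => w _; rewrite big_nil mule1.
  by rewrite !E1.
move: ul => /= /andP[al ul].
have [mf f0] := Cm _ Cf.
have ind0 i k w : (0 <= (\1_(A i k) w : R)%:E)%E by rewrite lee_fin.
have mS (l' : seq I) : measurable_fun setT (fun w =>
    \prod_(i <- l') \sum_(k <oo) (phi i k w * (\1_(A i k) w)%:E))%E.
  apply: measurable_prode => i; apply: measurable_nneseries => k.
    apply: emeasurable_funM => //; apply/measurable_EFinP.
    exact: measurable_indic.
  by move=> w; exact: mule_ge0.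
have mS' (l' : seq I) : measurable_fun setT (fun w =>
    \prod_(i <- l') \sum_(k <oo) (p i k * phi i k w))%E.
  apply: measurable_prode => i; apply: measurable_nneseries => k.
    by apply: emeasurable_funM.
  by move=> w; exact: mule_ge0.
have S0 (l' : seq I) w :
    (0 <= \prod_(i <- l') \sum_(k <oo) (phi i k w * (\1_(A i k) w)%:E))%E.
  by apply: prode_ge0 => i; apply: nneseries_ge0 => k _ _; exact: mule_ge0.
have S0' (l' : seq I) w :
    (0 <= \prod_(i <- l') \sum_(k <oo) (p i k * phi i k w))%E.
  by apply: prode_ge0 => i; apply: nneseries_ge0 => k _ _; exact: mule_ge0.
transitivity (\int[mu]_(w in E') \sum_(k <oo) (f w * phi a k w *
   (\prod_(i <- l) \sum_(k <oo) (phi i k w * (\1_(A i k) w)%:E)) *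
   (\1_(A a k) w)%:E))%E.
  apply: eq_integral => w _; rewrite big_cons.
  rewrite muleA -ge0_nneseriesZl//; last by move=> k; exact: mule_ge0.
  rewrite muleC -ge0_nneseriesZl//; last first.
    by move=> k; apply: mule_ge0 => //; exact: mule_ge0.
  apply: eq_eseriesr => k _; rewrite muleC -!muleA; congr (_ * (_ * _))%E.
  by rewrite muleC.
rewrite integral_nneseries//; last 2 first.
- move=> k; apply: measurable_funTS; apply: emeasurable_funM.
    by apply: emeasurable_funM => //; exact: emeasurable_funM.
  by apply/measurable_EFinP; exact: measurable_indic.
- by move=> k w _; apply: mule_ge0 => //; apply: mule_ge0 => //; exact: mule_ge0.
transitivity (\sum_(k <oo) (c * (p a k * \int[mu]_(w in E)
    (f w * phi a k w *
     \prod_(i <- l) \sum_(k <oo) (p i k * phi i k w)))))%E.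
  apply: eq_eseriesr => k _.
  pose F w := (f w * phi a k w *
   (\prod_(i <- l) \sum_(k <oo) (phi i k w * (\1_(A i k) w)%:E)))%E.
  transitivity (\int[mu]_(w in E' `&` A a k) F w)%E.
    rewrite integral_mkcondr; apply: eq_integral => w _; rewrite patchE indicE.
    by case: ifP => _; rewrite ?mule1 ?mule0.
  (* The event of the first index goes into [E'] and its weight into [c]; this is why both are
     generalised in the induction. *)
  rewrite (IH _ (c * p a k)%E)//.
  - by rewrite muleA.
  - exact: measurableI.
  - exact: mule_ge0.
  - move=> f' k' Cf'.
    have := H f' (fun i => if i == a then k else k' i) Cf'.
    rewrite big_cons eqxx.
    rewrite (eq_big_seq (fun i => p i (k' i))); last first.
      by move=> i il /=; case: eqP => // ia; move: al; rewrite -ia il.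
    rewrite muleA => <-; congr integral; rewrite -setIA; congr (_ `&` _).
    apply/seteqP; split => w /=.
      move=> [Aw h] i /=; rewrite inE => /orP[/eqP ->|il]; first by rewrite eqxx.
      by case: eqP => // [->//|_]; exact: h.
    move=> h; split; first by have := h a; rewrite /= inE !eqxx; exact.
    move=> i /= il; have := h i; rewrite /= inE il orbT => /(_ isT).
    by case: eqP => // ia; move: al; rewrite -ia il.
  - exact: Cphi.
rewrite ge0_nneseriesZl//; last first.
  move=> k; apply: mule_ge0 => //; apply: integral_ge0 => w _.
  by apply: mule_ge0 => //; exact: mule_ge0.
congr (c * _)%E.
transitivity (\int[mu]_(w in E) \sum_(k <oo) (p a k * (f w * phi a k w *
     \prod_(i <- l) \sum_(k <oo) (p i k * phi i k w))))%E.
  rewrite integral_nneseries//; last 2 first.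
  - move=> k; apply: measurable_funTS; apply: emeasurable_funM => //.
    by apply: emeasurable_funM => //; exact: emeasurable_funM.
  - move=> k w _; apply: mule_ge0 => //; apply: mule_ge0 => //; exact: mule_ge0.
  apply: eq_eseriesr => k _; rewrite ge0_integralZl//.
  - apply: measurable_funTS; apply: emeasurable_funM => //.
    exact: emeasurable_funM.
  - by move=> w _; apply: mule_ge0 => //; exact: mule_ge0.
apply: eq_integral => w _; rewrite big_cons.
rewrite [RHS]muleC -muleA -[RHS]muleC -ge0_nneseriesZl//.
- apply: eq_eseriesr => k _.
  by rewrite [RHS]muleCA; congr (_ * _)%E; rewrite muleC muleA.
- exact: mule_ge0.
- by move=> k; exact: mule_ge0.
Qed.

(** For a partition enumerated with repetitions, removing the earlier sets either leaves an atom
    intact or erases it. *)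
Lemma seqDU_eq_or_disjoint (T : Type) (E : nat -> set T) n :
  (forall i j, E i = E j \/ E i `&` E j = set0) ->
  seqDU E n = E n \/ seqDU E n = set0.
Proof.
move=> H; have [[k kn Ekn]|h] := pselect (exists2 k, (k < n)%N & E k = E n).
  right; rewrite /seqDU -subset0 => w [Enw []].
  by rewrite -bigcup_mkord; exists k => //; rewrite Ekn.
left; apply/seteqP; split=> w; first by case.
move=> Enw; split => //; rewrite -bigcup_mkord => -[k /= kn Ekw].
have [e|e] := H k n; first by apply: h; exists k.
by have : (E k `&` E n) w by []; rewrite e.
Qed.

(** Serves to add up inequalities proved on each possible value of the tree up to a given
    generation. Repetitions are allowed since the enumeration of finite trees is not injective. *)
Lemma le_integral_cover d (T : measurableType d) (R : realType)
    (mu : {measure set T -> \bar R}) (E : nat -> set T) (f g : T -> \bar R) :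
  (forall n, measurable (E n)) -> mu (~` \bigcup_n E n) = 0%E ->
  (forall i j, E i = E j \/ E i `&` E j = set0) ->
  measurable_fun setT f -> measurable_fun setT g ->
  (forall w, 0 <= f w)%E -> (forall w, 0 <= g w)%E ->
  (forall n, \int[mu]_(w in E n) f w <= \int[mu]_(w in E n) g w)%E ->
  (\int[mu]_w f w <= \int[mu]_w g w)%E.
Proof.
move=> mE muE disj mf mg f0 g0 fg.
have mU : measurable (\bigcup_n E n) by exact: bigcupT_measurable.
have mDU n : measurable (seqDU E n).
  by have [->|->] := seqDU_eq_or_disjoint n disj.
have key (h : T -> \bar R) : measurable_fun setT h -> (forall w, 0 <= h w)%E ->
    (\int[mu]_w h w = \sum_(n <oo) \int[mu]_(w in seqDU E n) h w)%E.
  move=> mh h0; rewrite (ge0_negligible_integral (measurableC mU))//.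
  rewrite setTD setCK seqDU_bigcup_eq ge0_integral_bigcup//.
  exact: measurable_funTS.
rewrite !key//; apply: lee_nneseries => n _; first by rewrite integral_ge0.
have [->|->] := seqDU_eq_or_disjoint n disj; first exact: fg.
by rewrite !integral_set0.
Qed.

(** * Measurability of random points that may be absent *)

(** Has the shape of [root_events] and [cluster_events], so their measurability gives instances of
    it directly. The event that the point is absent is the complement of the case where [A] is
    [setT]. *)
Definition omeasurable d (T : measurableType d) (R : realType)
    (Y : T -> option R) : Prop :=
  forall A, measurable A -> measurable [set w | exists x, A x /\ Y w = Some x].

Lemma omeasurable_isSome d (T : measurableType d) (R : realType)
    (Y : T -> option R) :
  omeasurable Y -> measurable_fun setT (fun w => isSome (Y w)).
Proof.
move=> mY; apply: (@measurable_fun_bool _ _ _ _ true).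
rewrite setTI [X in measurable X](_ : _ =
  [set w | exists x, setT x /\ Y w = Some x]); first exact: mY.
apply/seteqP; split => w /=; last by move=> [x [_ ->]].
by case: (Y w) => // x _; exists x.
Qed.

Lemma omeasurable_odflt d (T : measurableType d) (R : realType)
    (Y : T -> option R) :
  omeasurable Y -> measurable_fun setT (fun w => odflt 0 (Y w)).
Proof.
move=> mY _ B mB; rewrite setTI.
have mS := omeasurable_isSome mY.
have -> : (fun w => odflt 0 (Y w)) @^-1` B =
    [set w | exists x, B x /\ Y w = Some x] `|`
    ((fun w => isSome (Y w)) @^-1` [set false] `&` [set w | B 0]).
  apply/seteqP; split => w /=.
    by case: (Y w) => [x|] /= Bx; [left; exists x|right].
  by case=> [[x [Bx ->]]//|]; case: (Y w) => [x []//|[_]].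
apply: measurableU; first exact: mY.
apply: measurableI; first by rewrite -[X in measurable X]setTI; exact: mS.
have [B0|nB0] := pselect (B 0).
  by rewrite [X in measurable X](_ : _ = setT)//; apply/seteqP; split.
by rewrite [X in measurable X](_ : _ = set0)//; apply/seteqP; split.
Qed.

Lemma omeasurable_oapp d (T : measurableType d) d' (T' : measurableType d')
    (R : realType) (Y : T -> option R) (c : R -> T') (z : T') :
  omeasurable Y -> measurable_fun setT c ->
  measurable_fun setT (fun w => oapp c z (Y w)).
Proof.
move=> mY mc; rewrite [X in measurable_fun _ X](_ : _ =
  fun w => if isSome (Y w) then c (odflt 0 (Y w)) else z); last first.
  by apply/funext => w; case: (Y w).
apply: measurable_fun_ifT => //; first exact: omeasurable_isSome.
by apply: measurableT_comp => //; exact: omeasurable_odflt.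
Qed.

(** * Poisson masses and their generating function *)

(** Rate 0 fits the same formula: since [0 ^+ 0] is 1, the right-hand side is then the Dirac mass at
    0. *)
Lemma poisson_massE (R : realType) (rate : R) k : 0 <= rate ->
  poisson_mass rate k = ((rate ^+ k) * k`!%:R^-1 * expR (- rate))%:E.
Proof.
rewrite /poisson_mass /poisson_prob le_eqVlt => /predU1P[<-|r0].
  rewrite ltxx diracE oppr0 expR0 mulr1.
  case: k => [|k]; first by rewrite expr0 fact0 invr1 mulr1 mem_set.
  by rewrite exprS !mul0r memNset.
by rewrite r0 esum_set1 ?lee_fin ?poisson_pmf_ge0// /poisson_pmf r0.
Qed.

Lemma poisson_mass_ge0 (R : realType) (rate : R) k : (0 <= poisson_mass rate k)%E.
Proof. exact: measure_ge0. Qed.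

Lemma poisson_mass_generating (R : realType) (rate x : R) :
  0 <= rate -> 0 <= x ->
  (\sum_(k <oo) (poisson_mass rate k * (x ^+ k)%:E) =
   (expR (rate * (x - 1)))%:E)%E.
Proof.
move=> r0 x0.
under eq_eseriesr => k _.
  rewrite poisson_massE// -EFinM mulrAC [X in X * _]mulrAC -exprMn mulrC EFinM.
  over.
rewrite ge0_nneseriesZl; last 2 first.
- by rewrite lee_fin expR_ge0.
- by move=> k; rewrite lee_fin divr_ge0// exprn_ge0// mulr_ge0.
rewrite mulrBr mulr1 addrC expRD EFinM; congr (_ * _)%E.
transitivity (limn (EFin \o series (exp_coeff (rate * x)))).
  apply/congr_lim/funext => n /=.
  by rewrite /series /= -sumEFin; apply: eq_bigr.
by rewrite EFin_lim//; exact: is_cvg_series_exp_coeff.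
Qed.

(** * Powers of a matrix of spectral radius less than one *)

(** The gap between [c] and [r] absorbs the polynomial factors that repeated eigenvalues create. *)
Lemma affine_recurrence_le (R : realType) (x : nat -> R) (c K r : R) :
  0 <= c -> c < r -> 0 <= K -> (forall n, x n.+1 <= K * r ^+ n + c * x n) ->
  exists2 K', 0 <= K' & forall n, x n <= K' * r ^+ n.
Proof.
move=> c0 cr K0 xS.
have rc0 : 0 < r - c by rewrite subr_gt0.
have r0 : 0 < r by exact: le_lt_trans cr.
(* Stability of the bound requires [K + c * K' <= r * K'], that is [K' >= K / (r - c)]; the other
   summand takes care of [x 0]. *)
pose K' := Num.max 0 (x 0%N) + K / (r - c).
have K'0 : 0 <= K' by rewrite addr_ge0 ?le_max ?lexx// divr_ge0// ltW.
exists K' => //; elim=> [|n IH].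
  by rewrite expr0 mulr1 ler_wpDr ?le_max ?lexx ?orbT// divr_ge0// ltW.
rewrite (le_trans (xS n))// exprS.
rewrite (@le_trans _ _ (K * r ^+ n + c * (K' * r ^+ n)))//.
  by rewrite lerD2l ler_wpM2l.
rewrite mulrA -mulrDl mulrA ler_wpM2r ?exprn_ge0 ?(ltW r0)//.
rewrite -lerBrDr [K' * r]mulrC -mulrBl -ler_pdivrMl// mulrC /K'.
by rewrite ler_wpDl// le_max lexx.
Qed.

Section spectral_radius.
Local Open Scope complex_scope.

(* By Cayley-Hamilton the product of the [A - z] over the eigenvalues vanishes;
   its factors are removed one at a time, the entries of [A ^+ n * B] obeying an
   affine recurrence of ratio [z]. *)
Lemma complex_power_bound (R : realType) (M' : nat) (A : 'M[R[i]]_M'.+1) (r : R)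
    (s : seq R[i]) :
  0 < r -> (forall z, z \in s -> Normc.normc z < r) ->
  forall B : 'M[R[i]]_M'.+1,
  horner_mx A (\prod_(z <- s) ('X - z%:P)) * B = 0 ->
  forall a b, exists2 K : R, 0 <= K &
    forall n, Normc.normc ((A ^+ n * B) a b) <= K * r ^+ n.
Proof.
move=> r0; elim: s => [|z s IH] sr B.
  rewrite big_nil rmorph1 mul1r => -> a b; exists 0 => // n.
  by rewrite mulr0 mxE Normc.normc0 mul0r.
rewrite big_cons rmorphM -comm_horner_mx2 -mulrA => h a b.
have sr' y : y \in s -> Normc.normc y < r.
  by move=> ys; apply: sr; rewrite inE ys orbT.
have [K K0 HK] := IH sr' _ h a b.
apply: (@affine_recurrence_le R _ (Normc.normc z) K r) => //.
- by case: (z) => x y; exact: sqrtr_ge0.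
- by apply: sr; rewrite inE eqxx.
- move=> n; rewrite (le_trans _ (lerD (HK n) (lexx _)))//.
  rewrite -Normc.normcM (le_trans _ (le_normcD _ _))//.
  suff -> : A ^+ n.+1 * B =
      A ^+ n * (horner_mx A ('X - z%:P) * B) + z *: (A ^+ n * B).
    by rewrite !mxE.
  rewrite rmorphB /= horner_mx_X horner_mx_C mulrBl mulrBr exprSr mulrA.
  by rewrite -[z%:M * B]/(z%:M *m B) mul_scalar_mx -scalerAr subrK.
Qed.

Lemma spectral_radius_lt1_powers (R : realType) (M : nat) (H : 'M[R]_M) :
  (0 < M)%N -> spectral_radius H < 1 ->
  exists r K : R, [/\ 0 < r < 1, 0 <= K &
    forall n, opnorm_inf (H ^+ n) <= K * r ^+ n].
Proof.
case: M H => // M' H _ rho1.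
pose A := map_mx (real_complex R) H.
have [s Es] := closed_field_poly_normal (char_poly A).
have Ps : char_poly A = \prod_(z <- s) ('X - z%:P).
  by rewrite {1}Es (monicP (char_poly_monic A)) scale1r.
have s_rho z : z \in s -> Normc.normc z <= spectral_radius H.
  move=> zs; apply: ub_le_sup; last first.
    by exists z => //=; rewrite eigenvalue_root_char Ps root_prod_XsubC.
  (* The supremum in [spectral_radius] is meaningful only for a bounded set: the sum of the moduli
     of all roots is an upper bound. *)
  exists (\sum_(y <- s) Normc.normc y) => _ [y /= + <-].
  rewrite eigenvalue_root_char -/A Ps root_prod_XsubC => ys.
  rewrite (big_rem y)//= lerDl sumr_ge0// => t _.
  by case: t => t u; exact: sqrtr_ge0.
(* A midpoint, so that [r] stays below 1 and strictly above every eigenvalue in modulus; it is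
   positive even for a nilpotent matrix. *)
pose r := (1 + Num.max 0 (spectral_radius H)) / 2.
have m0 : 0 <= Num.max 0 (spectral_radius H) by rewrite le_max lexx.
have m1 : Num.max 0 (spectral_radius H) < 1 by rewrite gt_max ltr01.
have mr : Num.max 0 (spectral_radius H) < r by rewrite /r; lra.
have r0 : 0 < r by rewrite /r; lra.
have r1 : r < 1 by rewrite /r; lra.
have sr z : z \in s -> Normc.normc z < r.
  move=> zs; apply: le_lt_trans mr; apply: (le_trans (s_rho z zs)).
  by rewrite le_max lexx orbT.
have key a b : exists K : R, 0 <= K /\ forall n, `|(H ^+ n) a b| <= K * r ^+ n.
  have [|K K0 HK] := @complex_power_bound R M' A r s r0 sr 1 _ a b.
    by rewrite mulr1 -Ps Cayley_Hamilton.
  exists K; split => // n; apply: le_trans (HK n).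
  rewrite mulr1 -rmorphXn /= mxE /= expr0n /= addr0 sqrtr_sqr.
  exact: lexx.
have /choice[K HK] : forall ab : 'I_M'.+1 * 'I_M'.+1, exists K : R,
    0 <= K /\ forall n, `|(H ^+ n) ab.1 ab.2| <= K * r ^+ n.
  by move=> [a b]; exact: key.
(* The sum of the constants of all entries dominates the sum over any single row. *)
exists r, (\sum_a \sum_b K (a, b)); split; first by rewrite r0.
  by rewrite sumr_ge0// => a _; rewrite sumr_ge0// => b _; have [] := HK (a, b).
move=> n; apply: bigmax_le => [|i _].
  rewrite mulr_ge0 ?exprn_ge0 ?(ltW r0)//.
  by rewrite sumr_ge0// => a _; rewrite sumr_ge0// => b _; have [] := HK (a, b).
rewrite [X in _ <= X * _](bigD1 i)//= mulrDl mulr_suml ler_wpDr//.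
  rewrite mulr_ge0 ?exprn_ge0 ?(ltW r0)//.
  by rewrite sumr_ge0// => a _; rewrite sumr_ge0// => b _; have [] := HK (a, b).
by apply: ler_sum => b _; have [_] := HK (i, b); exact.
Qed.
End spectral_radius.

(** * The recursion for log-moments *)

(** From [exp(-x) >= 1 - x] one gets [exp x - 1 <= x exp x], and [exp x] is at most [rho] on the
    range considered. *)
Lemma expR_sub1_le (R : realType) (x u rho : R) :
  0 <= x -> x <= u -> expR u <= rho -> expR x - 1 <= rho * x.
Proof.
move=> x0 xu urho; have h := expR_ge1Dx (- x).
rewrite (@le_trans _ _ (expR x * x))//; last first.
  by rewrite ler_wpM2r// (le_trans _ urho)// ler_expR.
have e0 := expR_gt0 x.
have : expR x * expR (- x) = 1 by rewrite -expRD subrr expR0.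
move: h e0; set e := expR x; set f := expR (- x); nra.
Qed.

(** The graph of the convex function [exp - 1] lies below its chord over [[0, u]]. The slope
    [(expR u - 1) / u] later cancels against the bound [L * u] for the integral of a log-moment,
    which leaves [L * (expR u - 1)]. *)
Lemma expR_sub1_chord (R : realType) (x u : R) :
  0 <= x -> x <= u -> 0 < u -> expR x - 1 <= (expR u - 1) / u * x.
Proof.
move=> x0 xu u0.
have t01 : (0 <= x / u <= 1)%R.
  by rewrite divr_ge0 ?(ltW u0)//= ler_pdivrMr// mul1r.
have t0 : 0 <= x / u by case/andP: t01.
have t1 : x / u <= 1 by case/andP: t01.
pose t : {i01 R} := Itv01 t0 t1.
have := convex_expR t u 0.
rewrite !convRE /= mulr0 addr0 divfK ?gt_eqF// expR0 mulr1 => h.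
rewrite lerBlDr (le_trans h)// /onem.
suff -> : x / u * expR u + (1 - x / u) = (expR u - 1) / u * x + 1 by [].
by ring.
Qed.

Lemma lebesgue_measure_translate (R : realType) (c : R) (A : set R) :
  measurable A ->
  lebesgue_measure ((fun x => x + c) @^-1` A) = lebesgue_measure A.
Proof.
move=> mA; have mc : measurable_fun setT
    ((fun x => x + c) : measurableTypeR R -> measurableTypeR R).
  by apply: measurable_funD.
pose m := measure_function_pushforward__canonical__measure_function_Measure
    (@lebesgue_measure R) mc.
apply/esym/(@lebesgue_measure_unique R m) => // _ [[a b]] _ <-.
rewrite -[m _]/(lebesgue_measure ((fun x => x + c) @^-1` `]a, b]%classic)).
rewrite (_ : _ @^-1` _ = `]a - c, b - c]%classic); last first.
  by apply/seteqP; split => x /=; rewrite !in_itv/= ltrBlDr lerBrDr.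
rewrite /= !lebesgue_measure_itv/= !lte_fin ltrD2r; case: ifPn => // _.
by rewrite -!EFinD; congr EFin; ring.
Qed.

Lemma ge0_integral_translate (R : realType) (f : R -> \bar R) (c : R) :
  measurable_fun setT f -> (forall x, 0 <= f x)%E ->
  (\int[lebesgue_measure]_x f (x + c)%R = \int[lebesgue_measure]_x f x)%E.
Proof.
move=> mf f0.
have mc : measurable_fun setT
    ((fun x => x + c) : measurableTypeR R -> measurableTypeR R).
  by apply: measurable_funD.
pose m := measure_function_pushforward__canonical__measure_function_Measure
    (@lebesgue_measure R) mc.
transitivity (\int[m]_x f x)%E; last first.
  by apply: eq_measure_integral => A mA _; exact: lebesgue_measure_translate.
by rewrite ge0_integral_pushforward.
Qed.

(** Exponential formula for the children of an individual born at [y]: they form a Poisson process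
    with intensity [k t] at [y + t], and a child born at [y + t] contributes a factor with logarithm
    [f (y + t)]. *)
Definition kernel_integral (R : realType) (k f : R -> R) (y : R) : \bar R :=
  (\int[lebesgue_measure]_t (k t * (expR (f (y + t)) - 1))%:E)%E.

Section kernel_integral.
Context (R : realType) (k f : R -> R).
Hypothesis mk : measurable_fun setT k.
Hypothesis k0 : forall t, 0 <= k t.
Hypothesis mf : measurable_fun setT f.
Hypothesis f0 : forall t, 0 <= f t.

Local Notation leb := (@lebesgue_measure R).

Let e0 y : 0 <= expR (f y) - 1.
Proof. by rewrite subr_ge0 -expR0 ler_expR. Qed.

Let mkE : measurable_fun setT (fun t => (k t)%:E).
Proof. exact/measurable_EFinP. Qed.

Let mfE : measurable_fun setT (fun y => (expR (f y) - 1)%:E).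
Proof.
by apply/measurable_EFinP; apply: measurable_funB => //; exact: measurableT_comp.
Qed.

Let phi (yt : R * R) := (k yt.2 * (expR (f (yt.1 + yt.2)) - 1))%:E.

Let mphi : measurable_fun setT phi.
Proof.
apply/measurable_EFinP; apply: measurable_funM.
  by apply: measurableT_comp.
apply: measurable_funB => //; apply: measurableT_comp => //.
by apply: (measurableT_comp mf); exact: measurable_funD.
Qed.

Let phi0 z : (0 <= phi z)%E.
Proof. by rewrite lee_fin mulr_ge0. Qed.

Lemma kernel_integral_ge0 y : (0 <= kernel_integral k f y)%E.
Proof. by apply: integral_ge0 => t _; rewrite lee_fin mulr_ge0. Qed.

Lemma measurable_kernel_integral : measurable_fun setT (kernel_integral k f).
Proof.
exact: (@measurable_fun_fubini_tonelli_F _ _ _ _ R leb phi mphi phi0).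
Qed.

Lemma kernel_integral_le y c : (forall t, expR (f t) - 1 <= c) ->
  (kernel_integral k f y <= c%:E * \int[leb]_t (k t)%:E)%E.
Proof.
move=> fc; have c0 : 0 <= c by rewrite (le_trans (e0 0)).
rewrite -ge0_integralZl//; last by move=> t _; rewrite lee_fin.
apply: ge0_le_integral => //.
- by move=> t _; rewrite lee_fin mulr_ge0.
- exact: (measurableT_comp mphi (pair1_measurable y)).
- exact: (emeasurable_funM (measurable_cst c%:E) mkE).
- by move=> t _; rewrite -EFinM lee_fin mulrC ler_wpM2r.
Qed.

(** After the order of integration is exchanged, the inner integral over [y] does not depend on [t],
    by translation invariance of Lebesgue measure. *)
Lemma integral_kernel_integral :
  (\int[leb]_y kernel_integral k f y =
   \int[leb]_t (k t)%:E * \int[leb]_y (expR (f y) - 1)%:E)%E.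
Proof.
have D0 : (0 <= \int[leb]_y (expR (f y) - 1)%:E)%E.
  by apply: integral_ge0 => y _; rewrite lee_fin.
transitivity (\int[leb]_t \int[leb]_y phi (y, t))%E.
  exact: (@fubini_tonelli _ _ _ _ R leb leb phi mphi phi0).
rewrite -ge0_integralZr//; last by move=> t _; rewrite lee_fin.
apply: eq_integral => t _; rewrite /phi /=; under eq_integral do rewrite EFinM.
rewrite ge0_integralZl//.
- by rewrite (@ge0_integral_translate R (fun y => (expR (f y) - 1)%:E)).
- apply: (measurableT_comp mfE (f := fun y => (expR (f y) - 1)%:E)).
  exact: measurable_funD.
- by move=> y _; rewrite lee_fin.
- by rewrite lee_fin.
Qed.

End kernel_integral.

(* [log_moment n i y] dominates the logarithm of the exponential moment of the
   number of points in [B] of the first [n] generations of a cluster whose root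
   has type [i] and is born at [y]. *)
Fixpoint log_moment (R : realType) (M : nat) (k : 'I_M -> 'I_M -> R -> R)
    (a : R) (B : set R) (n : nat) (i : 'I_M) (y : R) : R :=
  if n is n'.+1 then a * \1_B y +
    \sum_j fine (kernel_integral (k i j) (log_moment k a B n' j) y)
  else 0.

(** The recursion of [log_moment] with the indicator replaced by 1 and [exp(x) - 1] by [rho * x]. It
    no longer depends on the birth date. *)
Fixpoint linear_bound (R : realType) (M : nat) (H : 'M[R]_M) (a rho : R)
    (n : nat) (i : 'I_M) : R :=
  if n is n'.+1 then a + rho * \sum_j H i j * linear_bound H a rho n' j else 0.

Section log_moment.
Context (R : realType) (M : nat) (H : 'M[R]_M) (k : 'I_M -> 'I_M -> R -> R).
Context (a rho u L : R) (B : set R).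
Hypothesis mk : forall i j, measurable_fun setT (k i j).
Hypothesis k0 : forall i j t, 0 <= k i j t.
Hypothesis kH : forall i j,
  (\int[lebesgue_measure]_t (k i j t)%:E = (H i j)%:E)%E.
Hypothesis a0 : 0 <= a.
Hypothesis mB : measurable B.
Hypothesis L0 : 0 <= L.
Hypothesis BL : (lebesgue_measure B <= L%:E)%E.
Hypothesis rho0 : 0 <= rho.
Hypothesis urho : expR u <= rho.
Hypothesis bound_u : forall n i, linear_bound H a rho n i <= u.

Local Notation lam := (log_moment k a B).
Local Notation g := (linear_bound H a rho).
Local Notation leb := (@lebesgue_measure R).

Let H0 i j : 0 <= H i j.
Proof. by rewrite -lee_fin -kH integral_ge0// => t _; rewrite lee_fin. Qed.

(** The linear bound on [exp(x) - 1] is licit only below [u], which the bound at rank [n] guarantees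
    for rank [n.+1]. The same bound makes the kernel integrals finite, so that [fine] loses nothing
    in the recursion. *)
Lemma log_moment_facts n : forall i, measurable_fun setT (lam n i) /\
  forall y, 0 <= lam n i y <= g n i.
Proof.
elim: n => [|n IH] i; first by split => [|y] //=; rewrite lexx.
have ml j := (IH j).1.
have lam0 j y : 0 <= lam n j y by have /andP[] := (IH j).2 y.
have lamg j y : lam n j y <= g n j by have /andP[] := (IH j).2 y.
have int_le j y :
    (kernel_integral (k i j) (lam n j) y <= (H i j * (rho * g n j))%:E)%E.
  rewrite mulrC EFinM -kH; apply: kernel_integral_le => // t.
  apply: (@le_trans _ _ (rho * lam n j t)); last by rewrite ler_wpM2l.
  by apply: (@expR_sub1_le _ _ u) => //; rewrite (le_trans (lamg _ _)).
split.
  apply: measurable_funD.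
    by apply: measurable_funM => //; exact: measurable_indic.
  apply: measurable_sum => j; apply: measurableT_comp => //.
  exact: measurable_kernel_integral.
move=> y /=; apply/andP; split.
  rewrite addr_ge0// ?mulr_ge0// sumr_ge0// => j _; apply: fine_ge0.
  exact: kernel_integral_ge0.
apply: lerD.
  by rewrite -[leRHS]mulr1 ler_wpM2l// indicE; case: (_ \in _).
rewrite mulr_sumr; apply: ler_sum => j _; rewrite mulrCA.
rewrite -lee_fin fineK ?int_le// ge0_fin_numE ?kernel_integral_ge0//.
by rewrite (le_lt_trans (int_le _ _))// ltry.
Qed.

Lemma measurable_log_moment n i : measurable_fun setT (lam n i).
Proof. exact: (log_moment_facts n i).1. Qed.

Lemma log_moment_ge0 n i y : 0 <= lam n i y.
Proof. by have /andP[] := (log_moment_facts n i).2 y. Qed.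

Lemma log_moment_le n i y : lam n i y <= u.
Proof. by have /andP[_ /le_trans] := (log_moment_facts n i).2 y; exact. Qed.

Let mlamE n i : measurable_fun setT (fun y => (lam n i y)%:E).
Proof. by apply/measurable_EFinP; exact: measurable_log_moment. Qed.

Let mclamE c n i : measurable_fun setT (fun y => c%:E * (lam n i y)%:E)%E.
Proof. by apply: emeasurable_funM => //; exact: mlamE. Qed.

Let mexplamE n i : measurable_fun setT (fun y => (expR (lam n i y) - 1)%:E).
Proof.
apply/measurable_EFinP; apply: measurable_funB => //.
by apply: measurableT_comp => //; exact: measurable_log_moment.
Qed.

Lemma kernel_integral_fin n i j y :
  kernel_integral (k i j) (lam n j) y \is a fin_num.
Proof.
have l0 := @log_moment_ge0 n j.
rewrite ge0_fin_numE; last exact: kernel_integral_ge0.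
apply: le_lt_trans (kernel_integral_le (c := expR u) _ _ _ _ y _) _ => //.
- exact: measurable_log_moment.
- by move=> t; rewrite lerBlDr ler_wpDr// ler_expR log_moment_le.
- by rewrite kH -EFinM ltry.
Qed.

(** The induction of [log_moment_facts] in the L1 norm instead of the sup norm: integration against
    the kernel costs the same factor [H i j] in both, and the indicator of [B] now costs [L] instead
    of 1. *)
Lemma integral_log_moment_le n i :
  (\int[leb]_y (lam n i y)%:E <= (L * g n i)%:E)%E.
Proof.
elim: n i => [|n IH] i; first by rewrite /= mulr0 integral0.
have ml j := measurable_log_moment n j.
have l0 j := @log_moment_ge0 n j.
have mI j : measurable_fun setT (kernel_integral (k i j) (lam n j)).
  exact: measurable_kernel_integral.
have I0 j y : (0 <= kernel_integral (k i j) (lam n j) y)%E.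
  exact: kernel_integral_ge0.
have m1B : measurable_fun setT (fun y : R => (\1_B y)%:E : \bar R).
  by apply/measurable_EFinP; exact: measurable_indic.
have ma1B : measurable_fun setT (fun y : R => a%:E * (\1_B y)%:E : \bar R)%E.
  exact: emeasurable_funM.
have -> : (\int[leb]_y (lam n.+1 i y)%:E = \int[leb]_y (a%:E * (\1_B y)%:E +
  \sum_j kernel_integral (k i j) (lam n j) y))%E.
  apply: eq_integral => y _; rewrite /= EFinD EFinM -sumEFin.
  congr (_ + _)%E; apply: eq_bigr => j _.
  by rewrite fineK// kernel_integral_fin.
rewrite ge0_integralD//; last 3 first.
- by move=> y _; rewrite mule_ge0// lee_fin.
- by move=> y _; rewrite sume_ge0.
- exact: emeasurable_sum.
rewrite mulrDr EFinD; apply: leeD.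
  rewrite ge0_integralZl//.
  by rewrite integral_indic// setIT mulrC EFinM lee_wpmul2l.
rewrite ge0_integral_sum// mulrCA mulr_sumr mulr_sumr -sumEFin.
apply: lee_sum => j _; rewrite integral_kernel_integral// kH.
have swap x : rho * (L * (H i j * x)) = H i j * (rho * (L * x)) by ring.
rewrite swap EFinM lee_wpmul2l ?lee_fin//.
apply: (@le_trans _ _ (rho%:E * \int[leb]_y (lam n j y)%:E)%E); last first.
  by rewrite [X in (_ <= X)%E]EFinM lee_wpmul2l ?lee_fin.
rewrite -ge0_integralZl//; last 2 first.
- exact: mlamE.
- by move=> y _; rewrite lee_fin.
apply: ge0_le_integral => //.
- by move=> y _; rewrite lee_fin subr_ge0 -expR0 ler_expR.
- exact: mexplamE.
- exact: mclamE.
- move=> y _; rewrite -EFinM lee_fin; apply: (@expR_sub1_le _ _ u) => //.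
  exact: log_moment_le.
Qed.

Lemma integral_expR_log_moment_le n i :
  (\int[leb]_y (expR (lam n i y) - 1)%:E <= (L * (expR u - 1))%:E)%E.
Proof.
have u0 : 0 <= u by apply: le_trans (bound_u 0 i).
(* The chord has no slope at [u = 0], but there all log-moments vanish. *)
move: u0; rewrite le_eqVlt => /predU1P[u0|u0].
  rewrite integral0_eq ?lee_fin; last first.
    move=> y _; suff -> : lam n i y = 0 by rewrite expR0 subrr.
    by apply/eqP; rewrite eq_le log_moment_ge0 {1}u0 log_moment_le.
  by rewrite mulr_ge0// -u0 expR0 subrr.
have c0 : 0 <= (expR u - 1) / u.
  by rewrite divr_ge0 ?(ltW u0)// subr_ge0 -expR0 ler_expR ltW.
have ml := measurable_log_moment n i.
have l0 := @log_moment_ge0 n i.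
apply: (@le_trans _ _ (((expR u - 1) / u)%:E * \int[leb]_y (lam n i y)%:E)%E).
  rewrite -ge0_integralZl//; last 2 first.
  - exact: mlamE.
  - by move=> y _; rewrite lee_fin.
  apply: ge0_le_integral => //.
  - by move=> y _; rewrite lee_fin subr_ge0 -expR0 ler_expR.
  - exact: mexplamE.
  - exact: mclamE.
  - move=> y _; rewrite -EFinM lee_fin; apply: expR_sub1_chord => //.
    exact: log_moment_le.
apply: (@le_trans _ _ (((expR u - 1) / u)%:E * (L * g n i)%:E)%E).
  by rewrite lee_wpmul2l ?lee_fin// integral_log_moment_le.
rewrite -EFinM lee_fin mulrCA ler_wpM2l//.
apply: (@le_trans _ _ ((expR u - 1) / u * u)); first by rewrite ler_wpM2l.
by rewrite divfK// gt_eqF.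
Qed.

End log_moment.

(** * Clusters: labels, births and displacements *)

Definition density_law (R : realType) (g : R -> R) (A : set R) : \bar R :=
  (\int[lebesgue_measure]_(x in A) (g x)%:E)%E.

Section density.
Context (R : realType) (g : R -> R).
Hypothesis mg : measurable_fun setT g.
Hypothesis g0 : forall x, 0 <= g x.

Let density_law0 : density_law g set0 = 0.
Proof. by rewrite /density_law integral_set0. Qed.

Let density_law_ge0 A : (0 <= density_law g A)%E.
Proof. by apply: integral_ge0 => x _; rewrite lee_fin. Qed.

Let mgE : measurable_fun setT (fun x => (g x)%:E).
Proof. exact/measurable_EFinP. Qed.

Let density_law_sigma_additive : semi_sigma_additive (density_law g).
Proof.
move=> F mF tF mUF; rewrite /density_law ge0_integral_bigcup//; last 2 first.
- exact: (measurable_funTS mgE).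
- by move=> x _; rewrite lee_fin.
by apply: is_cvg_nneseries => n _ _; exact: density_law_ge0.
Qed.

Definition density_measure : {measure set R -> \bar R} :=
  HB.pack_for {measure set R -> \bar R} (density_law g)
    (isMeasure.Build _ _ _ (density_law g)
      density_law0 density_law_ge0 density_law_sigma_additive).

Import HBNNSimple.

(** Indicators first, then simple functions by linearity, then monotone convergence. *)
Lemma ge0_integral_density (f : R -> \bar R) :
  measurable_fun setT f -> (forall x, 0 <= f x)%E ->
  (\int[density_measure]_x f x =
   \int[lebesgue_measure]_x (f x * (g x)%:E))%E.
Proof.
move=> mf f0.
have fg0 (c : R) (A : set R) x : 0 <= c -> (0 <= (c * \1_A x)%:E * (g x)%:E)%E.
  by move=> c0; rewrite -EFinM lee_fin mulr_ge0// mulr_ge0.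
pose f_ := nnsfun_approx measurableT mf.
have m_f n : measurable_fun setT (fun x : R => (f_ n x)%:E).
  exact/measurable_EFinP/measurable_funP.
have m_fg n : measurable_fun setT (fun x : R => (f_ n x)%:E * (g x)%:E)%E.
  exact: emeasurable_funM.
have key n : (\int[density_measure]_x (f_ n x)%:E =
    \int[lebesgue_measure]_x ((f_ n x)%:E * (g x)%:E))%E.
  have m1 r : measurable_fun setT (fun x : R => (r * \1_(f_ n @^-1` [set r]) x)%:E).
    by apply/measurable_EFinP; apply: measurable_funM => //; exact: measurable_indic.
  have m1' r : measurable_fun setT (fun x : R => (\1_(f_ n @^-1` [set r]) x)%:E : \bar R).
    by apply/measurable_EFinP; exact: measurable_indic.
  have pos r x : (0 <= (r * \1_(f_ n @^-1` [set r]) x)%:E)%E.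
    exact: nnfun_muleindic_ge0.
  transitivity (\sum_(r \in range (f_ n)) \int[density_measure]_x
      (r * \1_(f_ n @^-1` [set r]) x)%:E)%E.
    rewrite -ge0_integral_fsum//.
    by apply: eq_integral => x _; rewrite fimfunE -fsumEFin.
  transitivity (\sum_(r \in range (f_ n)) \int[lebesgue_measure]_x
      ((r * \1_(f_ n @^-1` [set r]) x)%:E * (g x)%:E))%E; last first.
    rewrite -ge0_integral_fsum//; last 2 first.
    - by move=> r; exact: (emeasurable_funM (m1 r) mgE).
    - by move=> r x _; apply: mule_ge0 => //; rewrite lee_fin.
    apply: eq_integral => x _; rewrite fimfunE -fsumEFin//.
    by rewrite ge0_mule_fsuml.
  apply: eq_fsbigr => r /[!inE] -[x0 _ fx0].
  have r0 : 0 <= r by rewrite -fx0 fun_ge0.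
  rewrite integralZl_indic_nnsfun// integral_indic// setIT.
  under eq_integral do rewrite EFinM -muleA.
  rewrite ge0_integralZl//; last 2 first.
  - exact: (emeasurable_funM (m1' r) mgE).
  - by move=> x _; rewrite -EFinM lee_fin mulr_ge0.
  congr (_ * _)%E; rewrite /= /density_law integral_mkcond.
  apply: eq_integral => x _; rewrite patchE indicE.
  by case: ifP => _; rewrite ?mul1e ?mul0e.
transitivity (limn (fun n => \int[density_measure]_x (f_ n x)%:E))%E.
  rewrite -monotone_convergence//.
  - apply: eq_integral => x _; apply/esym/cvg_lim => //.
    exact: cvg_nnsfun_approx.
  - by move=> n x _; rewrite lee_fin.
  - by move=> x _ m n mn; rewrite lee_fin; exact/lefP/nd_nnsfun_approx.
under eq_fun do rewrite key.
rewrite -monotone_convergence//.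
- apply: eq_integral => x _; apply/cvg_lim => //.
  by apply: cvgeZr => //; exact: cvg_nnsfun_approx.
- by move=> n x _; rewrite -EFinM lee_fin mulr_ge0.
- move=> x _ m n mn; rewrite lee_wpmul2r// lee_fin//.
  by have /lefP/(_ x) := nd_nnsfun_approx measurableT mf mn.
Qed.

End density.

(** The value 0 off the tree allows sums over arbitrary lists of labels. *)
Definition cval (R : realType) (M : nat) (g : Defs.cluster R M) (u : label)
    (c : 'I_M -> R -> R) : R :=
  if g u is Some (m, b) then c m b else 0.

Definition typed_birth (R : realType) (M : nat) (T : Type) (G : T -> Defs.cluster R M)
    (u : label) (m : 'I_M) (w : T) : option R :=
  if G w u is Some (m', b) then if m' == m then Some b else None else None.

Definition translate_cluster (R : realType) (M : nat) (g : Defs.cluster R M) (x : R) :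
  Defs.cluster R M := fun u => omap (fun mb => (mb.1, x + mb.2)) (g u).

Section cluster_measurability.
Context (R : realType) (M : nat) (d : measure_display) (T : measurableType d).
Context (G : T -> Defs.cluster R M).
Hypothesis mG : cluster_events G `<=` measurable.

Lemma omeasurable_typed_birth u m : omeasurable (typed_birth G u m).
Proof.
move=> A mA; apply: mG; exists u, m, A; split => //.
apply/seteqP; split => w [b [Ab]]; rewrite /typed_birth /=.
  case E : (G w u) => [[m' b']|] //; case: eqP => // e [e'].
  by exists b; rewrite e e'.
by move=> E; exists b; rewrite E eqxx.
Qed.

Lemma measurable_cval u (c : 'I_M -> R -> R) :
  (forall m, measurable_fun setT (c m)) ->
  measurable_fun setT (fun w => cval (G w) u c).
Proof.
move=> mc; rewrite [X in measurable_fun _ X](_ : _ =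
    (fun w => \sum_m oapp (c m) 0 (typed_birth G u m w))); last first.
  apply/funext => w; rewrite /cval /typed_birth.
  case: (G w u) => [[m b]|]; last by rewrite big1.
  rewrite (bigD1 m)//= eqxx big1 ?addr0// => j /negbTE.
  by rewrite eq_sym => ->.
apply: measurable_sum => m; apply: omeasurable_oapp => //.
exact: omeasurable_typed_birth.
Qed.

Lemma typed_tree_events_sub : typed_tree_events G `<=` cluster_events G.
Proof.
move=> _ [u [m ->]]; exists u, m, setT; split => //.
apply/seteqP; split => w; rewrite /ctype /=.
  by case: (G w u) => // -[m' b] [<-]; exists b.
by move=> [b [_ ->]].
Qed.

Lemma measurable_typed_tree E :
  <<s typed_tree_events G >> E -> measurable E.
Proof.
apply: (smallest_sub (@sigma_algebra_measurable _ T)) => A /typed_tree_events_sub.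
exact: mG.
Qed.

(** The map [f] allows the cluster and the translation to be read off different coordinates of a
    product space. *)
Lemma translate_cluster_measurable d' (T' : measurableType d') (f : T' -> T)
    (x : T' -> R) :
  measurable_fun setT f -> measurable_fun setT x ->
  cluster_events (fun w => translate_cluster (G (f w)) (x w)) `<=` measurable.
Proof.
move=> mf mx _ [u [m [A [mA ->]]]].
have mY : omeasurable (typed_birth G u m \o f).
  move=> B mB; have := omeasurable_typed_birth u m mB.
  by move=> /(mf measurableT); rewrite setTI.
rewrite [X in measurable X](_ : _ =
  ((fun w => isSome (typed_birth G u m (f w))) @^-1` [set true]) `&`
  ((fun w => x w + odflt 0 (typed_birth G u m (f w))) @^-1` A)).
  apply: measurableI.
    by rewrite -[X in measurable X]setTI; apply: (omeasurable_isSome mY).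
  rewrite -[X in measurable X]setTI; apply: measurable_funD => //.
  exact: (omeasurable_odflt mY).
apply/seteqP; split => w /=; rewrite /typed_birth /translate_cluster.
  case: (G (f w) u) => [[m' b']|] [b [Ab]] //= -[e e'].
  by rewrite e eqxx /= e'.
case: (G (f w) u) => [[m' b']|] [] //=; case: eqP => // -> _ /= Ab.
by exists (x w + b').
Qed.

End cluster_measurability.

Definition child (p : label * nat) : label := rcons p.1 p.2.

Definition birth (R : realType) (M : nat) (g : Defs.cluster R M) (u : label) : R :=
  cval g u (fun=> id).

Definition displacement (R : realType) (M : nat) (g : Defs.cluster R M)
    (p : label * nat) : R :=
  if isSome (ctype g p.1) && isSome (ctype g (child p))
  then birth g (child p) - birth g p.1 else 0.

(** Equals the birth date on the tree when the root is born at 0. Unlike [birth], it is by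
    definition a function of the displacements of edges issued from generations before [size u],
    hence measurable for the sigma-algebra that these generate. *)
Definition path_sum (R : realType) (M : nat) (g : Defs.cluster R M) (u : label) : R :=
  \sum_(0 <= j < size u) displacement g (take j u, nth 0%N u j).

Lemma path_sum_rcons (R : realType) (M : nat) (g : Defs.cluster R M) p :
  path_sum g (child p) = path_sum g p.1 + displacement g p.
Proof.
rewrite /path_sum /child size_rcons big_nat_recr//=.
rewrite nth_rcons ltnn eqxx -cats1 take_cat ltnn subnn take0 cats0 -surjective_pairing.
congr (_ + _); apply: eq_big_nat => j /andP[_ jp].
by rewrite take_cat jp nth_cat jp.
Qed.

Lemma birth_path_sum (R : realType) (M : nat) (g : Defs.cluster R M) (m0 : 'I_M) u :
  is_typed_tree g -> g [::] = Some (m0, 0) -> isSome (ctype g u) ->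
  birth g u = path_sum g u.
Proof.
move=> [_ gtree] g0; elim/last_ind: u => [|u i IH].
  by rewrite /birth /cval g0 /path_sum big_nil.
rewrite -[rcons u i]/(child (u, i)) path_sum_rcons => gui.
have gu : isSome (ctype g u).
  have [|] := gtree u i; last by rewrite /ctype; case: (g u).
  by move: gui; rewrite /ctype /child /=; case: (g _).
by rewrite /= -IH// /displacement /= gu gui addrCA subrr addr0.
Qed.

Definition tree_upto (R : realType) (M : nat) (T : Type) (G : T -> Defs.cluster R M)
    (n : nat) (t : label -> option 'I_M) : set T :=
  [set w | forall u, (size u <= n)%N -> ctype (G w) u = t u].

Definition kernel (R : realType) (M : nat) (h : 'I_M -> 'I_M -> R -> R)
  (i j : 'I_M) (t : R) : R := if 0 < t then h i j t else 0.

Section kernel.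
Context (R : realType) (M : nat) (H : 'M[R]_M) (h : 'I_M -> 'I_M -> R -> R).
Hypothesis mh : forall i j, measurable_fun `[(0 : R), +oo[ (h i j).
Hypothesis h0 : forall i j (t : R), 0 <= t -> 0 <= h i j t.
Hypothesis hH : forall i j, l1norm (h i j) = (H i j)%:E.

Lemma kernel_ge0 i j t : 0 <= kernel h i j t.
Proof. by rewrite /kernel; case: ifP => // /ltW; exact: h0. Qed.

Let kernelE i j : kernel h i j = (h i j) \_ `]0, +oo[.
Proof.
by apply/funext => t; rewrite /kernel patchE mem_setE in_itv /= andbT.
Qed.

Lemma measurable_kernel i j : measurable_fun setT (kernel h i j).
Proof.
rewrite kernelE; apply/(measurable_restrictT _ (measurable_itv _)).
apply: measurable_funS (mh i j) => //.
by move=> t /=; rewrite !in_itv/= !andbT => /ltW.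
Qed.

Lemma integral_kernel i j :
  (\int[lebesgue_measure]_t (kernel h i j t)%:E = (H i j)%:E)%E.
Proof.
(* The norm is an integral over [[0, +oo[] while the kernel vanishes at 0; a single point is
   negligible. *)
rewrite -hH /l1norm -integral_itv_obnd_cbnd; last first.
  apply/measurable_EFinP; apply: measurable_funS (mh i j) => //.
  by move=> t /=; rewrite !in_itv/= !andbT => /ltW.
rewrite [RHS]integral_mkcond; apply: eq_integral => t _.
by rewrite /kernel patchE mem_setE in_itv/= andbT; case: ifP.
Qed.

Lemma offspring_mean_eq i j : offspring_mean h i j = H i j.
Proof. by rewrite /offspring_mean hH. Qed.

Lemma displacement_density_eq i j t :
  displacement_density h i j t = kernel h i j t / H i j.
Proof. by rewrite /displacement_density offspring_mean_eq. Qed.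

End kernel.

Section cluster_tree.
Context (R : realType) (M : nat) (h : 'I_M -> 'I_M -> R -> R).
Context (d : measure_display) (T : measurableType d) (P : probability T R).
Context (m0 : 'I_M) (G : T -> Defs.cluster R M).
Hypothesis HG : is_cluster P h m0 0 G.

Local Notation tts := (typed_tree_events G).

Lemma tts_ctype u o : <<s tts >> [set w | ctype (G w) u = o].
Proof.
case: o => [m|]; first by apply: sub_sigma_algebra; exists u, m.
pose TT : measurableType _ := g_sigma_algebraType tts.
rewrite (_ : [set _ | _] = ~` \bigcup_(m in [set: 'I_M]) [set w | ctype (G w) u = Some m]).
  apply: (@measurableC _ TT); apply: (@fin_bigcup_measurable _ TT) => // m _.
  by apply: sub_sigma_algebra; exists u, m.
apply/seteqP; split => w /=; first by move=> Ew [m _ /=]; rewrite Ew.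
move=> hw; case E : (ctype (G w) u) => [m|//].
by exfalso; apply: hw; exists m.
Qed.

Lemma tts_tree_upto n t : <<s tts >> (tree_upto G n t).
Proof.
pose TT : measurableType _ := g_sigma_algebraType tts.
(* Labels are countable through [CodeSeq], which makes this a countable intersection. *)
rewrite (_ : tree_upto G n t = \bigcap_i (if (size (CodeSeq.decode i) <= n)%N
   then [set w | ctype (G w) (CodeSeq.decode i) = t (CodeSeq.decode i)]
   else setT)).
  apply: (@bigcapT_measurable _ TT) => i; case: ifP => _.
    exact: tts_ctype.
  exact: (@measurableT _ TT).
apply/seteqP; split => w.
  by move=> hw i _; case: ifP => // un; exact: hw.
by move=> hw u un; have := hw (CodeSeq.code u) I; rewrite CodeSeq.codeK un.
Qed.

Let mG := cluster_measurable HG.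

Lemma tts_measurable E : <<s tts >> E -> measurable E.
Proof. exact: measurable_typed_tree. Qed.

Lemma measurable_tree_upto n t : measurable (tree_upto G n t).
Proof. by apply: tts_measurable; exact: tts_tree_upto. Qed.

Lemma measurable_birth u : measurable_fun setT (fun w => birth (G w) u).
Proof. by apply: measurable_cval => // m. Qed.

Lemma measurable_isSome_ctype u :
  measurable_fun setT (fun w => isSome (ctype (G w) u)).
Proof.
apply: (@measurable_fun_bool _ _ _ _ false); rewrite setTI.
rewrite (_ : _ @^-1` _ = [set w | ctype (G w) u = None]).
  by apply: tts_measurable; exact: tts_ctype.
by apply/seteqP; split => w /=; case: ctype.
Qed.

Lemma measurable_displacement p : measurable_fun setT (fun w => displacement (G w) p).
Proof.
apply: measurable_fun_ifT => //.
  by apply: measurable_and; exact: measurable_isSome_ctype.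
by apply: measurable_funB; exact: measurable_birth.
Qed.

(* Outside the tree the displacement has the junk value 0. *)
Definition edge_law (t : label -> option 'I_M) (p : label * nat) (A : set R) : \bar R :=
  if t (child p) is Some j
  then density_law (displacement_density h (odflt m0 (t p.1)) j) A
  else \d_(0 : R) A.

(** Edges whose child belongs to the tree fall under [independent_displacements]; on [tree_upto] the
    others have displacement 0, whence the Dirac masses. The condition [size p.1 < n] places the
    child in generation at most [n], so [t] decides whether it is present. The event [Ev] is left
    free to prescribe numbers of children later, which yields their independence from the
    displacements. *)
Lemma tree_displacements n t Ev (s : seq (label * nat)) (A : label * nat -> set R) :
  <<s tts >> Ev -> uniq s -> (forall p, p \in s -> (size p.1 < n)%N) ->
  (forall p, measurable (A p)) ->
  P ((tree_upto G n t `&` Ev) `&`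
     \bigcap_(p in [set` s]) ((fun w => displacement (G w) p) @^-1` A p)) =
  (P (tree_upto G n t `&` Ev) * \prod_(p <- s) edge_law t p (A p))%E.
Proof.
move=> tEv us sn mA.
pose TT : measurableType _ := g_sigma_algebraType tts.
set E := tree_upto G n t `&` Ev.
have tE : <<s tts >> E.
  by apply: (@measurableI _ TT) => //; exact: tts_tree_upto.
pose s1 := [seq p <- s | isSome (t (child p))].
pose s2 := [seq p <- s | ~~ isSome (t (child p))].
have present w p : E w -> p \in s1 ->
    ctype (G w) p.1 = Some (odflt m0 (t p.1)) /\
    ctype (G w) (child p) = Some (odflt m0 (t (child p))).
  move=> [Ew _]; rewrite mem_filter => /andP[tp ps]; have pn := sn _ ps.
  have e2 : ctype (G w) (child p) = t (child p).
    by apply: Ew; rewrite /child size_rcons.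
  have e1 : ctype (G w) p.1 = t p.1 by apply: Ew; exact: ltnW.
  have [_ /(_ p.1 p.2) gt] := cluster_tree HG w.
  have : isSome (ctype (G w) p.1).
    have [|] := gt; last by rewrite /ctype; case: (G w p.1).
    by move: tp; rewrite -e2 /ctype /child; case: (G w _).
  by rewrite e1 e2; case: (t p.1) => // i _; case: (t (child p)) tp.
have absent w p : E w -> p \in s2 -> displacement (G w) p = 0.
  move=> [Ew _]; rewrite mem_filter => /andP[tp ps]; have pn := sn _ ps.
  rewrite /displacement [ctype _ (child p)]Ew ?(negbTE tp) ?andbF//.
  by rewrite /child size_rcons.
have us1 : uniq s1 by rewrite filter_uniq.
have EF : E `&` [set w | forall p, p \in s1 ->
    ctype (G w) p.1 = Some (odflt m0 (t p.1)) /\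
    ctype (G w) (rcons p.1 p.2) = Some (odflt m0 (t (rcons p.1 p.2)))] = E.
  by apply/setIidl => w Ew p ps; exact: present.
have := cluster_displacements HG (fun u => odflt m0 (t u)) tE us1 mA.
rewrite /= EF => key.
have split_s : E `&` \bigcap_(p in [set` s]) ((fun w => displacement (G w) p) @^-1` A p) =
   (E `&` [set w | forall p, p \in s1 -> exists a b,
      omap snd (G w p.1) = Some a /\
      omap snd (G w (rcons p.1 p.2)) = Some b /\ A p (b - a)]) `&`
   [set w | forall p, p \in s2 -> A p 0].
  apply/seteqP; split => w.
    move=> [Ew h1]; split; last first.
      move=> p ps2; have := h1 p; rewrite /= (absent w)//; apply.
      by move: ps2; rewrite mem_filter => /andP[].
    split => // p ps1; have [c1 c2] := present w p Ew ps1.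
    have := h1 p; rewrite /= /displacement c1 c2 /= /birth /cval.
    move: ps1; rewrite mem_filter => /andP[_ ps] /(_ ps).
    move: c1 c2; rewrite /ctype /child.
    case: (G w p.1) => [[i a]|] //=; case: (G w _) => [[j b]|] //= _ _ hA.
    by exists a, b.
  move=> [[Ew h1] h2]; split => // p /= ps; case tp : (isSome (t (child p))).
    have ps1 : p \in s1 by rewrite mem_filter tp.
    have [c1 c2] := present w p Ew ps1.
    have [a [b [Ga [Gb Aab]]]] := h1 p ps1.
    rewrite /displacement c1 c2 /= /birth /cval.
    move: Ga Gb Aab; rewrite /child.
    by case: (G w p.1) => [[i a']|] //=; case: (G w _) => [[j b']|] //= [->] [->].
  have ps2 : p \in s2 by rewrite mem_filter tp.
  by rewrite (absent w)//; exact: h2.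
rewrite split_s (bigID (fun p => isSome (t (child p))))/=.
rewrite -[X in (_ * (X * _))%E]big_filter -/s1.
rewrite -[X in (_ * (_ * X))%E]big_filter -/s2 muleA.
have -> : (\prod_(p <- s1) edge_law t p (A p) = \prod_(p <- s1)
    \int[lebesgue_measure]_(x in A p) (displacement_density h (odflt m0 (t p.1))
      (odflt m0 (t (rcons p.1 p.2))) x)%:E)%E.
  apply: eq_big_seq => p; rewrite mem_filter => /andP[+ _].
  by rewrite /edge_law /density_law /child; case: (t (rcons _ _)).
rewrite -key.
have law0 p : p \in s2 -> edge_law t p (A p) = \d_(0:R) (A p).
  by rewrite mem_filter /edge_law => /andP[]; case: (t _).
(* On the absent edges the condition is deterministic: always true or never, just as the product of
   Dirac masses is 1 or 0. *)
have [h0|] := pselect (forall p, p \in s2 -> A p 0).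
  have -> : [set w : T | forall p, p \in s2 -> A p 0] = setT.
    by apply/seteqP; split.
  rewrite setIT.
  rewrite [X in (_ * X)%E]big_seq big1 ?mule1// => p ps.
  by rewrite law0// diracE mem_set//; exact: h0.
move=> /existsNP[p /not_implyP[ps Ap]].
have -> : [set w : T | forall p, p \in s2 -> A p 0] = set0.
  by rewrite -subset0 => w /(_ p ps).
rewrite setI0 measure0.
by rewrite [X in (_ * X)%E](big_rem p)//= law0// diracE memNset// mul0e mule0.
Qed.

End cluster_tree.

(** * Almost sure finiteness of generations *)

Lemma ae_foralln d (T : measurableType d) (R : realType)
    (mu : {measure set T -> \bar R}) (Q : nat -> T -> Prop) :
  (forall n, {ae mu, forall w, Q n w}) -> {ae mu, forall w, forall n, Q n w}.
Proof.
move=> H; have := negligible_bigcup H; apply: negligibleS => w /=.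
by move=> /existsNP[n Qn]; exists n.
Qed.

Lemma ae_children d (T : measurableType d) (R : realType)
    (mu : {measure set T -> \bar R}) (Q : label -> T -> Prop) :
  (forall u, {ae mu, forall w, Q u w}) -> {ae mu, forall w, forall u, Q u w}.
Proof.
move=> H; have := @ae_foralln _ _ _ mu (fun n => Q (CodeSeq.decode n))
  (fun n => H _).
by apply: filterS => w hw u; rewrite -[u]CodeSeq.codeK.
Qed.

Lemma counting_lty (T : choiceType) (R : realType) (A : set T) :
  (counting A < +oo :> \bar R)%E <-> finite_set A.
Proof.
rewrite /counting; case: ifPn => [/asboolP fA|/asboolP nA].
  by split => // _; exact: ltry.
by split => //; rewrite ltxx.
Qed.

Lemma counting_lty_nat (T : choiceType) (R : realType) (A : set T) :
  (counting A < +oo :> \bar R)%E -> exists k : nat, counting A = k%:R%:E :> \bar R.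
Proof.
rewrite /counting; case: ifPn => _; last by rewrite ltxx.
by move=> _; eexists.
Qed.

(** Countable enumeration of the finitely supported assignments of types to labels, each coded by an
    association list. Different codes may give the same assignment. *)
Definition finite_tree (M : nat) (q : nat) : label -> option 'I_M :=
  if unpickle q is Some l
  then fun u => ohead [seq p.2 | p : seq nat * 'I_M <- l & p.1 == u]
  else fun=> None.

Lemma finite_tree_surj (M : nat) (s : seq label) (t : label -> option 'I_M) :
  (forall u, isSome (t u) -> u \in s) -> exists q, finite_tree M q = t.
Proof.
move=> ts; pose l := pmap (fun u => omap (fun m => (u : seq nat, m)) (t u)) s.
exists (pickle l); rewrite /finite_tree pickleK; apply/funext => u.
rewrite /l; case tu : (t u) => [m|]; last first.
  suff -> : [seq p <- l | p.1 == u] = [::] by [].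
  apply/eqP; rewrite -(negbK (_ == _)) -has_filter; apply/negP => /hasP[[v m]].
  rewrite mem_pmap => /mapP[v' _]; case tv : (t v') => [m'|//] [-> ->] /eqP /= e.
  by move: tv; rewrite e tu.
have : u \in s by apply: ts; rewrite tu.
elim: s {ts l} => // v s IH; rewrite inE => /orP[/eqP <-|us] /=.
  by rewrite tu /= eqxx.
case tv : (t v) => [m'|] /=; last exact: IH.
by case: eqP => [e|_] /=; [move: tv; rewrite e tu => -[->]|exact: IH].
Qed.

Section finiteness.
Context (R : realType) (M : nat) (h : 'I_M -> 'I_M -> R -> R).
Context (d : measure_display) (T : measurableType d) (P : probability T R).
Context (m0 : 'I_M) (G : T -> Defs.cluster R M).
Hypothesis HG : is_cluster P h m0 0 G.
Hypothesis h_ge0 : forall i j, 0 <= offspring_mean h i j.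

Local Notation tts := (typed_tree_events G).

Lemma tts_nchildren u m k :
  <<s tts >> [set w | nchildren (G w) u m = k%:R%:E].
Proof.
pose TT : measurableType _ := g_sigma_algebraType tts.
have mf : measurable_fun (setT : set TT) (fun w => nchildren (G w) u m).
  rewrite (_ : (fun w : TT => _) = (fun w : TT => \sum_(i <oo)
      (\1_[set w | ctype (G w) (rcons u i) = Some m] w : R)%:E)%E); last first.
    apply/funext => w; rewrite /nchildren counting_dirac; apply: eq_eseriesr => i _.
    by rewrite diracE indicE; congr (_%:R%:E); apply/idP/idP => /set_mem ?; exact/mem_set.
  apply: measurable_nneseries => [i|i w]; last by rewrite lee_fin.
  apply/measurable_EFinP; apply: measurable_indic.
  by apply: sub_sigma_algebra; exists (rcons u i), m.
have := mf measurableT [set k%:R%:E] (emeasurable_set1 _).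
by rewrite setTI.
Qed.

Lemma measurable_nchildren u m k :
  measurable [set w | nchildren (G w) u m = k%:R%:E].
Proof. by apply: (tts_measurable HG); exact: tts_nchildren. Qed.

(** The number of children may a priori be infinite; the events that it takes a given finite value
    then miss [w]. *)
Lemma nchildren_series_le1 w u m :
  (\sum_(k <oo) (1 * (\1_[set w | nchildren (G w) u m = k%:R%:E] w : R)%:E) =
   (if nchildren (G w) u m < +oo then 1 else 0))%E.
Proof.
case: ifPn => [/counting_lty_nat[k Ek]|].
  rewrite (@nneseriesD1 _ _ k)//.
  rewrite indicE mem_set ?mul1e// eseries0 ?adde0// => i _ /= ik.
  rewrite indicE memNset ?mul1e//= /nchildren Ek => -[/eqP].
  by rewrite eqr_nat eq_sym (negbTE ik).
move=> noo; apply: eseries0 => i _ _; rewrite indicE memNset ?mul1e//= => e.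
by move: noo; rewrite e ltry.
Qed.

(** [poisson_offspring] gives the probability of each finite value, and Poisson masses sum to 1, so
    no mass is left for infinite counts. *)
Lemma children_finite_level n t u : size u = n -> isSome (t u) ->
  {ae P, forall w, tree_upto G n t w -> forall m, (nchildren (G w) u m < +oo)%E}.
Proof.
move=> un tu; pose E := tree_upto G n t.
have mE : measurable E by exact: measurable_tree_upto HG _ _.
(* All factors [phi] are 1 here, so constants form a large enough class. *)
pose C : set (T -> \bar R) := [set f | exists2 c : R, 0 <= c & f = cst c%:E].
have := @integral_prod_series _ T R P 'I_M C
  (fun m k => [set w | nchildren (G w) u m = k%:R%:E]) (fun _ _ _ => 1%E)
  (fun m k => poisson_mass (offspring_mean h (odflt m0 (t u)) m) k) E mE
  (fun m k => measurable_nchildren u m k).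
move=> /(_ _ _ _ _ _ (index_enum 'I_M) E 1%E mE lee01 (index_enum_uniq _) _ (cst 1%E)).
have -> : (\int[P]_(w in E) (cst 1 w * \prod_(m <- index_enum 'I_M) \sum_(k <oo)
    (poisson_mass (offspring_mean h (odflt m0 (t u)) m) k * 1)) = P E)%E.
  rewrite (eq_integral (cst 1%E)) ?integral_cst ?mul1e// => w _ /=.
  rewrite mul1e big1// => m _.
  have := poisson_mass_generating (h_ge0 (odflt m0 (t u)) m) ler01.
  under eq_eseriesr do rewrite expr1n.
  by rewrite subrr mulr0 expR0.
rewrite mul1e => key.
have {key} : (\int[P]_(w in E) (\1_[set w | forall m, (nchildren (G w) u m < +oo)%E] w : R)%:E = P E)%E.
  rewrite -key.
  - apply: eq_integral => w _; rewrite mul1e.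
    under eq_bigr do rewrite nchildren_series_le1.
    rewrite indicE; have [fin|nfin] := pselect (forall m, (nchildren (G w) u m < +oo)%E).
      by rewrite mem_set// big1// => m _; rewrite fin.
    rewrite memNset//; move/existsNP : nfin => [m nm].
    by rewrite (bigD1 m)//= ifN ?mul0e//; exact/negP.
  - by move=> f [c c0 ->]; split => // w; rewrite lee_fin.
  - by [].
  - by [].
  - by move=> m k f [c c0 ->]; exists c => //; apply/funext => w; rewrite mule1.
  - by move=> *; exact: poisson_mass_ge0.
  - move=> f k [c c0 ->]; rewrite !integral_cst//; last first.
      apply: measurableI => //; rewrite bigcap_seq.
      by apply: bigsetI_measurable => m _; exact: measurable_nchildren.
    rewrite mul1e muleCA; congr (_ * _)%E.
    have := @cluster_offspring _ _ _ _ _ _ _ _ _ HG n t (fun u => odflt m0 (t u))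
      [:: u] (fun _ => k) isT.
    rewrite !big_seq1 muleC => <-.
      congr (P _); apply/seteqP; split => w [Ew hw]; split => //.
        by move=> v m /[!inE] /eqP ->; apply: hw => /=; exact: mem_index_enum.
      by move=> m _; apply: hw; rewrite inE.
    by move=> v /[!inE] /eqP ->; split => //; case: (t u) tu.
  - by exists 1.
have mF : measurable [set w | forall m, (nchildren (G w) u m < +oo)%E].
  rewrite (_ : [set w | _] = \bigcap_(m in [set: 'I_M])
      \bigcup_k [set w | nchildren (G w) u m = k%:R%:E]).
    apply: fin_bigcap_measurable => // m _.
    by apply: bigcupT_measurable => k; exact: measurable_nchildren.
  apply/seteqP; split => w hw m; last by have [k _ ->] := hw m I; rewrite ltry.
  by move=> _; have [k Ek] := counting_lty_nat (hw m); exists k.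
rewrite integral_indic// => PE.
apply/negligibleP; last first.
  have -> : (~` [set x | tree_upto G n t x -> forall m, (nchildren (G x) u m < +oo)%E])
      = E `\` [set w | forall m, (nchildren (G w) u m < +oo)%E].
    apply/seteqP; split => w; first by move=> /not_implyP.
    by move=> [Ew nw] /(_ Ew).
  rewrite measureD//; last by rewrite ltey_eq fin_num_measure.
  by rewrite [X in (_ - P X)%E]setIC -[X in (X - _)%E]PE subee// PE fin_num_measure.
rewrite (_ : ~` _ = E `\` [set w | forall m, (nchildren (G w) u m < +oo)%E]).
  exact: measurableD.
apply/seteqP; split => w; first by move=> /not_implyP.
by move=> [Ew nw] /(_ Ew).
Qed.

Lemma finite_tree_cover n w :
  finite_set [set u | (size u <= n)%N /\ isSome (ctype (G w) u)] ->
  exists q, tree_upto G n (finite_tree M q) w.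
Proof.
move=> /finite_seqP[s Es].
have [|q Eq] := @finite_tree_surj M s
    (fun u => if (size u <= n)%N then ctype (G w) u else None).
  move=> u; case: ifP => // un cu; have : [set` s] u by rewrite -Es.
  by [].
by exists q => u un; rewrite Eq un.
Qed.

(** Finiteness up to generation [n] places the tree in the countable family [finite_tree]. The
    exceptional sets of [children_finite_level], one for each label and each such tree, therefore
    have a negligible union, outside which generation [n.+1] is a finite union of finite sets. *)
Lemma ae_finite_generations n :
  {ae P, forall w, finite_set [set u | (size u <= n)%N /\ isSome (ctype (G w) u)]}.
Proof.
elim: n => [|n IH].
  apply: aeW => w; apply: (sub_finite_set (B := [set [::]])) => //.
  by move=> u /= [+ _]; rewrite leqn0 => /nilP.
have step (u : label) : {ae P, forall w, forall q, size u = n ->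
    isSome (finite_tree M q u) -> tree_upto G n (finite_tree M q) w ->
    forall m, (nchildren (G w) u m < +oo)%E}.
  apply: ae_foralln => q; have [un|un] := pselect (size u = n); last first.
    by apply: aeW => w /un.
  have [tu|tu] := pselect (isSome (finite_tree M q u)); last first.
    by apply: aeW => w _ /tu.
  have := children_finite_level un tu; apply: filterS => w hw _ _; exact: hw.
apply: filterS2 IH (ae_children step) => w fw hw.
have [q Eq] := finite_tree_cover fw.
apply: (@sub_finite_set _ _
   ([set u | (size u <= n)%N /\ isSome (ctype (G w) u)] `|`
    \bigcup_(u in [set u | (size u <= n)%N /\ isSome (ctype (G w) u)])
      \bigcup_(m in [set: 'I_M]) ((fun i => rcons u i) @`
         [set i | size u = n /\ ctype (G w) (rcons u i) = Some m]))).
  move=> u /= [+ cu]; rewrite leq_eqVlt ltnS => /orP[/eqP un|un]; last by left.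
  right; move: un cu; case/lastP: u => // u i; rewrite size_rcons => -[un] cu.
  exists u => /=; first split; first by rewrite un.
    have [_ /(_ u i) gt] := cluster_tree HG w.
    have [|] := gt; last by rewrite /ctype; case: (G w u).
    by move: cu; rewrite /ctype; case: (G w _).
  move: cu; case cm : (ctype _ _) => [m|//] _; exists m => //.
  by exists i.
rewrite finite_setU; split => //; apply: bigcup_finite => // u [un cu].
apply: bigcup_finite => // m _; apply: finite_image.
have [e|e] := pselect (size u = n); last first.
  by apply: (sub_finite_set (B := set0)) => // i [/e].
apply: (@sub_finite_set _ _ [set i | ctype (G w) (rcons u i) = Some m]).
  by move=> i [].
apply/(counting_lty R); apply: (hw u q e _ Eq m).
by rewrite -Eq// cu.
Qed.

Lemma tree_upto_cover n :
  P (~` \bigcup_q tree_upto G n (finite_tree M q)) = 0%E.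
Proof.
have mU : measurable (\bigcup_q tree_upto G n (finite_tree M q)).
  by apply: bigcupT_measurable => q; exact: measurable_tree_upto HG _ _.
apply/negligibleP; first exact: measurableC.
have := ae_finite_generations n; apply: negligibleS => w; apply: contra_not.
by move=> /finite_tree_cover[q Eq]; exists q.
Qed.

Lemma tree_upto_disjoint n q q' :
  tree_upto G n (finite_tree M q) = tree_upto G n (finite_tree M q') \/
  tree_upto G n (finite_tree M q) `&` tree_upto G n (finite_tree M q') = set0.
Proof.
have [/set0P[w [Ew Ew']]|/negPn/eqP] := boolP
  (tree_upto G n (finite_tree M q) `&` tree_upto G n (finite_tree M q') != set0).
  left; apply/seteqP; split => v hv u un; rewrite hv//.
    by rewrite -Ew// Ew'.
  by rewrite -Ew'// Ew.
by right.
Qed.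

Lemma ae_children_finite :
  {ae P, forall w, forall u m, (nchildren (G w) u m < +oo)%E}.
Proof.
have step (u : label) : {ae P, forall w, forall q,
    isSome (finite_tree M q u) -> tree_upto G (size u) (finite_tree M q) w ->
    forall m, (nchildren (G w) u m < +oo)%E}.
  apply: ae_foralln => q.
  have [tu|tu] := pselect (isSome (finite_tree M q u)); last first.
    by apply: aeW => w /tu.
  have := children_finite_level (erefl (size u)) tu.
  by apply: filterS => w hw _; exact: hw.
apply: ae_children => u.
apply: filterS2 (ae_finite_generations (size u)) (step u).
move=> w /finite_tree_cover[q Eq] hw m.
case cu : (isSome (ctype (G w) u)).
  by apply: (hw q _ Eq m); rewrite -Eq.
rewrite (_ : nchildren (G w) u m = 0%E) ?ltry//.
rewrite /nchildren (_ : [set _ | _] = set0) ?measure0//.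
rewrite -subset0 => i /= ci; have [_ /(_ u i) gt] := cluster_tree HG w.
have [|] := gt; first by move: ci; rewrite /ctype; case: (G w _).
by move: cu; rewrite /ctype; case: (G w u).
Qed.

End finiteness.

(** * Exponential moment of a cluster *)

Section displacements.
Context (R : realType) (M : nat) (H : 'M[R]_M) (h : 'I_M -> 'I_M -> R -> R).
Context (d : measure_display) (T : measurableType d) (P : probability T R).
Context (m0 : 'I_M) (G : T -> Defs.cluster R M).
Hypothesis HG : is_cluster P h m0 0 G.
Hypothesis mh : forall i j, measurable_fun `[(0 : R), +oo[ (h i j).
Hypothesis h0 : forall i j (t : R), 0 <= t -> 0 <= h i j t.
Hypothesis hH : forall i j, l1norm (h i j) = (H i j)%:E.

Local Notation disp := (fun p w => displacement (G w) p).

Definition displacement_events (p : label * nat) : set (set T) :=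
  [set E | exists2 A : set R, measurable A & E = disp p @^-1` A].

Local Notation cyl := (cylinders displacement_events).
Local Notation cylT J := (g_sigma_algebraType (cyl J)).

Lemma displacement_eventsT p : displacement_events p setT.
Proof. by exists setT => //; rewrite preimage_setT. Qed.

Lemma displacement_eventsI p : setI_closed (displacement_events p).
Proof.
move=> _ _ [A mA ->] [B mB ->]; exists (A `&` B); first exact: measurableI.
by rewrite preimage_setI.
Qed.

Lemma displacement_events_measurable p : displacement_events p `<=` measurable.
Proof.
move=> _ [A mA ->]; rewrite -[X in measurable X]setTI.
exact: (measurable_displacement HG).
Qed.

Lemma measurable_cyl_displacement (J : set (label * nat)) p : J p ->
  measurable_fun (setT : set (cylT J)) (disp p).
Proof.
move=> Jp _ A mA; rewrite setTI; apply: sub_sigma_algebra.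
apply: (cylinders_sub displacement_eventsT Jp).
by exists A.
Qed.

Lemma measurable_cyl_path_sum (J : set (label * nat)) u :
  (forall p, (size p.1 < size u)%N -> J p) ->
  measurable_fun (setT : set (cylT J)) (fun w => path_sum (G w) u).
Proof.
elim/last_ind: u => [|u i IH] hJ.
  rewrite (_ : (fun _ => _) = cst 0)//.
  by apply/funext => w; rewrite /path_sum big_nil.
rewrite (_ : (fun _ => _) = fun w => path_sum (G w) u + displacement (G w) (u, i)).
  apply: measurable_funD.
    by apply: IH => p pu; apply: hJ; rewrite size_rcons ltnS ltnW.
  by apply: measurable_cyl_displacement; apply: hJ; rewrite size_rcons.
by apply/funext => w; rewrite -[rcons u i]/(child (u, i)) path_sum_rcons.
Qed.

Lemma measurable_cyl_mono d' (S : measurableType d') (J J' : set (label * nat))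
    (f : T -> S) : J `<=` J' ->
  measurable_fun (setT : set (cylT J)) f -> measurable_fun (setT : set (cylT J')) f.
Proof.
move=> JJ' mf _ A mA; have := mf measurableT A mA; rewrite !setTI.
apply: sub_sigma_algebra2 => _ [s [B [us sJ FB ->]]].
by exists s, B; split => // i /sJ /JJ'.
Qed.

Lemma measurable_cylW d' (S : measurableType d') (J : set (label * nat))
    (f : T -> S) :
  measurable_fun (setT : set (cylT J)) f -> measurable_fun setT f.
Proof.
move=> mf; apply: (measurableT_comp mf).
apply: measurable_id_g_sigma; apply: cylinders_measurable.
exact: displacement_events_measurable.
Qed.

Let dd (t : label -> option 'I_M) (p : label * nat) : R -> R :=
  displacement_density h (odflt m0 (t p.1)) (odflt m0 (t (child p))).

Let ddE t p : dd t p = fun y => kernel h (odflt m0 (t p.1))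
  (odflt m0 (t (child p))) y / H (odflt m0 (t p.1)) (odflt m0 (t (child p))).
Proof. by apply/funext => y; rewrite /dd (displacement_density_eq hH). Qed.

Let H0 i j : 0 <= H i j.
Proof.
rewrite -lee_fin -(integral_kernel mh hH); apply: integral_ge0 => t _.
by rewrite lee_fin (kernel_ge0 h0).
Qed.

Lemma measurable_density t p : measurable_fun setT (dd t p).
Proof.
by rewrite ddE; apply: measurable_funM => //; exact: (measurable_kernel mh).
Qed.

Lemma density_ge0 t p y : 0 <= dd t p y.
Proof. by rewrite ddE divr_ge0 ?(kernel_ge0 h0). Qed.

Lemma density_law_fin t p : fin_num_fun (density_law (dd t p)).
Proof.
move=> A mA; have d0 B : (0 <= density_law (dd t p) B)%E.
  by apply: integral_ge0 => y _; rewrite lee_fin density_ge0.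
have mE : measurable_fun setT (fun y => (dd t p y)%:E).
  by apply/measurable_EFinP; exact: measurable_density.
rewrite ge0_fin_numE//; apply: (@le_lt_trans _ _ (density_law (dd t p) setT)).
  apply: ge0_subset_integral => //.
  by move=> y _; rewrite lee_fin density_ge0.
rewrite /density_law ddE.
under eq_integral do rewrite mulrC EFinM.
rewrite ge0_integralZl//; last 3 first.
- by apply/measurable_EFinP; exact: (measurable_kernel mh).
- by move=> y _; rewrite lee_fin (kernel_ge0 h0).
- by rewrite lee_fin invr_ge0.
by rewrite (integral_kernel mh hH) -EFinM ltry.
Qed.

Let dm t p : {measure set R -> \bar R} :=
  density_measure (measurable_density t p) (density_ge0 t p).

Let dm_fin t p : fin_num_fun (dm t p).
Proof. exact: density_law_fin. Qed.

Definition edge_measure t p : {finite_measure set R -> \bar R} :=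
  HB.pack_for (FiniteMeasure.type R R) (Measure.sort (dm t p))
    (Measure_isFinite.Build _ _ _ _ (@dm_fin t p)).

(** The edges of [e] all start in generation [n], so the birth date of a parent involves none of
    them. On the atom, the displacement of each edge is thus independent of everything else in the
    integrand, and the edges can be integrated one after the other. *)
Lemma integrate_displacements n t (e : seq (label * nat)) (Psi : T -> \bar R)
    (phi : label * nat -> R * R -> \bar R) :
  uniq e -> (forall p, p \in e -> size p.1 = n /\ isSome (t (child p))) ->
  (forall p, measurable_fun setT (phi p)) -> (forall p z, 0 <= phi p z)%E ->
  measurable_fun (setT : set (cylT [set p | (size p.1 < n.+1)%N /\ p \notin e])) Psi ->
  (forall w, 0 <= Psi w)%E ->
  (\int[P]_(w in tree_upto G n.+1 t)
     (Psi w * \prod_(p <- e) phi p (path_sum (G w) p.1, displacement (G w) p)) =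
   \int[P]_(w in tree_upto G n.+1 t)
     (Psi w * \prod_(p <- e) \int[lebesgue_measure]_y
        (phi p (path_sum (G w) p.1, y) * (dd t p y)%:E)))%E.
Proof.
move=> + + mphi phi0.
have mE : measurable (tree_upto G n.+1 t) by exact: measurable_tree_upto HG _ _.
have mdE p : measurable_fun setT (fun y => (dd t p y)%:E).
  by apply/measurable_EFinP; exact: measurable_density.
pose psi p s := (\int[lebesgue_measure]_y (phi p (s, y) * (dd t p y)%:E))%E.
have psi0 p s : (0 <= psi p s)%E.
  by apply: integral_ge0 => y _; rewrite mule_ge0// lee_fin density_ge0.
have mphid p : measurable_fun setT (fun z : R * R => phi p z * (dd t p z.2)%:E)%E.
  apply: emeasurable_funM => //.
  by apply/measurable_EFinP; apply: (measurableT_comp (measurable_density t p)).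
have phid0 p (z : R * R) : (0 <= phi p z * (dd t p z.2)%:E)%E.
  by rewrite mule_ge0// lee_fin density_ge0.
have mpsi p : measurable_fun setT (psi p).
  exact: (@measurable_fun_fubini_tonelli_F _ _ _ _ R (@lebesgue_measure R)
    _ (mphid p) (phid0 p)).
have mpath (J : set (label * nat)) u : (forall p, (size p.1 < n)%N -> J p) ->
    (size u <= n)%N ->
    measurable_fun (setT : set (cylT J)) (fun w => path_sum (G w) u).
  move=> hJ un; apply: measurable_cyl_path_sum => p pu; apply: hJ.
  exact: leq_trans un.
elim: e Psi => [|p e IH] Psi; first by move=> *; under eq_integral do rewrite big_nil;
  under [RHS]eq_integral do rewrite big_nil.
move=> /= /andP[pe ue] hpe mPsi Psi0.
have [pn tp] : size p.1 = n /\ isSome (t (child p)) by apply: hpe; rewrite inE eqxx.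
have he q : q \in e -> size q.1 = n /\ isSome (t (child q)).
  by move=> qe; apply: hpe; rewrite inE qe orbT.
(* All edges issued from generations up to [n] except [p]: everything but the factor of [p] depends
   on these only. *)
pose J := [set q : label * nat | (size q.1 < n.+1)%N /\ q != p].
have Jn q : (size q.1 < n)%N -> J q.
  move=> qn; split; first exact: ltnW.
  by apply: contraTneq qn => ->; rewrite pn ltnn.
have mPsiJ : measurable_fun (setT : set (cylT J)) Psi.
  apply: measurable_cyl_mono mPsi => q /= [qn]; rewrite inE negb_or => /andP[qp _].
  by split.
have mrest : measurable_fun (setT : set (cylT J)) (fun w => Psi w *
    \prod_(q <- e) phi q (path_sum (G w) q.1, displacement (G w) q))%E.
  apply: emeasurable_funM => //.
  rewrite (_ : (fun _ => _) = fun w => \prod_(q <- e) (if q \in e then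
    phi q (path_sum (G w) q.1, displacement (G w) q) else 1))%E; last first.
    by apply/funext => w; apply: eq_big_seq => q ->.
  apply: measurable_prode => q.
  case: (boolP (q \in e)) => qe; last exact: measurable_cst.
  have [qn _] := he q qe.
  apply: (measurableT_comp (mphi q)); apply: measurable_fun_pair.
    by apply: mpath => //; rewrite qn.
  apply: measurable_cyl_displacement; split; first by rewrite qn.
  by apply: contraNneq pe => <-.
pose Phi (z : cylT J * R) : \bar R := ((Psi z.1 *
    \prod_(q <- e) phi q (path_sum (G z.1) q.1, displacement (G z.1) q)) *
    phi p (path_sum (G z.1) p.1, z.2))%E.
have mPhi : measurable_fun setT Phi.
  apply: emeasurable_funM; first exact: (measurableT_comp mrest).
  apply: (measurableT_comp (mphi p)); apply: measurable_fun_pair => //.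
  apply: (measurableT_comp (g := fst) (mpath J p.1 Jn _)) => //.
  by rewrite pn.
have rest0 w : (0 <= Psi w *
    \prod_(q <- e) phi q (path_sum (G w) q.1, displacement (G w) q))%E.
  by rewrite mule_ge0// prode_ge0.
have Phi0 z : (0 <= Phi z)%E by rewrite mule_ge0.
have mD := measurable_displacement HG p.
have := @cylinders_indep_integral _ _ T R R (mrestr P mE) (edge_measure t p) _
  displacement_events J (disp p) Phi displacement_eventsT displacement_eventsI
  displacement_events_measurable mD mPhi Phi0.
have ind (s : seq (label * nat)) A (B : set R) : uniq s -> (forall q, q \in s -> J q) ->
    (forall q, displacement_events q (A q)) -> measurable B ->
    (mrestr P mE ((\bigcap_(i in [set` s]) A i) `&` disp p @^-1` B) =
     mrestr P mE (\bigcap_(i in [set` s]) A i) * edge_measure t p B)%E.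
  move=> us sJ FA mB.
  have /choice[C HC] : forall q, exists C, measurable C /\ A q = disp q @^-1` C.
    by move=> q; have [C mC EC] := FA q; exists C.
  have ps : p \notin s by apply/negP => /sJ [_]; rewrite eqxx.
  have sn q : q \in s -> (size q.1 < n.+1)%N by move=> /sJ [].
  pose C' q := if q == p then B else C q.
  have mC' q : measurable (C' q) by rewrite /C'; case: ifP => // _; exact: (HC q).1.
  have u' : uniq (p :: s) by rewrite /= ps.
  have sn' q : q \in p :: s -> (size q.1 < n.+1)%N.
    by rewrite inE => /orP[/eqP ->|/sn//]; rewrite pn.
  have tT : <<s typed_tree_events G >> (setT : set T).
    exact: (@measurableT _ (g_sigma_algebraType (typed_tree_events G))).
  (* The product formula with and without the edge [p]: the two differ by the law of its
     displacement. *)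
  have k1 := tree_displacements HG t tT u' sn' mC'.
  have k2 := tree_displacements HG t tT us sn (fun q => (HC q).1).
  rewrite /mrestr.
  have E2 : \bigcap_(i in [set` s]) A i = \bigcap_(i in [set` s]) (disp i @^-1` C i).
    by apply: eq_bigcapr => q _; exact: (HC q).2.
  have E1 : (\bigcap_(i in [set` s]) A i) `&` disp p @^-1` B =
      \bigcap_(i in [set` p :: s]) (disp i @^-1` C' i).
    rewrite E2; apply/seteqP; split => w.
      move=> [hs hp] q /=; rewrite inE /C'; case: eqP => [->//|_] /= qs.
      exact: hs.
    move=> hw; split.
      move=> q /= qs; have := hw q; rewrite /= inE qs orbT /C' => /(_ isT).
      by case: eqP => // qp; move: ps; rewrite -qp qs.
    by have := hw p; rewrite /= inE eqxx /C' eqxx; exact.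
  rewrite E1 E2 [X in P X = _]setIC [X in (_ = P X * _)%E]setIC.
  move: k1 k2; rewrite setIT => -> ->; rewrite big_cons muleA -!muleA.
  congr (_ * _)%E; rewrite muleC; congr (_ * _)%E.
    apply: eq_big_seq => q qs; rewrite /C'; case: eqP => // qp.
    by move: ps; rewrite -qp qs.
  rewrite /edge_law /C' eqxx; move: tp; rewrite /edge_measure /= /dd.
  by case: (t (child p)).
have midT : measurable_fun setT (id : T -> cylT J).
  apply: measurable_id_g_sigma; apply: cylinders_measurable.
  exact: displacement_events_measurable.
move=> /(_ ind); rewrite !integral_mrestr//; last 3 first.
- apply: (@measurable_cylW _ _ J).
  exact: (@measurable_fun_fubini_tonelli_F _ _ _ _ R (edge_measure t p) Phi mPhi Phi0).
- by move=> w; apply: integral_ge0.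
- by apply: (measurableT_comp mPhi); apply: measurable_fun_pair.
move=> key.
transitivity (\int[P]_(x in tree_upto G n.+1 t) Phi (x, displacement (G x) p))%E.
  apply: eq_integral => w _; rewrite big_cons /Phi /= muleCA muleC.
  by rewrite muleC muleA muleC muleA.
rewrite key.
transitivity (\int[P]_(w in tree_upto G n.+1 t) (Psi w * psi p (path_sum (G w) p.1) *
    \prod_(q <- e) phi q (path_sum (G w) q.1, displacement (G w) q)))%E.
  apply: eq_integral => w _.
  transitivity (\int[edge_measure t p]_y ((Psi w *
    \prod_(q <- e) phi q (path_sum (G w) q.1, displacement (G w) q)) *
    phi p (path_sum (G w) p.1, y)))%E; first by [].
  rewrite ge0_integralZl//; last first.
    exact: (measurableT_comp (mphi p) (pair1_measurable _)).
  have -> : (\int[edge_measure t p]_y phi p (path_sum (G w) p.1, y) =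
      psi p (path_sum (G w) p.1))%E.
    rewrite /psi -(ge0_integral_density (measurable_density t p) (density_ge0 t p))//.
    exact: (measurableT_comp (mphi p) (pair1_measurable _)).
  by rewrite -!muleA; congr (_ * _)%E; rewrite muleC.
(* Once integrated, the factor of [p] depends on the birth date of its parent only, so it can join
   [Psi] for the remaining edges. *)
rewrite IH//; last 2 first.
- apply: emeasurable_funM.
    apply: measurable_cyl_mono mPsi => q /= [qn]; rewrite inE negb_or => /andP[_ qe].
    by split.
  apply: (measurableT_comp (mpsi p)); apply: mpath; last by rewrite pn.
  move=> q qn; split; first exact: ltnW.
  by apply: contraTN qn => /he[-> _]; rewrite ltnn.
- by move=> w; rewrite mule_ge0.
by apply: eq_integral => w _; rewrite big_cons -muleA.
Qed.

End displacements.

Lemma expR_sumE (R : realType) (I : Type) (s : seq I) (Q : pred I) (f : I -> R) :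
  ((expR (\sum_(i <- s | Q i) f i))%:E = \prod_(i <- s | Q i) (expR (f i))%:E)%E.
Proof.
apply: (big_morph (fun x => (expR x)%:E)) => [x y|]; first by rewrite expRD EFinM.
by rewrite expR0.
Qed.

Lemma prode_EFin (R : realType) (I : Type) (s : seq I) (Q : pred I) (f : I -> R) :
  (\prod_(i <- s | Q i) (f i)%:E = (\prod_(i <- s | Q i) f i)%:E)%E.
Proof. by symmetry; apply: (big_morph EFin) => // x y; rewrite EFinM. Qed.

Lemma lee_prode (R : realType) (I : eqType) (s : seq I) (f g : I -> \bar R) :
  (forall i, i \in s -> 0 <= f i <= g i)%E ->
  (0 <= \prod_(i <- s) f i <= \prod_(i <- s) g i)%E.
Proof.
elim: s => [|i s IH] fg; first by rewrite !big_nil lexx andbT.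
rewrite !big_cons; have /andP[f0 fgi] : (0 <= f i <= g i)%E.
  by apply: fg; rewrite inE eqxx.
have /andP[F0 FG] : (0 <= \prod_(j <- s) f j <= \prod_(j <- s) g j)%E.
  by apply: IH => j js; apply: fg; rewrite inE js orbT.
by rewrite mule_ge0//= lee_pmul.
Qed.

Lemma uniq_le_counting (R : realType) (T : choiceType) (A : set T) (s : seq T) (k : nat) :
  uniq s -> (forall i, i \in s -> A i) -> counting A = k%:R%:E :> \bar R ->
  (size s <= k)%N.
Proof.
move=> us sA; rewrite /counting; case: ifPn => [/asboolP fA|_] // -[/eqP].
rewrite eqr_nat => /eqP <-.
apply: uniq_leq_size => // i /sA Ai; rewrite in_fset_set//.
exact/mem_set.
Qed.

Lemma ge0_eq_integral_g_sigma d (T : measurableType d) (R : realType)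
    (C : set (set T)) (m1 m2 : {measure set T -> \bar R}) (f : T -> \bar R) :
  C `<=` measurable -> (forall A, <<s C >> A -> m1 A = m2 A) ->
  measurable_fun (setT : set (g_sigma_algebraType C)) f -> (forall w, 0 <= f w)%E ->
  (\int[m1]_w f w = \int[m2]_w f w)%E.
Proof.
move=> Cm m12 mf f0; have mid := measurable_id_g_sigma Cm.
have key (m : {measure set T -> \bar R}) :
  (\int[m]_w f w = \int[measure_function_pushforward__canonical__measure_function_Measure
     m mid]_w f w)%E.
  by rewrite (@ge0_integral_pushforward _ _ T (g_sigma_algebraType C) R id mid m setT f).
by rewrite !key; apply: eq_measure_integral => A mA _; exact: m12.
Qed.

Lemma ler_sum_uniq_sub (R : numDomainType) (I : eqType) (s1 s2 : seq I) (f : I -> R) :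
  uniq s1 -> {subset s1 <= s2} -> (forall i, 0 <= f i) ->
  \sum_(i <- s1) f i <= \sum_(i <- s2) f i.
Proof.
move=> + + f0; elim: s1 s2 => [|i s1 IH] s2 /=; first by rewrite big_nil sumr_ge0.
move=> /andP[is1 us1] s12; have is2 : i \in s2 by apply: s12; rewrite inE eqxx.
rewrite big_cons (big_rem i is2)/= lerD2l; apply: IH => // j js1.
apply: rem_mem; first by apply: contraNneq is1 => <-.
by apply: s12; rewrite inE js1 orbT.
Qed.

Lemma count_series (R : realType) (c : \bar R) (k : nat) (f : nat -> \bar R) :
  (forall i, 0 <= f i)%E -> c = k%:R%:E ->
  (\sum_(i <oo) (f i * (if c == i%:R%:E then 1 else 0)) = f k)%E.
Proof.
move=> f0 ->; rewrite (@nneseriesD1 _ _ k)//; last first.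
  by move=> i _; rewrite mule_ge0//; case: ifP.
rewrite eqxx mule1 eseries0 ?adde0// => i _ /= ik.
by rewrite eqe eqr_nat eq_sym (negbTE ik) mule0.
Qed.

Definition unchild (v : label) : label * nat := (take (size v).-1 v, last 0%N v).

Lemma unchildK v : (0 < size v)%N -> child (unchild v) = v.
Proof.
case/lastP: v => // v i _; rewrite /unchild /child /= size_rcons /= last_rcons.
by congr rcons; rewrite -cats1 take_size_cat.
Qed.

Section cluster_moment.
Context (R : realType) (M : nat) (H : 'M[R]_M) (h : 'I_M -> 'I_M -> R -> R).
Context (d : measure_display) (T : measurableType d) (P : probability T R).
Context (m0 : 'I_M) (G : T -> Defs.cluster R M).
Hypothesis HG : is_cluster P h m0 0 G.
Hypothesis mh : forall i j, measurable_fun `[(0 : R), +oo[ (h i j).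
Hypothesis h0 : forall i j (t : R), 0 <= t -> 0 <= h i j t.
Hypothesis hH : forall i j, l1norm (h i j) = (H i j)%:E.

Context (a rho u : R) (B : set R).
Hypothesis a0 : 0 <= a.
Hypothesis mB : measurable B.
Hypothesis rho0 : 0 <= rho.
Hypothesis urho : expR u <= rho.
Hypothesis bound_u : forall n i, linear_bound H a rho n i <= u.

Local Notation lam := (log_moment (kernel h) a B).
Local Notation leb := (@lebesgue_measure R).
Let mk := measurable_kernel mh.
Let k0 := kernel_ge0 h0.
Let kH := integral_kernel mh hH.

Let mlam n i : measurable_fun setT (lam n i).
Proof. exact: (measurable_log_moment mk k0 kH a0 mB rho0 urho bound_u). Qed.

Let lam_ge0 n i y : 0 <= lam n i y.
Proof. exact: (log_moment_ge0 mk k0 kH a0 mB rho0 urho bound_u). Qed.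

Let kint_fin n i j y : kernel_integral (kernel h i j) (lam n j) y \is a fin_num.
Proof. exact: (kernel_integral_fin mk k0 kH a0 mB rho0 urho bound_u). Qed.

Let kint_ge0 n i j y : (0 <= kernel_integral (kernel h i j) (lam n j) y)%E.
Proof. exact: kernel_integral_ge0. Qed.

Let H0 i j : 0 <= H i j.
Proof. by rewrite -lee_fin -kH; apply: integral_ge0 => t _; rewrite lee_fin. Qed.

Let dens_ge0 i j y : 0 <= displacement_density h i j y.
Proof. by rewrite (displacement_density_eq hH) divr_ge0. Qed.

Let mdens i j : measurable_fun setT (displacement_density h i j).
Proof.
rewrite (_ : displacement_density h i j = fun y => kernel h i j y / H i j).
  by apply: measurable_funM.
by apply/funext => y; rewrite (displacement_density_eq hH).
Qed.

(* [psi n i j y] dominates the exponential moment of the cluster of a child of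
   type [j] of an individual of type [i] born at [y]. *)
Let psi n i j y : R :=
  1 + fine (kernel_integral (kernel h i j) (lam n j) y) / H i j.

Let psi_ge1 n i j y : 1 <= psi n i j y.
Proof. by rewrite /psi lerDl divr_ge0// fine_ge0. Qed.

Let mpsi n i j : measurable_fun setT (psi n i j).
Proof.
apply: measurable_funD => //; apply: measurable_funM => //.
by apply: measurableT_comp => //; apply: measurable_kernel_integral.
Qed.

(** For [H i j] nonzero the density has mass 1, and splitting [exp] into [1 + (exp - 1)] produces
    the two terms of [psi]. For [H i j = 0] the density is the zero function while [psi] is 1, so
    only an inequality holds. *)
Let psi_bound n i j s :
  (\int[leb]_y ((expR (lam n j (s + y)))%:E * (displacement_density h i j y)%:E)
    <= (psi n i j s)%:E)%E.
Proof.
have [Hij|Hij] := eqVneq (H i j) 0.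
  rewrite integral0_eq; first by rewrite lee_fin (le_trans ler01).
  by move=> y _; rewrite (displacement_density_eq hH) Hij invr0 mulr0 mule0.
have mkE : measurable_fun setT (fun y => (kernel h i j y / H i j)%:E).
  by apply/measurable_EFinP; apply: measurable_funM.
have me : measurable_fun setT (fun y => (kernel h i j y * (expR (lam n j (s + y)) - 1))%:E).
  apply/measurable_EFinP; apply: measurable_funM => //.
  apply: measurable_funB => //; apply: measurableT_comp => //.
  by apply: (measurableT_comp (mlam n j)); exact: measurable_funD.
have mHe : measurable_fun setT (fun y => (H i j)^-1%:E *
    (kernel h i j y * (expR (lam n j (s + y)) - 1))%:E)%E.
  exact: emeasurable_funM.
have e0 y : (0 <= (kernel h i j y * (expR (lam n j (s + y)) - 1))%:E)%E.
  by rewrite lee_fin mulr_ge0// subr_ge0 -expR0 ler_expR.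
have i0 : 0 <= (H i j)^-1 by rewrite invr_ge0.
have -> : (\int[leb]_y ((expR (lam n j (s + y)))%:E *
    (displacement_density h i j y)%:E) =
    \int[leb]_y ((kernel h i j y / H i j)%:E + (H i j)^-1%:E *
    (kernel h i j y * (expR (lam n j (s + y)) - 1))%:E))%E.
  apply: eq_integral => y _; rewrite (displacement_density_eq hH).
  by rewrite -!EFinM -EFinD; congr EFin; ring.
rewrite ge0_integralD//; last 2 first.
- by move=> y _; rewrite lee_fin divr_ge0.
- by move=> y _; rewrite mule_ge0// lee_fin.
rewrite ge0_integralZl//.
rewrite -/(kernel_integral (kernel h i j) (lam n j) s) -(fineK (kint_fin n i j s)).
under eq_integral do rewrite mulrC EFinM.
have mkE0 : measurable_fun setT (fun y => (kernel h i j y)%:E).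
  by apply/measurable_EFinP.
rewrite ge0_integralZl//; last by move=> y _; rewrite lee_fin.
by rewrite kH -!EFinM -EFinD mulVf// /psi [X in _ + X]mulrC lexx.
Qed.

Lemma cval_path_sum w v (f : 'I_M -> R -> R) (x : R) :
  cval (G w) v (fun m b => f m (x + b)) =
  if ctype (G w) v is Some m then f m (x + path_sum (G w) v) else 0.
Proof.
have := birth_path_sum (u := v) (cluster_tree HG w) (cluster_root HG w).
rewrite /cval /ctype /birth /cval; case: (G w v) => [[m b]|] //=.
by move=> /(_ isT) <-.
Qed.

(* Weights interpolating between the points of [B] alone ([k = n]) and
   [log_moment n] at the root ([k = 0]): the generations before [k] have their
   true weight, those after [k] are accounted for by [log_moment] at generation
   [k]. *)
Let lw n k s m y : R :=
  if (s < k)%N then a * \1_B y else if s == k then lam (n - k) m y else 0.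

Let cw n k x v w : R := cval (G w) v (fun m b => lw n k (size v) m (x + b)).

Let cwE n k x v w : cw n k x v w =
  if ctype (G w) v is Some m then lw n k (size v) m (x + path_sum (G w) v) else 0.
Proof. exact: cval_path_sum. Qed.

Let mlw n k s m : measurable_fun setT (lw n k s m).
Proof.
rewrite /lw; case: (s < k)%N; last by case: (s == k); [exact: mlam|].
by apply: measurable_funM => //; exact: measurable_indic.
Qed.

Let mcw n k x v : measurable_fun setT (cw n k x v).
Proof.
apply: (measurable_cval (cluster_measurable HG)) => m.
by apply: (measurableT_comp (mlw _ _ _ _)); exact: measurable_funD.
Qed.

Let mexp_sum (I : Type) (l : seq I) (f : I -> T -> R) :
  (forall v, measurable_fun setT (f v)) ->
  measurable_fun setT (fun w => (expR (\sum_(v <- l) f v w))%:E).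
Proof.
move=> mf; apply/measurable_EFinP; apply: measurableT_comp => //.
exact: measurable_sum.
Qed.

Let Xs x v w : R :=
  if ctype (G w) v is Some m then a * \1_B (x + path_sum (G w) v) else 0.

Let mXs x v : measurable_fun setT (Xs x v).
Proof.
rewrite (_ : Xs x v = fun w => cval (G w) v (fun m b => a * \1_B (x + b))).
  apply: (measurable_cval (cluster_measurable HG)) => m.
  apply: measurable_funM => //.
  have m1 : measurable_fun setT (\1_B : R -> R) by exact: measurable_indic.
  by apply: (measurableT_comp m1); exact: measurable_funD.
by apply/funext => w; rewrite (cval_path_sum w v (fun _ y => a * \1_B y)).
Qed.

(* What remains of the child [child p] once its displacement is integrated out;
   it only depends on the birth date of the parent. *)
Let pe n x p w : R := if ctype (G w) p.1 is Some i then
  if ctype (G w) (child p) is Some j then psi n i j (x + path_sum (G w) p.1)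
  else 1 else 1.

Let mpath v : measurable_fun setT (fun w => path_sum (G w) v).
Proof.
apply: (measurable_cylW HG (J := setT)).
by apply: measurable_cyl_path_sum.
Qed.

Let pe_ge1 n x p w : 1 <= pe n x p w.
Proof. by rewrite /pe; case: ctype => // i; case: ctype. Qed.

Let mpe n x p : measurable_fun setT (pe n x p).
Proof.
have mc v o : measurable [set w | ctype (G w) v = o].
  by apply: (tts_measurable HG); exact: tts_ctype.
pose F i j w : R := if [&& ctype (G w) p.1 == Some i & ctype (G w) (child p) == Some j]
  then psi n i j (x + path_sum (G w) p.1) - 1 else 0.
rewrite (_ : pe n x p = fun w => 1 + \sum_i \sum_j F i j w); last first.
  apply/funext => w; rewrite /pe /F.
  case: (ctype (G w) p.1) => [i|]; last first.
    by rewrite big1 ?addr0// => i _; rewrite big1.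
  rewrite (bigD1 i)//= [X in _ + (_ + X)]big1 ?addr0; last first.
    by move=> i' /negbTE; rewrite eq_sym => ii'; rewrite big1// => j _; rewrite
      (inj_eq Some_inj) ii'.
  rewrite eqxx /=; case: ctype => [j|]; last by rewrite big1 ?addr0.
  rewrite (bigD1 j)//= eqxx big1 ?addr0; last first.
    by move=> j' /negbTE; rewrite eq_sym (inj_eq Some_inj) => ->.
  by rewrite addrCA subrr addr0.
apply: measurable_funD => //; apply: measurable_sum => i; apply: measurable_sum => j.
apply: measurable_fun_ifT => //; last first.
  apply: measurable_funB => //; apply: (measurableT_comp (mpsi n i j)).
  by apply: measurable_funD => //; exact: mpath.
have mb v o : measurable_fun setT (fun w => ctype (G w) v == o).
  apply: (@measurable_fun_bool _ _ _ _ true); rewrite setTI.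
  rewrite (_ : _ @^-1` _ = [set w | ctype (G w) v = o])//.
  by apply/seteqP; split => w /= /eqP.
by apply: measurable_and.
Qed.

Let upto (l : seq label) k := [seq v <- l | (size v <= k)%N].

Let edges_to (l : seq label) k := map unchild [seq v <- l | size v == k.+1].

Let edges_to_size l k p : p \in edges_to l k -> size p.1 = k.
Proof.
move=> /mapP[v]; rewrite mem_filter => /andP[/eqP sv _] ->.
by rewrite /unchild /= size_take sv ltnSn.
Qed.

(** Generation [k.+1] carries the weight [log_moment (n - k.+1)] at its birth dates; averaging over
    the last displacement leaves [psi] evaluated at the birth date of the parent. *)
Let integrate_last_generation n k x (l : seq label) : uniq l ->
  (\int[P]_w (expR (\sum_(v <- l) cw n k.+1 x v w))%:E <=
   \int[P]_w ((expR (\sum_(v <- upto l k) Xs x v w))%:E *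
     \prod_(p <- edges_to l k) (pe (n - k.+1) x p w)%:E))%E.
Proof.
move=> ul; set l1 := upto l k; set e := edges_to l k; set n' := (n - k.+1)%N.
have mE t : measurable (tree_upto G k.+1 t) by exact: measurable_tree_upto HG _ _.
have ue : uniq e.
  rewrite map_inj_in_uniq ?filter_uniq// => v v'.
  rewrite !mem_filter => /andP[/eqP sv _] /andP[/eqP sv' _] vv'.
  by rewrite -(@unchildK v) ?sv// vv' unchildK ?sv'.
have he p : p \in e -> size p.1 = k by exact: edges_to_size.
have mR : measurable_fun setT (fun w => (expR (\sum_(v <- l1) Xs x v w))%:E *
     \prod_(p <- e) (pe n' x p w)%:E)%E.
  apply: emeasurable_funM; first exact: mexp_sum.
  by apply: measurable_prode => p; apply/measurable_EFinP; exact: mpe.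
apply: (@le_integral_cover _ _ R P
  (fun q => tree_upto G k.+1 (finite_tree M q))) => //.
- by apply: (tree_upto_cover HG) => i j; rewrite (offspring_mean_eq hH).
- exact: tree_upto_disjoint.
- exact: mexp_sum.
- move=> w; rewrite mule_ge0 ?lee_fin ?expR_ge0//.
  by apply: prode_ge0 => p; rewrite lee_fin (le_trans ler01).
move=> q; set t := finite_tree M q; pose E := tree_upto G k.+1 t.
pose e' := [seq p <- e | isSome (t (child p))].
(* On the atom the types are read off [t], so that [Psi] and [phi] involve the tree through its
   displacements only. *)
pose Psi w := (expR (\sum_(v <- l1) (if t v is Some m then
   a * \1_B (x + path_sum (G w) v) else 0)))%:E.
pose phi (p : label * nat) (z : R * R) :=
  (expR (lam n' (odflt m0 (t (child p))) (x + z.1 + z.2)))%:E.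
have mphi p : measurable_fun setT (phi p).
  apply/measurable_EFinP; apply: measurableT_comp => //.
  apply: (measurableT_comp (mlam _ _)).
  by apply: measurable_funD => //; exact: measurable_funD.
have phi0 p z : (0 <= phi p z)%E by rewrite lee_fin expR_ge0.
have ue' : uniq e' by rewrite filter_uniq.
have he' p : p \in e' -> size p.1 = k /\ isSome (t (child p)).
  by rewrite mem_filter => /andP[tp /he].
have mPsi : measurable_fun (setT : set (g_sigma_algebraType (cylinders
    (displacement_events G) [set p | (size p.1 < k.+1)%N /\ p \notin e']))) Psi.
  apply/measurable_EFinP; apply: measurableT_comp => //.
  rewrite (_ : (fun _ => _) = fun w => \sum_(v <- l1) (if v \in l1 then
    if t v is Some m then a * \1_B (x + path_sum (G w) v) else 0 else 0)); last first.
    by apply/funext => w; apply: eq_big_seq => v ->.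
  apply: measurable_sum => v; case: (boolP (v \in l1)) => //; rewrite mem_filter.
  move=> /andP[vk _]; case: (t v) => // _; apply: measurable_funM => //.
  have m1 : measurable_fun setT (\1_B : R -> R) by exact: measurable_indic.
  apply: (measurableT_comp m1); apply: measurable_funD => //.
  apply: measurable_cyl_path_sum => p pv; split.
    by rewrite ltnS (leq_trans (ltnW pv)).
  apply/negP => /he' [pk _]; move: pv; rewrite pk ltnNge.
  by rewrite vk.
have Psi0 w : (0 <= Psi w)%E by rewrite lee_fin expR_ge0.
have key := integrate_displacements HG mh h0 hH ue' he' mphi phi0 mPsi Psi0.
have -> : (\int[P]_(w in E) (expR (\sum_(v <- l) cw n k.+1 x v w))%:E =
  \int[P]_(w in E) (Psi w *
    \prod_(p <- e') phi p (path_sum (G w) p.1, displacement (G w) p)))%E.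
  apply: eq_integral => w /set_mem Ew.
  rewrite /Psi /phi -expR_sumE -EFinM -expRD; congr (expR _)%:E.
  rewrite (bigID (fun v => (size v <= k)%N)) /= -big_filter -/l1; congr (_ + _).
    apply: eq_big_seq => v; rewrite mem_filter => /andP[vk _].
    rewrite cwE Ew ?(leq_trans vk)//; case: (t v) => // m.
    by rewrite /lw ltnS vk.
  rewrite (bigID (fun v => size v == k.+1)) /= [X in _ + X]big1 ?addr0; last first.
    move=> v /andP[vk1 vk2]; rewrite cwE; case: ctype => // m.
    by rewrite /lw ltnS (negbTE vk1) (negbTE vk2).
  transitivity (\sum_(v <- l | size v == k.+1) (if isSome (t v) then
     lam n' (odflt m0 (t v)) (x + path_sum (G w) v) else 0)).
    rewrite (eq_bigl (fun v => size v == k.+1)); last first.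
      by move=> v; rewrite /=; case: eqP => [->|]; rewrite ?andbF// ltnn.
    apply: eq_bigr => v /eqP sv; rewrite cwE Ew ?sv//; case: (t v) => // m.
    by rewrite /lw ltnn eqxx.
  rewrite /e' big_filter /e /edges_to big_map big_filter_cond.
  rewrite [RHS](eq_bigl (fun v => (size v == k.+1) && isSome (t v))); last first.
    move=> v; case: eqP => //= sv; by rewrite unchildK// sv.
  rewrite big_mkcondr; apply: eq_bigr => v /eqP sv; case: ifP => // tv.
  by rewrite -addrA -path_sum_rcons unchildK// sv.
have -> : (\int[P]_(w in E) ((expR (\sum_(v <- l1) Xs x v w))%:E *
     \prod_(p <- e) (pe n' x p w)%:E) =
   \int[P]_(w in E) (Psi w * \prod_(p <- e')
     (psi n' (odflt m0 (t p.1)) (odflt m0 (t (child p))) (x + path_sum (G w) p.1))%:E))%E.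
  apply: eq_integral => w /set_mem Ew; congr (_ * _)%E.
    rewrite /Psi; congr (expR _)%:E; apply: eq_big_seq => v.
    by rewrite mem_filter => /andP[vk _]; rewrite /Xs Ew// (leq_trans vk).
  rewrite /e' big_filter [RHS]big_mkcond; apply: eq_big_seq => p /he pk.
  have ck : (size (child p) <= k.+1)%N by rewrite /child size_rcons pk.
  have pk' : (size p.1 <= k.+1)%N by rewrite pk.
  rewrite /pe (Ew _ pk') (Ew _ ck).
  case tp : (t (child p)) => [j|] /=; last by case: (t p.1).
  suff : isSome (t p.1) by case: (t p.1).
  have [_ /(_ p.1 p.2) gt] := cluster_tree HG w.
  rewrite -Ew//; have [|] := gt; last by rewrite /ctype; case: (G w p.1).
  by move: tp; rewrite -Ew// /ctype /child; case: (G w _).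
rewrite key; apply: ge0_le_integral => //.
- move=> w _; rewrite mule_ge0//; apply: prode_ge0 => p.
  by apply: integral_ge0 => y _; rewrite mule_ge0// lee_fin.
- apply: measurable_funTS; apply: emeasurable_funM.
    by apply: (measurable_cylW HG mPsi).
  apply: measurable_prode => p.
  have mphid : measurable_fun setT (fun z : R * R => phi p z *
      (displacement_density h (odflt m0 (t p.1)) (odflt m0 (t (child p))) z.2)%:E)%E.
    apply: emeasurable_funM => //; apply/measurable_EFinP.
    by apply: (measurableT_comp (mdens _ _)).
  have phid0 (z : R * R) : (0 <= phi p z *
      (displacement_density h (odflt m0 (t p.1)) (odflt m0 (t (child p))) z.2)%:E)%E.
    by rewrite mule_ge0// lee_fin.
  have mF := @measurable_fun_fubini_tonelli_F _ _ _ _ R leb _ mphid phid0.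
  exact: (measurableT_comp mF (mpath p.1)).
- apply: measurable_funTS; apply: emeasurable_funM.
    by apply: (measurable_cylW HG mPsi).
  apply: measurable_prode => p; apply/measurable_EFinP.
  apply: (measurableT_comp (mpsi _ _ _)).
  by apply: measurable_funD => //; exact: mpath.
- move=> w _; apply: lee_wpmul2l => //.
  refine (elimT andP (@lee_prode R _ e' (fun p => \int[leb]_y
    (phi p (path_sum (G w) p.1, y) * (displacement_density h (odflt m0 (t p.1))
      (odflt m0 (t (child p))) y)%:E))%E (fun p => (psi n' (odflt m0 (t p.1))
      (odflt m0 (t (child p))) (x + path_sum (G w) p.1))%:E) _)).2.
  move=> p _; apply/andP; split.
    by apply: integral_ge0 => y _; rewrite mule_ge0// lee_fin.
  have := psi_bound n' (odflt m0 (t p.1)) (odflt m0 (t (child p)))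
    (x + path_sum (G w) p.1).
  by rewrite /phi /=.
Qed.

(** What is left of generation [k.+1] is transferred to the parents, which must therefore be added
    to the list; [undup] prevents counting them twice. *)
Let parents_upto l k := undup (upto l k ++ map fst (edges_to l k)).

Let parents_upto_size l k v : v \in parents_upto l k -> (size v <= k)%N.
Proof.
rewrite mem_undup mem_cat => /orP[|/mapP[p /edges_to_size <- ->]//].
by rewrite mem_filter => /andP[].
Qed.

Let uniq_edges_to l k : uniq l -> uniq (edges_to l k).
Proof.
move=> ul; rewrite map_inj_in_uniq ?filter_uniq// => v v'.
rewrite !mem_filter => /andP[/eqP sv _] /andP[/eqP sv' _] vv'.
by rewrite -(@unchildK v) ?sv// vv' unchildK ?sv'.
Qed.

(** The left-hand side is the exponent of the Poisson generating function at [psi], the right-hand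
    side a summand in the recursion of [log_moment]. *)
Let psi_rate n i j y : H i j * (psi n i j y - 1) <=
  fine (kernel_integral (kernel h i j) (lam n j) y).
Proof.
rewrite /psi addrC addrA addNr add0r.
have [->|Hij] := eqVneq (H i j) 0; first by rewrite mul0r fine_ge0.
by rewrite mulrCA divff ?mulr1.
Qed.

Let J k := [set p : label * nat | (size p.1 < k)%N].

(** The numbers of children in generation [k] are independent of the displacements of earlier edges,
    given the tree up to [k]. Prescribing these numbers is an event of the typed tree, so it can be
    taken as [Ev] in [tree_displacements]: the restriction of [P] to it is proportional to the
    restriction to the atom on cylinders of displacements, hence on the sigma-algebra for which [f]
    is measurable. *)
Let independent_offspring k t (s : seq label) (c : label * 'I_M -> nat) (f : T -> \bar R) :
  uniq s -> (forall v, v \in s -> size v = k /\ isSome (t v)) ->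
  measurable_fun
    (setT : set (g_sigma_algebraType (cylinders (displacement_events G) (J k)))) f ->
  (forall w, 0 <= f w)%E ->
  let sj := [seq (v, j) | v <- s, j <- index_enum 'I_M] in
  (\int[P]_(w in tree_upto G k t `&`
     \bigcap_(q in [set` sj]) [set w | nchildren (G w) q.1 q.2 = (c q)%:R%:E]) f w =
   1 * \prod_(q <- sj) poisson_mass (H (odflt m0 (t q.1)) q.2) (c q) *
     \int[P]_(w in tree_upto G k t) f w)%E.
Proof.
move=> us hs mf f0 sj; rewrite mul1e; set E := tree_upto G k t.
set Ev := \bigcap_(q in _) _; set pr := (\prod_(q <- sj) _)%E.
have mE : measurable E by exact: measurable_tree_upto HG _ _.
pose TT : measurableType _ := g_sigma_algebraType (typed_tree_events G).
have tEv : <<s typed_tree_events G >> Ev.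
  rewrite /Ev bigcap_seq; apply: (@bigsetI_measurable _ TT) => q _.
  exact: tts_nchildren.
have mEv := tts_measurable HG tEv.
have mEEv : measurable (E `&` Ev) by exact: measurableI.
have pr0 : (0 <= pr)%E by apply: prode_ge0 => q; exact: poisson_mass_ge0.
have prfin : pr \is a fin_num.
  rewrite /pr; elim/big_ind : _ => // [x y|q _]; first exact: fin_numM.
  exact: fin_num_measure.
have PEEv : P (E `&` Ev) = (pr * P E)%E.
  have := @cluster_offspring _ _ _ _ _ _ _ _ _ HG k t (fun u => odflt m0 (t u)) s
    (fun u m => c (u, m)) us.
  have hs' v : v \in s -> size v = k /\ t v = Some (odflt m0 (t v)).
    by move=> /hs[-> tv]; split => //; case: (t v) tv.
  move=> /(_ hs') /=; rewrite -/(tree_upto G k t) -/E.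
  have -> : E `&` [set w | forall v m, v \in s -> nchildren (G w) v m = (c (v, m))%:R%:E]
      = E `&` Ev.
    congr (_ `&` _); apply/seteqP; split => w hw.
      by move=> [v j] /= /allpairsP[[v' j'] /= [vs _ [-> ->]]]; exact: hw.
    move=> v j vs; apply: (hw (v, j)) => /=; apply/allpairsP.
    by exists (v, j); split => //=; exact: mem_index_enum.
  move=> ->; rewrite muleC /pr /sj big_allpairs; congr (_ * _)%E.
  apply: eq_bigr => v _; apply: eq_bigr => j _.
  by rewrite (offspring_mean_eq hH).
pose r : {nonneg R} := NngNum (fine_ge0 pr0).
have rE : (r%:num)%:E = pr by rewrite /r /= fineK.
have Cm : cylinders (displacement_events G) (J k) `<=` measurable.
  apply: cylinders_measurable; exact: (displacement_events_measurable HG).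
have mfT := measurable_cylW HG mf.
rewrite -(integral_mrestr P mEEv mfT f0) -(integral_mrestr P mE mfT f0) -rE.
have <- : (\int[mscale r (mrestr P mE)]_w f w =
    (r%:num)%:E * \int[mrestr P mE]_w f w)%E by rewrite ge0_integral_mscale.
apply: (ge0_eq_integral_g_sigma Cm _ mf) => // Q sQ.
apply: (g_sigma_finite_measure_eq (m1 := mrestr P mEEv)
  (m2 := mscale r (mrestr P mE)) Cm _ _ _ _ sQ).
- apply: cylinders_setI; [exact: displacement_eventsT|exact: displacement_eventsI].
- apply: cylinders_setT; exact: displacement_eventsT.
- by rewrite ltey_eq fin_num_measure.
move=> _ [se [A [use sJ FA ->]]].
have /choice[C HC] : forall q, exists C, measurable C /\
    A q = (fun w => displacement (G w) q) @^-1` C.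
  by move=> q; have [C mC EC] := FA q; exists C.
(* The displacement laws depend on [t] only, so they are the same with and without the event on the
   offspring. *)
have k1 := tree_displacements HG t tEv use sJ (fun q => (HC q).1).
have tT : <<s typed_tree_events G >> (setT : set T) by exact: (@measurableT _ TT).
have k2 := tree_displacements HG t tT use sJ (fun q => (HC q).1).
have EA : \bigcap_(i in [set` se]) A i =
    \bigcap_(i in [set` se]) ((fun w => displacement (G w) i) @^-1` C i).
  by apply: eq_bigcapr => q _; exact: (HC q).2.
transitivity (P (\bigcap_(i in [set` se]) A i `&` (E `&` Ev))) => //.
transitivity ((r%:num)%:E * P (\bigcap_(i in [set` se]) A i `&` E))%E => //.
rewrite rE EA [in LHS]setIC k1 PEEv [in RHS]setIC.
by move: k2; rewrite setIT => ->; rewrite muleA.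
Qed.

(** The edges of the list with parent [v] and child of type [j] are at most as many as the children
    of [v] of type [j], and [psi >= 1]; their product is thus at most a power of [psi] whose
    exponent is a Poisson variable. Its generating function rebuilds one step of [log_moment] at
    [v]. *)
Let poisson_step n k x (l : seq label) : (k < n)%N -> uniq l ->
  (\int[P]_w ((expR (\sum_(v <- upto l k) Xs x v w))%:E *
     \prod_(p <- edges_to l k) (pe (n - k.+1) x p w)%:E) <=
   \int[P]_w (expR (\sum_(v <- parents_upto l k) cw n k x v w))%:E)%E.
Proof.
move=> kn ul; set n' := (n - k.+1)%N; set l' := parents_upto l k.
set e := edges_to l k.
(* Here [k < n] matters: [log_moment (n - k)] unfolds once. *)
have n'E : (n - k)%N = n'.+1 by rewrite /n' subnSK.
have ul' : uniq l' by exact: undup_uniq.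
have mLHS : measurable_fun setT (fun w => (expR (\sum_(v <- upto l k) Xs x v w))%:E *
     \prod_(p <- e) (pe n' x p w)%:E)%E.
  apply: emeasurable_funM; first exact: mexp_sum.
  by apply: measurable_prode => p; apply/measurable_EFinP; exact: mpe.
have LHS0 w : (0 <= (expR (\sum_(v <- upto l k) Xs x v w))%:E *
     \prod_(p <- e) (pe n' x p w)%:E)%E.
  rewrite mule_ge0 ?lee_fin ?expR_ge0//.
  by apply: prode_ge0 => p; rewrite lee_fin (le_trans ler01).
apply: (@le_integral_cover _ _ R P
  (fun q => tree_upto G k (finite_tree M q))) => //.
- by move=> q; exact: measurable_tree_upto HG _ _.
- by apply: (tree_upto_cover HG) => i j; rewrite (offspring_mean_eq hH).
- exact: tree_upto_disjoint.
- exact: mexp_sum.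
move=> q0; set t := finite_tree M q0; pose E := tree_upto G k t.
have mE : measurable E by exact: measurable_tree_upto HG _ _.
pose s := [seq v <- l' | (size v == k) && isSome (t v)].
pose sj := [seq (v, j) | v <- s, j <- index_enum 'I_M].
have us : uniq s by rewrite filter_uniq.
have hs v : v \in s -> size v = k /\ isSome (t v).
  by rewrite mem_filter => /andP[/andP[/eqP]].
have usj : uniq sj by apply: allpairs_uniq => //; [exact: index_enum_uniq|move=> [? ?] [? ?]].
have sjP (q : label * 'I_M) : q \in sj -> q.1 \in s.
  by move=> /allpairsP[[v j] /= [vs _ ->]].
pose Y (v : label) w := if t v is Some m then a * \1_B (x + path_sum (G w) v) else 0.
have Y0 v w : 0 <= Y v w by rewrite /Y; case: (t v) => // m; rewrite mulr_ge0.
pose f w := (expR (\sum_(v <- l') Y v w))%:E : \bar R.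
pose ps (q : label * 'I_M) w :=
  psi n' (odflt m0 (t q.1)) q.2 (x + path_sum (G w) q.1).
have ps1 q w : 1 <= ps q w by exact: psi_ge1.
pose phi (q : label * 'I_M) (c : nat) w : \bar R :=
  if q \in sj then ((ps q w) ^+ c)%:E else 1%E.
have phi0 q c w : (0 <= phi q c w)%E.
  rewrite /phi; case: ifP => // _.
  by rewrite lee_fin exprn_ge0// (le_trans ler01).
pose A (q : label * 'I_M) (c : nat) := [set w | nchildren (G w) q.1 q.2 = c%:R%:E].
have mA q c : measurable (A q c) by exact: (measurable_nchildren HG).
pose pr (q : label * 'I_M) (c : nat) := poisson_mass (H (odflt m0 (t q.1)) q.2) c.
have pr0 q c : (0 <= pr q c)%E by exact: poisson_mass_ge0.
pose cJ := g_sigma_algebraType (cylinders (displacement_events G) (J k)).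
have mpathJ v : (size v <= k)%N ->
    measurable_fun (setT : set cJ) (fun w => path_sum (G w) v).
  by move=> vk; apply: measurable_cyl_path_sum => p pv; exact: leq_trans vk.
have mphi q c : measurable_fun (setT : set cJ) (phi q c).
  rewrite /phi; case: (boolP (q \in sj)) => qsj; last exact: measurable_cst.
  apply/measurable_EFinP; apply: measurable_funX.
  apply: (measurableT_comp (mpsi _ _ _)); apply: measurable_funD => //.
  by apply: mpathJ; have [-> _] := hs _ (sjP _ qsj).
have mf : measurable_fun (setT : set cJ) f.
  apply/measurable_EFinP; apply: measurableT_comp => //.
  rewrite (_ : (fun _ => _) = fun w => \sum_(v <- l') (if v \in l' then Y v w else 0)); last first.
    by apply/funext => w; apply: eq_big_seq => v ->.
  apply: measurable_sum => v; case: (boolP (v \in l')) => // vl'.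
  rewrite /Y; case: (t v) => // _; apply: measurable_funM => //.
  have m1 : measurable_fun setT (\1_B : R -> R) by exact: measurable_indic.
  apply: (measurableT_comp m1); apply: measurable_funD => //.
  by apply: mpathJ; exact: parents_upto_size vl'.
have f0 w : (0 <= f w)%E by rewrite lee_fin expR_ge0.
pose C := [set g : T -> \bar R | measurable_fun (setT : set cJ) g /\ forall w, (0 <= g w)%E].
have key : (\int[P]_(w in E)
     (f w * \prod_(q <- sj) \sum_(c <oo) (phi q c w * (\1_(A q c) w)%:E)) =
   1 * \int[P]_(w in E)
     (f w * \prod_(q <- sj) \sum_(c <oo) (pr q c * phi q c w)))%E.
  apply: (@integral_prod_series _ T R P _ C A phi pr E mE mA).
  - by move=> g [mg g0]; split => //; exact: (measurable_cylW HG mg).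
  - by move=> q c; apply: (measurable_cylW HG (mphi q c)).
  - exact: phi0.
  - move=> q c g [mg g0]; split; first exact: emeasurable_funM.
    by move=> w; exact: mule_ge0.
  - exact: pr0.
  - exact: mE.
  - exact: lee01.
  - exact: usj.
  - by move=> g c [mg g0]; exact: independent_offspring.
  - by split.
rewrite mul1e in key.
pose F1 w := (f w * \prod_(q <- sj) \sum_(c <oo) (phi q c w * (\1_(A q c) w)%:E))%E.
pose F2 w := (f w * \prod_(q <- sj) \sum_(c <oo) (pr q c * phi q c w))%E.
have S10 q w : (0 <= \sum_(c <oo) (phi q c w * (\1_(A q c) w)%:E))%E.
  by apply: nneseries_ge0 => c _ _; rewrite mule_ge0// lee_fin.
have S20 q w : (0 <= \sum_(c <oo) (pr q c * phi q c w))%E.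
  by apply: nneseries_ge0 => c _ _; rewrite mule_ge0.
have mphiT q c := measurable_cylW HG (mphi q c).
have mF1 : measurable_fun setT F1.
  apply: emeasurable_funM; first exact: (measurable_cylW HG mf).
  apply: measurable_prode => q; apply: measurable_nneseries => [c|c w].
    apply: emeasurable_funM => //; apply/measurable_EFinP.
    exact: measurable_indic.
  by rewrite mule_ge0// lee_fin.
have mF2 : measurable_fun setT F2.
  apply: emeasurable_funM; first exact: (measurable_cylW HG mf).
  apply: measurable_prode => q; apply: measurable_nneseries => [c|c w].
    exact: emeasurable_funM.
  by rewrite mule_ge0.
have F10 w : (0 <= F1 w)%E by rewrite mule_ge0// prode_ge0.
have F20 w : (0 <= F2 w)%E by rewrite mule_ge0// prode_ge0.
(* This comparison is only almost sure: the series in [F1] reduces to a power of [psi] when the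
   count is finite. *)
apply: (@le_trans _ _ (\int[P]_(w in E) F1 w)%E).
  apply: ae_ge0_le_integral => //; [exact: measurable_funTS|exact: measurable_funTS|].
  have hm i j : 0 <= offspring_mean h i j by rewrite (offspring_mean_eq hH).
  have := ae_children_finite HG hm; apply: filterS => w fin Ew.
  have ctE v : (size v <= k)%N -> ctype (G w) v = t v by exact: Ew.
  have /choice[c cE] : forall q : label * 'I_M, exists c : nat,
      nchildren (G w) q.1 q.2 = c%:R%:E.
    by move=> q; apply: counting_lty_nat; exact: fin.
  have -> : F1 w = (f w * \prod_(q <- sj) ((ps q w) ^+ c q)%:E)%E.
    congr (_ * _)%E; apply: eq_big_seq => q qsj.
    transitivity (\sum_(i <oo) (phi q i w *
        (if nchildren (G w) q.1 q.2 == i%:R%:E then 1 else 0)))%E.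
      apply: eq_eseriesr => i _; congr (_ * _)%E; rewrite indicE.
      by case: eqP => ci; [rewrite mem_set|rewrite memNset].
    by rewrite (count_series _ (cE q))// /phi qsj.
  apply: lee_pmul; rewrite ?lee_fin ?expR_ge0//.
  - by apply: prode_ge0 => p; rewrite lee_fin (le_trans ler01).
  - rewrite ler_expR (eq_big_seq (fun v => Y v w)); last first.
      by move=> v; rewrite mem_filter => /andP[vk _]; rewrite /Xs ctE.
    apply: ler_sum_uniq_sub => //; first by rewrite filter_uniq.
    by move=> v vl; rewrite mem_undup mem_cat vl.
  rewrite !prode_EFin lee_fin.
  (* [g p q] selects the pair formed by the parent and the type of the child of [p], so the product
     over edges becomes a product over pairs by exchange. *)
  pose g (p : label * nat) (q : label * 'I_M) : R :=
    if (p.1 == q.1) && (ctype (G w) (child p) == Some q.2) then ps q w else 1.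
  have g1 p q : 1 <= g p q by rewrite /g; case: ifP.
  have prod1 (r : seq (label * 'I_M)) p : 1 <= \prod_(q <- r) g p q.
    elim: r => [|q r IH]; first by rewrite big_nil.
    by rewrite big_cons (le_trans (g1 p q))// ler_peMr// (le_trans ler01).
  apply: (@le_trans _ _ (\prod_(p <- e) \prod_(q <- sj) g p q)).
    rewrite big_seq [leRHS]big_seq; apply: ler_prod => p pe0.
    rewrite (le_trans ler01)//= /pe ctE ?(edges_to_size pe0)//.
    case tp : (t p.1) => [i|] //; case cp : (ctype _ _) => [j|] //.
    have q0sj : (p.1, j) \in sj.
      apply/allpairsP; exists (p.1, j); split => //=; last exact: mem_index_enum.
      rewrite mem_filter (edges_to_size pe0) eqxx tp /= mem_undup mem_cat.
      by rewrite map_f ?orbT.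
    rewrite (big_rem _ q0sj)/= {1}/g /= eqxx cp eqxx /= {1}/ps /= tp /=.
    by rewrite ler_peMr// (le_trans ler01).
  rewrite exchange_big /= big_seq [leRHS]big_seq; apply: ler_prod => q qsj.
  apply/andP; split.
    by rewrite (le_trans ler01)//; elim: (e) => [|p r IH];
      [rewrite big_nil|rewrite big_cons (le_trans (g1 p q))// ler_peMr// (le_trans ler01)].
  rewrite /g -big_mkcond big_const_seq iter_mulr_1 ler_weXn2l//.
  rewrite -size_filter -(size_map snd).
  (* The edges selected by [q] have the same parent, so their last indices are distinct and
     designate distinct children. *)
  apply: (@uniq_le_counting R _ [set i | ctype (G w) (rcons q.1 i) = Some q.2]);
    last exact: cE.
    rewrite map_inj_in_uniq ?filter_uniq//; first exact: uniq_edges_to.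
    move=> [u1 i1] [u2 i2]; rewrite !mem_filter /= => /andP[/andP[/eqP -> _] _].
    by move=> /andP[/andP[/eqP -> _] _] ->.
  move=> i /mapP[[v j]]; rewrite mem_filter /= => /andP[/andP[/eqP -> /eqP ctj] _] ->.
  exact: ctj.
apply: (@le_trans _ _ (\int[P]_(w in E) F2 w)%E); first by rewrite key.
apply: ge0_le_integral => //; first exact: measurable_funTS.
  by apply: measurable_funTS; exact: mexp_sum.
move=> w Ew.
have -> : F2 w = (f w * \prod_(q <- sj)
    (expR (H (odflt m0 (t q.1)) q.2 * (ps q w - 1)))%:E)%E.
  congr (_ * _)%E; apply: eq_big_seq => q qsj.
  rewrite -poisson_mass_generating//; last by rewrite (le_trans ler01).
  by apply: eq_eseriesr => c _; rewrite /phi qsj.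
rewrite /f -expR_sumE -EFinM -expRD lee_fin ler_expR.
rewrite /sj big_allpairs /s big_filter big_mkcond -big_split /=.
rewrite big_seq [leRHS]big_seq; apply: ler_sum => v vl'.
have vk := parents_upto_size vl'.
rewrite cwE (Ew _ vk) /Y; case: eqP => [vk'|vk'] /=.
  case tv : (t v) => [m|] /=; last by rewrite addr0.
  rewrite /lw vk' ltnn eqxx n'E /= lerD2l; apply: ler_sum => j _.
  by rewrite /ps /= tv; exact: psi_rate.
rewrite addr0; case: (t v) => // m; rewrite /lw.
by rewrite ltn_neqAle vk andbT; case: eqP.
Qed.

Lemma cluster_exp_moment n x (l : seq label) : uniq l ->
  (forall v, v \in l -> (size v < n)%N) ->
  (\int[P]_w (expR (\sum_(v <- l)
      cval (G w) v (fun _ b => a * \1_B (x + b))))%:E <=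
    (expR (lam n m0 x))%:E)%E.
Proof.
move=> ul ln.
(* The list is quantified inside the induction because each step replaces it by [parents_upto]. At
   [k = 0] the root alone has a weight; at [k = n] all labels of [l] have their true weight, being
   shorter than [n]. *)
have claim k : (k <= n)%N -> forall l : seq label, uniq l ->
    (\int[P]_w (expR (\sum_(v <- l) cw n k x v w))%:E <= (expR (lam n m0 x))%:E)%E.
  elim: k => [_|k IH kn] l' ul'.
    apply: (@le_trans _ _ (\int[P]_w (cst (expR (lam n m0 x))%:E w))%E).
      apply: ge0_le_integral => //; first exact: mexp_sum.
      move=> w _; rewrite lee_fin ler_expR.
      rewrite (eq_bigr (fun v => if v == [::] then lam n m0 x else 0)); last first.
        move=> v _; rewrite cwE /lw ltn0 size_eq0 subn0.
        case: eqP => [->|_]; last by case: ctype.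
        rewrite /ctype (cluster_root HG) /= /path_sum big_nil addr0.
        by [].
      rewrite -big_mkcond.
      have [nl|nl] := boolP ([::] \in l'); last first.
        rewrite big_seq_cond big_pred0 ?lam_ge0// => v.
        by case: eqP => [->|]; rewrite ?andbF// (negbTE nl).
      rewrite (big_rem _ nl) /= big_seq_cond big_pred0 ?addr0// => v.
      case: eqP => [->|]; rewrite ?andbF//.
      by rewrite mem_rem_uniq// inE eqxx.
    rewrite integral_cst//.
    rewrite [X in (_ * X)%E](_ : _ = 1%E) ?mule1//; exact: probability_setT.
  apply: (le_trans (integrate_last_generation n k x ul')).
  apply: (le_trans (poisson_step x kn ul')).
  by apply: IH; [exact: ltnW|exact: undup_uniq].
apply: le_trans (claim n (leqnn n) l ul).
rewrite le_eqVlt; apply/orP; left; apply/eqP.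
apply: eq_integral => w _; congr (expR _)%:E; apply: eq_big_seq => v /ln vn.
by rewrite /cw /lw vn.
Qed.

End cluster_moment.

(** * Exponential formula for a Poisson process *)

Lemma fatou_le (R : realType) (d : measure_display) (T : measurableType d)
    (mu : {measure set T -> \bar R}) (F_ : nat -> T -> \bar R) (F : T -> \bar R)
    (C : \bar R) :
  (forall n, measurable_fun setT (F_ n)) -> (forall n w, (0 <= F_ n w)%E) ->
  measurable_fun setT F -> (forall w, (0 <= F w)%E) ->
  (forall w, (F w <= limn_einf (F_ ^~ w))%E) ->
  (forall n, (\int[mu]_w F_ n w <= C)%E) -> (\int[mu]_w F w <= C)%E.
Proof.
move=> mF_ F_0 mF F0 FF_ F_C.
apply: (@le_trans _ _ (\int[mu]_w limn_einf (F_ ^~ w))%E).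
  apply: ge0_le_integral => //.
  rewrite [X in measurable_fun _ X](_ : _ = -%E \o (fun w => limn_esup (fun n => - F_ n w)%E)).
    apply: measurableT_comp => //; apply: measurable_fun_limn_esup => n.
    exact: measurableT_comp.
  by apply/funext => w; rewrite /= limn_esupN oppeK.
apply: (le_trans (fatou mu measurableT mF_ (fun n w _ => F_0 n w))).
rewrite limn_einf_lim; apply: lime_le; first exact: is_cvg_einfs.
by apply: nearW => n; apply: ereal_inf_le; exists (\int[mu]_w F_ n w)%E => //; exists n => /=.
Qed.

Lemma le_limn_einf (R : realType) (u : nat -> \bar R) (c : \bar R) (K : nat) :
  (forall n, (K <= n)%N -> (c <= u n)%E) -> (c <= limn_einf u)%E.
Proof.
move=> cu; rewrite limn_einf_lim; apply: lime_ge; first exact: is_cvg_einfs.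
exists K => // n /= Kn; apply: le_ereal_inf_tmp => _ [m /= nm <-].
by apply: cu; exact: leq_trans nm.
Qed.

(** An enumeration without repetition cannot list more points of [B] than there are. *)
Lemma count_pmap_le_counting (R : realType) (X : nat -> option R) (B : set R)
    (K c : nat) :
  (forall k l, X k <> None -> X k = X l -> k = l) ->
  counting ([set x | exists k, X k = Some x] `&` B) = c%:R%:E :> \bar R ->
  \sum_(k < K) oapp \1_B 0 (X k) <= c%:R :> R.
Proof.
move=> distinct Nc.
pose s := [seq x <- pmap X (iota 0 K) | x \in B].
have us : uniq s.
  rewrite filter_uniq//; elim: K 0%N {s} => //= K IH n.
  case Xn : (X n) => [x|] //=; rewrite IH andbT mem_pmap.
  apply/negP => /mapP[l]; rewrite mem_iota => /andP[nl _] e.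
  have : n = l by apply: distinct; rewrite Xn.
  by move=> nl'; rewrite -nl' ltnn in nl.
have sN x : x \in s -> ([set x | exists k, X k = Some x] `&` B) x.
  rewrite mem_filter => /andP[/set_mem Bx]; rewrite mem_pmap => /mapP[k _ e].
  by split => //; exists k.
have := uniq_le_counting us sN Nc; rewrite -(ler_nat R); apply: le_trans.
rewrite size_filter -(big_mkord xpredT (fun k => oapp \1_B 0 (X k))).
rewrite /index_iota subn0; elim: (iota 0 K) => [|k t IH]; first by rewrite big_nil.
rewrite big_cons /=; case: (X k) => [x|] /=; last by rewrite add0r.
by rewrite natrD lerD// indicE.
Qed.

Section poisson_exponential.
Context (R : realType) (d : measure_display) (T : measurableType d).
Context (P : probability T R) (rate : R) (X : nat -> T -> option R).
Hypothesis rate0 : 0 <= rate.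
Hypothesis mX : forall k, omeasurable (X k).
Hypothesis X_distinct : forall k l w, X k w <> None -> X k w = X l w -> k = l.
Hypothesis X_poisson :
  poisson_process P rate (fun w => [set x | exists k, X k w = Some x]).

Local Notation pi := (fun w => [set x | exists k, X k w = Some x]).
Local Notation leb := (@lebesgue_measure R).

(** For a step function on disjoint bounded sets the counts are independent Poisson variables and
    each generating function gives a factor. Only the first [K] points enter the left-hand side,
    whence an inequality. *)
Let poisson_simple (K n : nat) (c : 'I_n -> R) (B : 'I_n -> set R) :
  (forall i, 0 <= c i) -> (forall i, measurable (B i) /\ bounded_set (B i)) ->
  trivIset setT B ->
  (\int[P]_w (expR (\sum_(k < K) oapp (fun x => \sum_i c i * \1_(B i) x) 0 (X k w)))%:E
   <= (expR (\sum_i rate * fine (leb (B i)) * (expR (c i) - 1)))%:E)%E.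
Proof.
move=> c0 mbB tB.
have [[mN finN] PN] := X_poisson.
pose A (i : 'I_n) (k : nat) := [set w | counting (pi w `&` B i) = k%:R%:E :> \bar R].
have mA i k : measurable (A i k).
  have := mN (B i) (mbB i).1 measurableT [set k%:R%:E] (emeasurable_set1 _).
  by rewrite setTI.
pose phi (i : 'I_n) (k : nat) (w : T) : \bar R := ((expR (c i)) ^+ k)%:E.
have phi0 i k w : (0 <= phi i k w)%E by rewrite lee_fin exprn_ge0// expR_ge0.
pose p (i : 'I_n) (k : nat) := poisson_mass (rate * fine (leb (B i))) k.
pose C : set (T -> \bar R) := [set f | exists2 r : R, 0 <= r & f = cst r%:E].
have CR : C (cst 1%E) by exists 1.
have key : (\int[P]_(w in setT) (cst 1 w * \prod_(i <- index_enum 'I_n)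
      \sum_(k <oo) (phi i k w * (\1_(A i k) w)%:E)) =
    1 * \int[P]_(w in setT) (cst 1 w * \prod_(i <- index_enum 'I_n)
      \sum_(k <oo) (p i k * phi i k w)))%E.
  apply: (@integral_prod_series _ T R P _ (fun f => exists2 r : R, 0 <= r & f = cst r%:E)
    A phi p setT measurableT mA) => //.
  - by move=> f [r r0 ->]; split => // w; rewrite lee_fin.
  - by move=> i k; exact: measurable_cst.
  - move=> i k f [r r0 ->]; exists (r * expR (c i) ^+ k).
      by rewrite mulr_ge0// exprn_ge0// expR_ge0.
    by apply/funext => w; rewrite /phi /= EFinM.
  - exact: index_enum_uniq.
  - move=> f k [r r0 ->]; rewrite setTI !integral_cst//; last first.
      by rewrite bigcap_seq; apply: bigsetI_measurable.
    rewrite mul1e muleCA; congr (_ * _)%E.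
    have PT : P setT = 1%E by exact: probability_setT.
    transitivity (\prod_(i <- index_enum 'I_n) p i (k i))%E.
      rewrite -(PN n B k mbB tB); congr (P _).
      apply/seteqP; split => w hw i; last by move=> _; exact: hw.
      by apply: hw => /=; exact: mem_index_enum.
    by rewrite -[LHS]mule1; congr (_ * _)%E.
have RHSE : (\int[P]_(w in setT) (cst 1 w * \prod_(i <- index_enum 'I_n)
      \sum_(k <oo) (p i k * phi i k w)) =
    (expR (\sum_i rate * fine (leb (B i)) * (expR (c i) - 1)))%:E)%E.
  rewrite (eq_integral (cst (expR (\sum_i rate * fine (leb (B i)) * (expR (c i) - 1)))%:E)).
    rewrite integral_cst// [X in (_ * X)%E](_ : _ = 1%E) ?mule1//.
    exact: probability_setT.
  move=> w _ /=; rewrite mul1e expR_sumE; apply: eq_bigr => i _.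
  rewrite poisson_mass_generating ?expR_ge0// mulr_ge0// fine_ge0//.
rewrite mul1e RHSE in key; rewrite -key.
have mS i : measurable_fun setT (fun x : R => c i * \1_(B i) x).
  apply: measurable_funM => //; apply: measurable_indic; exact: (mbB i).1.
apply: ae_ge0_le_integral => //.
- apply/measurable_EFinP; apply: measurableT_comp => //.
  apply: measurable_sum => k; apply: omeasurable_oapp => //.
  exact: measurable_sum.
- move=> w _; rewrite mul1e; apply: prode_ge0 => i; apply: nneseries_ge0 => k _ _.
  by rewrite mule_ge0// lee_fin.
- apply: emeasurable_funM => //; apply: measurable_prode => i.
  apply: measurable_nneseries => [k|k w]; last by rewrite mule_ge0// lee_fin.
  apply: emeasurable_funM; first exact: measurable_cst.
  by apply/measurable_EFinP; exact: measurable_indic.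
move: finN; apply: filterS => w fin _.
have /choice[N NE] : forall i, exists k : nat, counting (pi w `&` B i) = k%:R%:E :> \bar R.
  move=> i; apply: counting_lty_nat; apply/counting_lty; apply: fin.
  exact: (mbB i).2.
rewrite mul1e (eq_bigr (fun i => (expR (c i * (N i)%:R))%:E)); last first.
  move=> i _; transitivity (\sum_(k <oo) (phi i k w *
      (if counting (pi w `&` B i) == k%:R%:E :> \bar R then 1 else 0)))%E.
    apply: eq_eseriesr => k _; congr (_ * _)%E; rewrite indicE.
    by case: eqP => ci; [rewrite mem_set|rewrite memNset].
  by rewrite (count_series _ (NE i))// /phi expRM_natr.
rewrite -expR_sumE lee_fin ler_expR.
rewrite (eq_bigr (fun k : 'I_K => \sum_i c i * oapp \1_(B i) 0 (X k w))); last first.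
  by move=> k _; case: (X k w) => [x|] //=; rewrite big1// => i _; rewrite mulr0.
rewrite exchange_big /=; apply: ler_sum => i _; rewrite -mulr_sumr ler_wpM2l//.
apply: (@count_pmap_le_counting R (X^~ w) (B i) K (N i)); last exact: NE.
by move=> k l; exact: X_distinct.
Qed.

Import HBNNSimple.

Lemma poisson_exp_le (K : nat) (f : R -> R) (D : R) :
  measurable_fun setT f -> (forall x, 0 <= f x) ->
  (\int[leb]_x (expR (f x) - 1)%:E <= D%:E)%E ->
  (\int[P]_w (expR (\sum_(k < K) oapp f 0 (X k w)))%:E <= (expR (rate * D))%:E)%E.
Proof.
move=> mf f0 fD.
have mfE : measurable_fun setT (fun x => (f x)%:E) by exact/measurable_EFinP.
pose f_ := nnsfun_approx measurableT mfE.
(* The truncation to [[-n, n]] gives bounded level sets, the only ones whose counts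
   [poisson_process] describes. *)
pose g n (x : R) : R := f_ n x * \1_(`[- n%:R, n%:R]%classic : set R) x.
have f_le n x : f_ n x <= f x.
  rewrite -lee_fin.
  have cv := cvg_nnsfun_approx measurableT mfE (fun x _ => f0 x : (0 <= (f x)%:E)%E) (I : setT x).
  rewrite -(cvg_lim _ cv)//; apply: lime_ge; first by apply/cvg_ex; eexists; exact: cv.
  exists n => // m /= nm; rewrite lee_fin.
  exact/lefP/nd_nnsfun_approx.
have mg n : measurable_fun setT (g n).
  apply: measurable_funM; first exact: measurable_funP.
  by apply: measurable_indic.
have step n : (\int[P]_w (expR (\sum_(k < K) oapp (g n) 0 (X k w)))%:E
    <= (expR (rate * D))%:E)%E.
  pose rs : seq R := finmap.enum_fset (fset_set (range (f_ n))).
  have rsP x : f_ n x \in rs.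
    by rewrite /rs in_fset_set//; apply/mem_set; exists x.
  have urs : uniq rs by exact: finmap.fset_uniq.
  (* The values in the list are nonnegative, so the maximum only serves to make this visible for
     every index. *)
  pose c (i : 'I_(size rs)) : R := Num.max 0 (nth 0 rs i).
  pose B (i : 'I_(size rs)) : set R := f_ n @^-1` [set nth 0 rs i] `&` `[- n%:R, n%:R].
  have c0 i : 0 <= c i by rewrite /c le_max lexx.
  have cE (i : 'I_(size rs)) x : f_ n x = nth 0 rs i -> c i = f_ n x.
    by move=> xi; rewrite /c -xi; apply: max_r; exact: fun_ge0.
  have mB i : measurable (B i).
    apply: measurableI => //.
  have bB i : bounded_set (B i).
    exists n%:R; split => // y ny x [_]; rewrite /= in_itv /= => /andP[x1 x2].
    by rewrite (le_trans _ (ltW ny))// ler_norml x1.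
  have tB : trivIset setT B.
    move=> i j _ _ [x [[/= xi _] [/= xj _]]]; apply/val_inj/eqP => /=.
    by rewrite -(nth_uniq 0 _ _ urs)// -xi -xj.
  have gE x : g n x = \sum_i c i * \1_(B i) x.
    have xrs := rsP x.
    have ix : (index (f_ n x) rs < size rs)%N by rewrite index_mem.
    rewrite (bigD1 (Ordinal ix))//= big1 ?addr0; last first.
      move=> i ii; rewrite indicE memNset ?mulr0// => -[/= xi _].
      move/eqP: ii; apply; apply/val_inj => /=.
      by rewrite xi index_uniq.
    rewrite (cE _ x) /=; last by rewrite nth_index.
    rewrite /g; congr (_ * _); rewrite !indicE; congr ((nat_of_bool _)%:R).
    apply/idP/idP => /set_mem; first by move=> h; apply/mem_set; split => //=; rewrite nth_index.
    by move=> [_ h]; exact/mem_set.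
  have := @poisson_simple K (size rs) c B c0 (fun i => conj (mB i) (bB i)) tB.
  rewrite (eq_integral (fun w => (expR (\sum_(k < K) oapp (g n) 0 (X k w)))%:E)); last first.
    move=> w _; congr (expR _)%:E; apply: eq_bigr => k _.
    by case: (X k w) => [x|] //=; rewrite gE.
  move=> /le_trans; apply; rewrite lee_fin ler_expR.
  rewrite (eq_bigr (fun i => rate * (fine (leb (B i)) * (expR (c i) - 1)))); last first.
    by move=> i _; rewrite mulrA.
  rewrite -mulr_sumr ler_wpM2l// -lee_fin; apply: le_trans fD.
  have ec0 i : 0 <= expR (c i) - 1 by rewrite subr_ge0 -expR0 ler_expR.
  have m1B i : measurable_fun setT (fun x : R => (\1_(B i) x : R)%:E).
    by apply/measurable_EFinP; exact: measurable_indic.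
  have Bfin i : leb (B i) \is a fin_num.
    rewrite ge0_fin_numE//; apply: (@le_lt_trans _ _ (leb (`[- n%:R, n%:R]%classic : set R))).
      by apply: le_measure; rewrite ?inE//; [exact: mB|move=> x []].
    by rewrite lebesgue_measure_itv/=; case: ifP => _; rewrite ?ltry// -EFinD ltry.
  have intB i : (\int[leb]_x (\1_(B i) x : R)%:E = leb (B i))%E.
    transitivity (leb (B i `&` setT)); last by rewrite setIT.
    by apply: integral_indic => //; exact: mB.
  apply: (@le_trans _ _ (\int[leb]_x (\sum_i (expR (c i) - 1)%:E * (\1_(B i) x)%:E)))%E.
    rewrite ge0_integral_sum//.
    - rewrite -sumEFin; apply: lee_sum => i _.
      rewrite ge0_integralZl//; [|exact: m1B|by rewrite lee_fin].
      by rewrite intB EFinM muleC fineK.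
    - by move=> i; exact: (emeasurable_funM (measurable_cst _) (m1B i)).
    - by move=> i x _; rewrite mule_ge0// lee_fin.
  apply: ge0_le_integral => //.
  - by move=> x _; apply: sume_ge0 => i _; rewrite mule_ge0// lee_fin.
  - by apply: emeasurable_sum => i; exact: (emeasurable_funM (measurable_cst _) (m1B i)).
  - apply/measurable_EFinP; apply: measurable_funB => //; exact: measurableT_comp.
  move=> x _; under eq_bigr do rewrite -EFinM.
  rewrite sumEFin lee_fin.
  have [[i Bi]|nB] := pselect (exists i, B i x).
    rewrite (bigD1 i)//= big1 ?addr0; last first.
      move=> j ji; rewrite indicE memNset ?mulr0// => Bj.
      by move/eqP: ji; apply; apply: tB => //; exists x.
    rewrite indicE mem_set// mulr1 lerB// ler_expR.
    by rewrite (cE _ x) ?f_le//; exact: Bi.1.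
  rewrite big1 ?subr_ge0 -?expR0 ?ler_expR// => i _; rewrite indicE memNset ?mulr0//.
  by move=> Bi; apply: nB; exists i.
have g_cvg x : g ^~ x @ \oo --> f x.
  have cv := cvg_nnsfun_approx measurableT mfE (fun x _ => f0 x : (0 <= (f x)%:E)%E) (I : setT x).
  move/fine_cvgP : cv => [_ cv].
  apply: (cvg_trans _ cv); apply: near_eq_cvg; near=> n.
  rewrite /g indicE mem_set ?mulr1//= in_itv /= -ler_norml.
  by near: n; exact: nbhs_infty_ger.
apply: (@fatou_le _ _ _ P (fun n w => (expR (\sum_(k < K) oapp (g n) 0 (X k w)))%:E)) => //.
- move=> n; apply/measurable_EFinP; apply: measurableT_comp => //.
  by apply: measurable_sum => k; exact: omeasurable_oapp.
- apply/measurable_EFinP; apply: measurableT_comp => //.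
  by apply: measurable_sum => k; exact: omeasurable_oapp.
move=> w.
rewrite (cvg_limn_einf_sup (_ : _ @ \oo --> (expR (\sum_(k < K) oapp f 0 (X k w)))%:E)).1//.
apply: cvg_EFin; first exact: nearW.
apply: continuous_cvg; first exact: continuous_expR.
elim: (index_enum _) => [|k s IH].
  by rewrite big_nil; under eq_fun do rewrite big_nil; exact: cvg_cst.
rewrite big_cons; under eq_fun do rewrite big_cons.
apply: cvgD IH; case: (X k w) => [x|] /=; first exact: g_cvg.
exact: cvg_cst.
Unshelve. all: by end_near.
Qed.

End poisson_exponential.

(** * Superposition of the clusters *)

Section integrate_out.
Context (R : realType) (d : measure_display) (T : measurableType d).
Context (P : probability T R) (I : choiceType) (E : I -> set (set T)).
Hypothesis Em : forall i, E i `<=` measurable.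
Hypothesis E_indep : mutually_independent P (fun i => <<s E i >>).

Local Notation F := (fun i => <<s E i >>).
Local Notation sigma J := (g_sigma_algebraType (cylinders F J)).

Let FT i : F i setT.
Proof. exact: (@measurableT _ (g_sigma_algebraType (E i))). Qed.

Let FI i : setI_closed (F i).
Proof.
by move=> A B FA FB; exact: (@measurableI _ (g_sigma_algebraType (E i)) A B FA FB).
Qed.

Let Fm i : F i `<=` measurable.
Proof. by apply: (smallest_sub (@sigma_algebra_measurable _ T)); exact: Em. Qed.

Lemma measurable_cylinders_sub (J J' : set I) : J `<=` J' ->
  measurable_fun setT (id : sigma J' -> sigma J).
Proof.
move=> JJ' _ A mA; rewrite setTI preimage_id.
apply: (sub_smallest2r _ _ mA) => [|Q [s [B [us sJ FB ->]]]].
  exact: smallest_sigma_algebra.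
by exists s, B; split => // i /sJ /JJ'.
Qed.

Lemma measurable_cylinders_class (J : set I) i : J i ->
  measurable_fun setT (id : sigma J -> g_sigma_algebraType (E i)).
Proof.
move=> Ji _ A mA; rewrite setTI preimage_id.
apply: (@sub_gen_smallest _ _ (cylinders F J)).
exact: (cylinders_sub FT Ji).
Qed.

(** A diagonal integral becomes a double one: [w] feeds the classes of [J], and an independent copy
    [v] feeds the class [i]. *)
Let integrate_class (J : set I) i
    (phi : sigma J * g_sigma_algebraType (E i) -> \bar R) :
  ~ J i -> measurable_fun setT phi -> (forall z, 0 <= phi z)%E ->
  (\int[P]_w phi (w, w) = \int[P]_w \int[P]_v phi (w, v))%E.
Proof.
move=> nJi mphi phi0.
have mid := @measurable_id_g_sigma _ T (E i) (@Em i).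
pose nu' : {measure set g_sigma_algebraType (E i) -> \bar R} :=
  measure_function_pushforward__canonical__measure_function_Measure P mid.
have nufin : fin_num_fun nu'.
  move=> A mA; rewrite /nu' /= /pushforward; apply: fin_num_measure.
  by rewrite -[X in measurable X]setTI; exact: (mid measurableT A mA).
pose nu : {finite_measure set g_sigma_algebraType (E i) -> \bar R} :=
  HB.pack_for (FiniteMeasure.type (g_sigma_algebraType (E i)) R)
    (Measure.sort nu') (Measure_isFinite.Build _ _ _ _ nufin).
rewrite (@cylinders_indep_integral _ _ T _ R P nu I F J id phi)//.
  apply: eq_integral => w _.
  rewrite [in LHS]/nu /= ge0_integral_pushforward//.
  exact: (measurableT_comp mphi (@measurable_pair1 _ _ (sigma J) (g_sigma_algebraType (E i)) w)).
move=> s A B us sJ FA mB; rewrite preimage_id /nu /= /pushforward preimage_id.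
have is_ : i \notin s by apply/negP => /sJ.
pose A' j := if j == i then B else A j.
have A'i : A' i = B by rewrite /A' eqxx.
have A's j : j \in s -> A' j = A j.
  by move=> js; rewrite /A'; case: eqP js => // ->; rewrite (negbTE is_).
have := @E_indep (i :: s) A'; rewrite /= is_ us => /(_ isT).
rewrite big_cons A'i => indep.
transitivity (P (\bigcap_(j in [set` i :: s]) A' j)).
  congr (P _); apply/seteqP; split => w.
    move=> [wA wB] j /=; rewrite inE /A'; case: eqP => [->//|_ /=]; exact: wA.
  move=> wA; split; last by have := wA i; rewrite /= /A' inE eqxx; apply.
  by move=> j /= js; rewrite -A's//; apply: wA; rewrite /= inE js orbT.
rewrite indep; last by move=> j; rewrite /A'; case: eqP => [->|].
rewrite muleC; congr (_ * _)%E.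
rewrite (E_indep us FA); apply: eq_big_seq => j js; by rewrite A's.
Qed.

(** The factor [W i (w, v)] reads the classes of [J0] in [w] and its own class in [v]; [V i] bounds
    its mean over [v] for frozen [w]. Applied to the clusters with [J0] the classes of the roots,
    then to the roots with [J0] empty. *)
Lemma integrate_out_indep (s : seq I) (J0 : set I)
    (W : forall i, sigma J0 * g_sigma_algebraType (E i) -> \bar R)
    (V : I -> T -> \bar R) (J : set I) (Psi : T -> \bar R) :
  uniq s -> (forall i, i \in s -> ~ J i) -> J0 `<=` J ->
  (forall i, measurable_fun setT (W i)) -> (forall i z, 0 <= W i z)%E ->
  (forall i, measurable_fun setT (V i : sigma J0 -> \bar R)) ->
  (forall i w, 0 <= V i w)%E ->
  measurable_fun setT (Psi : sigma J -> \bar R) -> (forall w, 0 <= Psi w)%E ->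
  (forall i w, i \in s -> \int[P]_v W i (w, v) <= V i w)%E ->
  (\int[P]_w (Psi w * \prod_(i <- s) W i (w, w)) <=
   \int[P]_w (Psi w * \prod_(i <- s) V i w))%E.
Proof.
move=> us sJ J0J mW W0 mV V0 + + WV.
elim: s J us sJ J0J WV Psi => [|i s IH] J.
  move=> *; rewrite le_eqVlt; apply/orP; left; apply/eqP.
  by apply: eq_integral => w _; rewrite !big_nil.
move=> /= /andP[is_ us] sJ J0J WV Psi mPsi Psi0.
have Ji : ~ J i by apply: sJ; rewrite inE eqxx.
(* The factor of [i] is first absorbed in [Psi], which enlarges [J] while the other indices are
   integrated out; the class [i] comes last. *)
pose J' := J `|` [set i].
have mWi : measurable_fun setT (fun w : sigma J' => W i (w, w)).
  apply: (measurableT_comp (mW i)); apply/measurable_fun_pairP; split.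
    by apply: measurable_cylinders_sub => j /J0J; left.
  by apply: measurable_cylinders_class; right.
have JJ' : J `<=` J' by left.
have mm A (f : T -> \bar R) : measurable_fun setT (f : sigma A -> \bar R) ->
    measurable_fun setT f.
  move=> mf; apply: (measurableT_comp mf).
  by apply: measurable_id_g_sigma; exact: cylinders_measurable.
have mJ0 : measurable_fun setT (id : T -> sigma J0).
  by apply: measurable_id_g_sigma; exact: cylinders_measurable.
have mPV : measurable_fun setT ((fun w => Psi w * \prod_(j <- s) V j w)%E : sigma J -> \bar R).
  apply: emeasurable_funM => //; apply: measurable_prode => j.
  by apply: (measurableT_comp (mV j)); exact: measurable_cylinders_sub.
have PV0 w : (0 <= Psi w * \prod_(j <- s) V j w)%E by rewrite mule_ge0// prode_ge0.
apply: (@le_trans _ _ (\int[P]_w (Psi w * W i (w, w) * \prod_(j <- s) W j (w, w)))%E).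
  by under eq_integral do rewrite big_cons muleA.
apply: le_trans (IH J' us _ _ _ (fun w => Psi w * W i (w, w))%E _ _) _.
- move=> j js [|/= ji]; first by apply: sJ; rewrite inE js orbT.
  by move: is_; rewrite -ji js.
- exact: subset_trans JJ'.
- by move=> j w js; apply: WV; rewrite inE js orbT.
- apply: emeasurable_funM => //; apply: (measurableT_comp mPsi).
  exact: measurable_cylinders_sub.
- by move=> w; rewrite mule_ge0.
under eq_integral do rewrite -muleA [X in (_ * X)%E]muleC muleA.
under [leRHS]eq_integral do rewrite big_cons [X in (_ * X)%E]muleC muleA.
rewrite (@integrate_class J i (fun z => Psi z.1 * \prod_(j <- s) V j z.1 * W i z)%E)//; last 2 first.
- apply: emeasurable_funM.
    exact: (measurableT_comp mPV measurable_fst).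
  apply: (measurableT_comp (mW i)); apply/measurable_fun_pairP; split => /=.
    by apply: (measurableT_comp (measurable_cylinders_sub J0J)) => /=; exact: measurable_fst.
  exact: measurable_snd.
- by move=> z; rewrite mule_ge0.
have mWw w : measurable_fun setT (fun v : T => W i (w, v)).
  apply: (measurableT_comp (mW i)).
  apply: (measurableT_comp (@measurable_pair1 _ _ (sigma J0) (g_sigma_algebraType (E i)) w)).
  exact: measurable_id_g_sigma.
rewrite [leLHS](_ : _ = \int[P]_w (Psi w * \prod_(j <- s) V j w * \int[P]_v W i (w, v)))%E; last first.
  by apply: eq_integral => w _; rewrite -ge0_integralZl//; exact: mWw.
apply: ge0_le_integral => //.
- by move=> w _; rewrite mule_ge0// integral_ge0.
- apply: emeasurable_funM; first exact: mm mPV.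
  apply: (@measurable_fun_fubini_tonelli_F _ _ T T R P (fun z => W i z)) => //.
  apply: (measurableT_comp (mW i)); apply/measurable_fun_pairP; split => /=.
    by apply: (measurableT_comp mJ0) => /=; exact: measurable_fst.
  exact: (measurableT_comp (measurable_id_g_sigma (@Em i)) measurable_snd).
- apply: emeasurable_funM; first exact: mm mPV.
  exact: mm (mV i).
- by move=> w _; rewrite lee_wpmul2l// WV// inE eqxx.
Qed.

End integrate_out.

Lemma omeasurable_comp (R : realType) d (T : measurableType d) d' (T' : measurableType d')
    (f : T' -> T) (Y : T -> option R) :
  measurable_fun setT f -> omeasurable Y -> omeasurable (Y \o f).
Proof. by move=> mf mY A mA; have := mf measurableT _ (mY A mA); rewrite setTI. Qed.

Definition cluster_total (R : realType) (M : nat) (a : R) (B : set R) (K : nat)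
    (g : Defs.cluster R M) (x : R) : R :=
  \sum_(i < K) cval (translate_cluster g x) (CodeSeq.decode i) (fun=> fun y => a * \1_B y).

(** The same [K] bounds the ranks of the roots and the codes of the labels, which leaves a finite
    sum. *)
Definition truncated_total (R : realType) (M : nat) (T : Type) (a : R) (B : set R)
    (X : 'I_M -> nat -> T -> option R) (G : 'I_M -> nat -> T -> Defs.cluster R M)
    (K : nat) (w : T) : R :=
  \sum_m \sum_(k < K) oapp (cluster_total a B K (G m k w)) 0 (X m k w).

Lemma cval_translate (R : realType) (M : nat) (g : Defs.cluster R M) x v
    (f : 'I_M -> R -> R) :
  cval (translate_cluster g x) v f = cval g v (fun m b => f m (x + b)).
Proof. by rewrite /cval /translate_cluster; case: (g v) => [[]|]. Qed.

Lemma measurable_cluster_total (R : realType) (M : nat) d (T : measurableType d)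
    (G : T -> Defs.cluster R M) d' (T' : measurableType d') (f : T' -> T)
    (Y : T' -> option R) a B K :
  cluster_events G `<=` measurable -> measurable_fun setT f -> omeasurable Y ->
  measurable B ->
  measurable_fun setT (fun z => oapp (cluster_total a B K (G (f z))) 0 (Y z)).
Proof.
move=> mG mf mY mB; rewrite [X in measurable_fun _ X](_ : _ = (fun z =>
    if isSome (Y z) then cluster_total a B K (G (f z)) (odflt 0 (Y z)) else 0)); last first.
  by apply/funext => z; case: (Y z).
apply: measurable_fun_ifT => //; first exact: omeasurable_isSome.
apply: measurable_sum => i; apply: measurable_cval => [|_].
  by apply: translate_cluster_measurable => //; exact: omeasurable_odflt.
by apply: measurable_funM => //; exact: measurable_indic.
Qed.

Section truncated_total_moment.
Context (R : realType) (M : nat) (H : 'M[R]_M) (mu : 'I_M -> R).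
Context (h : 'I_M -> 'I_M -> R -> R).
Context (d : measure_display) (T : measurableType d) (P : probability T R).
Context (X : 'I_M -> nat -> T -> option R) (G : 'I_M -> nat -> T -> Defs.cluster R M).
Hypothesis HC : cluster_construction P mu h X G.
Hypothesis mu0 : forall m, 0 <= mu m.
Hypothesis mh : forall i j, measurable_fun `[(0 : R), +oo[ (h i j).
Hypothesis h0 : forall i j (t : R), 0 <= t -> 0 <= h i j t.
Hypothesis hH : forall i j, l1norm (h i j) = (H i j)%:E.
Context (a rho u L : R) (B : set R).
Hypothesis a0 : 0 <= a.
Hypothesis mB : measurable B.
Hypothesis L0 : 0 <= L.
Hypothesis BL : (lebesgue_measure B <= L%:E)%E.
Hypothesis rho0 : 0 <= rho.
Hypothesis urho : expR u <= rho.
Hypothesis bound_u : forall n i, linear_bound H a rho n i <= u.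

Local Notation lam := (log_moment (kernel h) a B).
Local Notation I := ('I_M + 'I_M * nat)%type.

Let E (i : I) : set (set T) :=
  match i with
  | inl m => root_events X m
  | inr (m, k) => cluster_events (G m k)
  end.

Let Em i : E i `<=` measurable.
Proof.
case: i => [m|[m k]]; first exact: (roots_measurable HC).
exact: (cluster_measurable (clusters_law HC m k)).
Qed.

Let E_indep : mutually_independent P (fun i => <<s E i >>).
Proof.
move=> s A us FA; apply: (construction_independent HC) => // -[m|[m k]].
  exact: (FA (inl m)).
exact: (FA (inr (m, k))).
Qed.

Local Notation sigma J := (g_sigma_algebraType (cylinders (fun i => <<s E i >>) J)).

Let omeasurable_root m k :
  omeasurable (X m k : g_sigma_algebraType (root_events X m) -> option R).
Proof. by move=> A mA; apply: sub_sigma_algebra; exists k, A. Qed.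

Let mlam n m : measurable_fun setT (lam n m).
Proof.
exact: (measurable_log_moment (measurable_kernel mh) (kernel_ge0 h0)
  (integral_kernel mh hH) a0 mB rho0 urho bound_u).
Qed.

Let lam0 n m x : 0 <= lam n m x.
Proof.
exact: (log_moment_ge0 (measurable_kernel mh) (kernel_ge0 h0)
  (integral_kernel mh hH) a0 mB rho0 urho bound_u).
Qed.

Let integrate_clusters K n : (forall i, (i < K)%N -> (size (CodeSeq.decode i) < n)%N) ->
  (\int[P]_w (expR (truncated_total a B X G K w))%:E <=
   \int[P]_w (expR (\sum_m \sum_(k < K) oapp (lam n m) 0 (X m k w)))%:E)%E.
Proof.
move=> Kn.
(* The classes of the roots, frozen while the clusters are integrated out. *)
pose J0 : set I := [set i | exists m, i = inl m].
pose s : seq I := [seq inr (m, k) | m <- index_enum 'I_M, k <- iota 0 K].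
pose W (i : I) (z : T * T) : \bar R := match i with
  | inl m => 1%E
  | inr (m, k) => (expR (oapp (cluster_total a B K (G m k z.2)) 0 (X m k z.1)))%:E
  end.
pose V (i : I) (w : T) : \bar R := match i with
  | inl m => 1%E
  | inr (m, k) => (expR (oapp (lam n m) 0 (X m k w)))%:E
  end.
have mX m k : omeasurable (X m k : sigma J0 -> option R).
  move=> A mA; have Jm : J0 (inl m) by exists m.
  have := @measurable_cylinders_class d T I E J0 (inl m) Jm measurableT _ (omeasurable_root k mA).
  by rewrite setTI.
have := @integrate_out_indep R d T P I E Em E_indep s J0 W V J0 (cst 1%E).
have -> : (\int[P]_w (cst 1 w * \prod_(i <- s) W i (w, w)) =
    \int[P]_w (expR (truncated_total a B X G K w))%:E)%E.
  apply: eq_integral => w _; rewrite mul1e big_allpairs_dep /truncated_total.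
  rewrite expR_sumE; apply: eq_bigr => m _; rewrite expR_sumE.
  by rewrite -(big_mkord xpredT (fun k => W (inr (m, k)) (w, w))) /index_iota subn0.
have -> : (\int[P]_w (cst 1 w * \prod_(i <- s) V i w) =
    \int[P]_w (expR (\sum_m \sum_(k < K) oapp (lam n m) 0 (X m k w)))%:E)%E.
  apply: eq_integral => w _; rewrite mul1e big_allpairs_dep.
  rewrite expR_sumE; apply: eq_bigr => m _; rewrite expR_sumE.
  by rewrite -(big_mkord xpredT (fun k => V (inr (m, k)) w)) /index_iota subn0.
apply => //.
- apply: allpairs_uniq; [exact: index_enum_uniq|exact: iota_uniq|].
  by move=> [m k] [m' k'] _ _ [-> ->].
- by move=> i /allpairsP[[m k] /= [_ _ ->]] [m'].
- case=> [m|[m k]]; first exact: measurable_cst.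
  apply/measurable_EFinP; apply: measurableT_comp => //.
  pose SG := g_sigma_algebraType (cluster_events (G m k)).
  have mG : cluster_events (G m k : SG -> _) `<=` measurable by exact: sub_sigma_algebra.
  have mY : omeasurable (fun z : sigma J0 * SG => X m k z.1).
    by apply: (omeasurable_comp (f := fst : sigma J0 * SG -> sigma J0)); [exact: measurable_fst|exact: mX].
  exact: (measurable_cluster_total a K mG measurable_snd mY mB).
- by case=> [m|[m k]] z; rewrite lee_fin ?expR_ge0.
- case=> [m|[m k]]; first exact: measurable_cst.
  apply/measurable_EFinP; apply: measurableT_comp => //.
  by apply: omeasurable_oapp => //; exact: mlam.
- by case=> [m|[m k]] z; rewrite lee_fin ?expR_ge0.
move=> i w /allpairsP[[m k] /= [_ _ ->]] /=.
case: (X m k w) => [x|] /=; last first.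
  rewrite expR0 integral_cst// [X in (_ * X)%E](_ : _ = 1%E) ?mule1//.
  exact: probability_setT.
have := @cluster_exp_moment R M H h d T P m (G m k) (clusters_law HC m k) mh h0 hH
  a rho u B a0 mB rho0 urho bound_u n x [seq CodeSeq.decode i | i <- iota 0 K].
rewrite map_inj_uniq ?iota_uniq; last exact: (can_inj CodeSeq.decodeK).
move=> /(_ isT) clK; apply: le_trans (clK _).
  rewrite le_eqVlt; apply/orP; left; apply/eqP; apply: eq_integral => v _.
  congr (expR _)%:E; rewrite big_map /cluster_total.
  rewrite -(big_mkord xpredT (fun i => cval (translate_cluster (G m k v) x)
    (CodeSeq.decode i) (fun=> fun y => a * \1_B y))) /index_iota subn0.
  by apply: eq_bigr => j _; rewrite cval_translate.
by move=> v /mapP[j]; rewrite mem_iota => /andP[_ jK] ->; apply: Kn.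
Qed.

(** Nothing remains to be frozen: the root processes of the different types are independent, and
    each contributes its exponential formula. *)
Let integrate_roots K n :
  (\int[P]_w (expR (\sum_m \sum_(k < K) oapp (lam n m) 0 (X m k w)))%:E <=
   (expR (\sum_m mu m * (L * (expR u - 1))))%:E)%E.
Proof.
pose s : seq I := [seq inl m | m <- index_enum 'I_M].
pose W (i : I) (z : T * T) : \bar R := match i with
  | inl m => (expR (\sum_(k < K) oapp (lam n m) 0 (X m k z.2)))%:E
  | inr _ => 1%E
  end.
pose V (i : I) (w : T) : \bar R := match i with
  | inl m => (expR (mu m * (L * (expR u - 1))))%:E
  | inr _ => 1%E
  end.
have := @integrate_out_indep R d T P I E Em E_indep s set0 W V set0 (cst 1%E).
have -> : (\int[P]_w (cst 1 w * \prod_(i <- s) W i (w, w)) =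
    \int[P]_w (expR (\sum_m \sum_(k < K) oapp (lam n m) 0 (X m k w)))%:E)%E.
  by apply: eq_integral => w _; rewrite mul1e big_map expR_sumE.
have -> : (\int[P]_w (cst 1 w * \prod_(i <- s) V i w) =
    (expR (\sum_m mu m * (L * (expR u - 1))))%:E)%E.
  rewrite (eq_integral (cst (expR (\sum_m mu m * (L * (expR u - 1))))%:E)).
    rewrite integral_cst// [X in (_ * X)%E](_ : _ = 1%E) ?mule1//.
    exact: probability_setT.
  by move=> w _; rewrite mul1e big_map -expR_sumE.
apply => //.
- by rewrite map_inj_uniq ?index_enum_uniq// => m m' [].
- by move=> i _ [].
- case=> [m|[m k]]; last exact: measurable_cst.
  apply/measurable_EFinP; apply: measurableT_comp => //.
  apply: measurable_sum => k.
  apply: (measurableT_comp (omeasurable_oapp _ (omeasurable_root k) (mlam n m))).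
  exact: measurable_snd.
- by case=> [m|[m k]] z; rewrite lee_fin ?expR_ge0.
- by case=> [m|[m k]]; exact: measurable_cst.
- by case=> [m|[m k]] z; rewrite lee_fin ?expR_ge0.
move=> i w /mapP[m _ ->] /=.
apply: poisson_exp_le => //.
- by move=> k A mA; apply: (roots_measurable HC); exists k, A.
- by move=> k l v; exact: (roots_distinct HC).
- exact: (roots_poisson HC m).
- exact: (integral_expR_log_moment_le (measurable_kernel mh) (kernel_ge0 h0)
    (integral_kernel mh hH) a0 mB L0 BL rho0 urho bound_u).
Qed.

Lemma exp_truncated_total_le K :
  (\int[P]_w (expR (truncated_total a B X G K w))%:E <=
   (expR (\sum_m mu m * (L * (expR u - 1))))%:E)%E.
Proof.
(* The number of generations exceeds the length of each of the first [K] labels. *)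
apply: le_trans (integrate_roots K (\max_(i < K) size (CodeSeq.decode i)).+1).
apply: integrate_clusters => i iK; rewrite ltnS.
exact: (@leq_bigmax _ (fun i : 'I_K => size (CodeSeq.decode i)) (Ordinal iK)).
Qed.

Lemma measurable_truncated_total K :
  measurable_fun setT (truncated_total a B X G K).
Proof.
apply: measurable_sum => m; apply: measurable_sum => k.
apply: measurable_cluster_total => //; first exact: (@Em (inr (m, val k))).
by move=> A mA; apply: (roots_measurable HC); exists (val k), A.
Qed.

End truncated_total_moment.

(** * Transfer to processes with the same law *)

(** Points listed several times are to be counted once, since two individuals may share a birth
    date. *)
Lemma measurable_counting_points (R : realType) d (T : measurableType d)
    (Y : nat -> T -> option R) (B : set R) :
  (forall p, omeasurable (Y p)) -> measurable B ->
  measurable_fun setT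
    (fun w => counting ([set x | exists p, Y p w = Some x] `&` B) : \bar R).
Proof.
move=> mY mB.
pose S w p : set R := [set x | Y p w = Some x /\ B x].
pose eqpq p q : set T := [set w | (isSome (Y p w) && isSome (Y q w)) &&
  (odflt 0 (Y p w) == odflt 0 (Y q w))].
(* The [p]-th point lies in [B] and differs from all earlier ones; the count is the sum of these
   indicators. *)
pose D p : set T := [set w | exists x, B x /\ Y p w = Some x] `\`
  \big[setU/set0]_(q < p) eqpq p q.
have mD p : measurable (D p).
  apply: measurableD; first exact: mY.
  apply: bigsetU_measurable => q _.
  have mb : measurable_fun setT (fun w => (isSome (Y p w) && isSome (Y q w)) &&
      (odflt 0 (Y p w) == odflt 0 (Y q w))).
    apply: measurable_and; first by apply: measurable_and; exact: omeasurable_isSome.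
    by apply: measurable_fun_eqr; exact: omeasurable_odflt.
  by have := mb measurableT [set true] I; rewrite setTI.
have sub1 w p x y : S w p x -> S w p y -> x = y.
  by move=> [+ _] [+ _] => -> [].
have DE w p : D p w <-> seqDU (S w) p !=set0.
  split.
    move=> [[x [Bx Yx]] nD]; exists x; split => //.
    rewrite -bigcup_mkord => -[q /= qp [Yq _]]; apply: nD.
    by rewrite -bigcup_mkord; exists q => //; rewrite /eqpq /= Yx Yq /=.
  move=> [x [[Yx Bx] nS]]; split; first by exists x.
  rewrite -bigcup_mkord => -[q /= qp]; rewrite /eqpq /= Yx /=.
  case Yq : (Y q w) => [y|] //= /eqP xy; apply: nS.
  by rewrite -bigcup_mkord; exists q => //; split => //; rewrite Yq -xy.
have countS w p : counting (seqDU (S w) p) = (\1_(D p) w)%:E :> \bar R.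
  have [/[dup] /DE [x Sx] Dw|nD] := pselect (D p w).
    have -> : seqDU (S w) p = [set x].
      apply/seteqP; split => [y [Sy _]|y ->] //.
      exact: (sub1 w p _ _ Sy Sx.1).
    rewrite /counting asboolT// fset_set1 finmap.cardfs1 indicE mem_set//.
  rewrite indicE memNset//; have -> : seqDU (S w) p = set0.
    by rewrite -subset0 => x Sx; apply: nD; apply/DE; exists x.
  exact: measure0.
have mS w p : measurable (seqDU (S w) p).
  have [[x Sx]|nS] := pselect (seqDU (S w) p !=set0).
    rewrite (_ : seqDU _ _ = [set x])//.
    apply/seteqP; split => [y [Sy _]|y ->] //.
    exact: (sub1 w p _ _ Sy Sx.1).
  rewrite (_ : seqDU _ _ = set0)//.
  by rewrite -subset0 => x Sx; apply: nS; exists x.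
rewrite [X in measurable_fun _ X](_ : _ =
    (fun w => \sum_(p <oo) (\1_(D p) w)%:E)%E); last first.
  apply/funext => w.
  rewrite (_ : _ `&` B = \bigcup_p seqDU (S w) p); last first.
    rewrite -seqDU_bigcup_eq; apply/seteqP; split => x.
      by move=> [[p Yp] Bx]; exists p.
    by move=> [p _ [Yp Bx]]; split => //; exists p.
  rewrite measure_semi_bigcup//=; last exact: bigcup_measurable.
  by apply: eq_eseriesr => p _; exact: countS.
apply: measurable_nneseries => [p|p w]; last by rewrite lee_fin.
by apply/measurable_EFinP; exact: measurable_indic.
Qed.

(* [t = (m0, k, v)] designates the individual [v] of the [k]-th cluster of root
   type [m0]. *)
Definition individual (R : realType) (M : nat) (T : Type)
    (X : 'I_M -> nat -> T -> option R) (G : 'I_M -> nat -> T -> Defs.cluster R M)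
    (m : 'I_M) (t : 'I_M * nat * seq nat) (w : T) : option R :=
  obind (fun x => typed_birth (fun w => translate_cluster (G t.1.1 t.1.2 w) x) t.2 m w)
    (X t.1.1 t.1.2 w).

Lemma birth_datesE (R : realType) (M : nat) (T : Type)
    (X : 'I_M -> nat -> T -> option R) (G : 'I_M -> nat -> T -> Defs.cluster R M) m w :
  birth_dates X G m w = [set y | exists t, individual X G m t w = Some y].
Proof.
apply/seteqP; split => y.
  move=> [m0 [k [x [u [b [Xx Gu ->]]]]]]; exists (m0, k, u).
  by rewrite /individual /= Xx /= /typed_birth /translate_cluster Gu /= eqxx.
move=> [[[m0 k] u]]; rewrite /individual /typed_birth /translate_cluster /=.
case Xx : (X m0 k w) => [x|] //=; case Gu : (G m0 k w u) => [[m' b]|] //=.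
case: eqP => // mm' [<-]; exists m0, k, x, u, b; split => //.
by rewrite Gu mm'.
Qed.

Lemma omeasurable_individual (R : realType) (M : nat) d (T : measurableType d)
    (X : 'I_M -> nat -> T -> option R) (G : 'I_M -> nat -> T -> Defs.cluster R M) m t :
  (forall m k, omeasurable (X m k)) ->
  (forall m k, cluster_events (G m k) `<=` measurable) ->
  omeasurable (individual X G m t).
Proof.
move=> mX mG A mA.
have mGX : cluster_events (fun w => translate_cluster (G t.1.1 t.1.2 w)
    (odflt 0 (X t.1.1 t.1.2 w))) `<=` measurable.
  apply: (@translate_cluster_measurable _ _ _ _ (G t.1.1 t.1.2) (mG _ _) _ _ id) => //.
  exact: omeasurable_odflt.
have mS : measurable ((fun w => isSome (X t.1.1 t.1.2 w)) @^-1` [set true]).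
  have := omeasurable_isSome (mX t.1.1 t.1.2) measurableT (I : measurable [set true]).
  by rewrite setTI.
rewrite [X in measurable X](_ : _ = (fun w => isSome (X t.1.1 t.1.2 w)) @^-1` [set true] `&`
  [set w | exists x, A x /\ typed_birth (fun w => translate_cluster (G t.1.1 t.1.2 w)
    (odflt 0 (X t.1.1 t.1.2 w))) t.2 m w = Some x]).
  by apply: measurableI => //; exact: (omeasurable_typed_birth mGX).
rewrite /individual /typed_birth; apply/seteqP; split => w /=.
  by case: (X _ _ w) => [x|] [y [Ay]] //= e; split => //; exists y.
by case: (X _ _ w) => [x|] [] //= _ [y [Ay e]]; exists y.
Qed.

Lemma measurable_count_birth_dates (R : realType) (M : nat) d (T : measurableType d)
    (X : 'I_M -> nat -> T -> option R) (G : 'I_M -> nat -> T -> Defs.cluster R M)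
    (m : 'I_M) (B : set R) :
  (forall m k, omeasurable (X m k)) ->
  (forall m k, cluster_events (G m k) `<=` measurable) -> measurable B ->
  measurable_fun setT (fun w => counting (birth_dates X G m w `&` B) : \bar R).
Proof.
move=> mX mG mB.
pose Y p w := if unpickle p is Some t then individual X G m t w else None.
have mY p : omeasurable (Y p).
  rewrite /Y; case: unpickle => [t|]; first exact: omeasurable_individual.
  move=> A mA; rewrite [X in measurable X](_ : _ = set0)//.
  by apply/seteqP; split => // w [x []].
have := measurable_counting_points mY mB.
congr (measurable_fun setT _); apply/funext => w; congr (counting (_ `&` B)).
rewrite birth_datesE; apply/seteqP; split => y [].
  by move=> p; rewrite /Y; case: unpickle => // t e; exists t.
by move=> t e; exists (pickle t); rewrite /Y pickleK.
Qed.

(** Choose one individual for each counted pair of a type and a birth date. Different pairs give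
    different individuals, and the finitely many chosen ones all appear as soon as [K] exceeds their
    ranks and codes. *)
Lemma count_le_truncated_total (R : realType) (M : nat) (T : Type)
    (X : 'I_M -> nat -> T -> option R) (G : 'I_M -> nat -> T -> Defs.cluster R M)
    (a : R) (B : set R) (kappa : 'I_M -> nat) (w : T) : 0 <= a ->
  (forall m, counting (birth_dates X G m w `&` B) = (kappa m)%:R%:E :> \bar R) ->
  exists K0, forall K, (K0 <= K)%N ->
    a * \sum_m (kappa m)%:R <= truncated_total a B X G K w.
Proof.
move=> a0 count.
have finB m : finite_set (birth_dates X G m w `&` B).
  by apply/(counting_lty R); rewrite count ltry.
pose s : seq ('I_M * R) :=
  [seq (m, x) | m <- index_enum 'I_M, x <- finmap.enum_fset (fset_set (birth_dates X G m w `&` B))].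
have us : uniq s.
  apply: allpairs_uniq_dep; first exact: index_enum_uniq.
    by move=> m _; exact: finmap.fset_uniq.
  by move=> [m x] [m' x'] _ _ /= [-> ->].
have sP m x : (m, x) \in s -> (birth_dates X G m w `&` B) x.
  move=> /allpairsPdep[m' [x' [_ + [-> ->]]]].
  by rewrite in_fset_set// => /set_mem.
have sizes : (size s)%:R = \sum_m (kappa m)%:R :> R.
  rewrite /s size_allpairs_dep sumnE big_map natr_sum; apply: eq_bigr => m _.
  have := count m; rewrite /counting asboolT// => -[] /eqP.
  by rewrite eqr_nat => /eqP <-.
have /choice[f fP] : forall p : 'I_M * R, exists t : 'I_M * nat * seq nat,
    p \in s -> individual X G p.1 t w = Some p.2.
  move=> [m x]; have [/sP[]|] := boolP ((m, x) \in s); last by exists (m, 0%N, [::]).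
  by rewrite birth_datesE => -[t e] _; exists t.
pose val (t : 'I_M * nat * nat) : R :=
  oapp (fun x => cval (translate_cluster (G t.1.1 t.1.2 w) x) (CodeSeq.decode t.2)
    (fun=> fun y => a * \1_B y)) 0 (X t.1.1 t.1.2 w).
have val0 t : 0 <= val t.
  rewrite /val; case: (X _ _ w) => [x|] //=; rewrite /cval.
  by case: translate_cluster => [[m b]|] //; rewrite mulr_ge0.
pose f' p := ((f p).1, CodeSeq.code (f p).2).
have f'inj : {in s &, injective f'}.
  move=> p q ps qs [e1 /(can_inj CodeSeq.codeK) e2].
  have e : f p = f q by rewrite [f p]surjective_pairing e1 e2 -surjective_pairing.
  have := fP p ps; have := fP q qs; rewrite -e /individual /typed_birth.
  case: (X _ _ w) => [x|] //=; case: translate_cluster => [[m b]|] //.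
  case: eqP => // mq [bq]; case: eqP => // mp [bp].
  by rewrite (surjective_pairing p) (surjective_pairing q) -mp -mq -bp -bq.
have valf p : p \in s -> val (f' p) = a.
  move=> ps; have := fP p ps; rewrite /individual /typed_birth /val /= CodeSeq.codeK.
  case: (X _ _ w) => [x|] //=; rewrite /cval; case: translate_cluster => [[m b]|] //.
  case: eqP => // mp [bp]; have : (p.1, p.2) \in s by rewrite -surjective_pairing.
  by move=> /sP[_ Bb]; rewrite indicE mem_set ?mulr1// bp.
(* The successors make both the rank of the root and the code of the label strictly less than
   [K]. *)
exists (\max_(p <- s) maxn (f' p).1.2.+1 (f' p).2.+1)%N => K sK.
have fK p : p \in s -> ((f' p).1.2 < K)%N && ((f' p).2 < K)%N.
  move=> ps; have := leq_trans (@leq_bigmax_seq _ s xpredT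
    (fun p => maxn (f' p).1.2.+1 (f' p).2.+1) p ps isT) sK.
  by rewrite geq_max.
pose S : seq ('I_M * nat * nat) :=
  [seq (mk, i) | mk <- [seq (m, k) | m <- index_enum 'I_M, k <- iota 0 K], i <- iota 0 K].
have -> : truncated_total a B X G K w = \sum_(t <- S) val t.
  rewrite /S big_allpairs_dep big_allpairs_dep; apply: eq_bigr => m _.
  rewrite -(big_mkord xpredT (fun k => oapp (cluster_total a B K (G m k w)) 0 (X m k w))).
  rewrite /index_iota subn0; apply: eq_bigr => k _; rewrite /val /=.
  case: (X m k w) => [x|] /=; last by rewrite big1.
  rewrite /cluster_total -(big_mkord xpredT (fun i => cval _ (CodeSeq.decode i) _)).
  by rewrite /index_iota subn0.
apply: (@le_trans _ _ (\sum_(t <- map f' s) val t)).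
  rewrite big_map (eq_big_seq (fun=> a) valf).
  by rewrite big_const_seq count_predT iter_addr_0 -mulr_natr sizes.
apply: ler_sum_uniq_sub => //; first by rewrite map_inj_in_uniq.
move=> _ /mapP[p ps ->]; have /andP[k1 k2] := fK p ps.
apply/allpairsP; exists ((f' p).1, (f' p).2); split => //=; last by rewrite mem_iota.
apply/allpairsP; exists ((f' p).1.1, (f' p).1.2); split => //=; last by rewrite -surjective_pairing.
  exact: mem_index_enum.
by rewrite mem_iota.
Qed.

Section exp_count.
Context (R : realType) (M : nat) (a : R) (B : set R).
Hypothesis a0 : 0 <= a.

Definition count_event (T : Type) (N : 'I_M -> T -> set R) (k : 'I_M -> nat) : set T :=
  [set w | forall m, counting (N m w `&` B) = (k m)%:R%:E :> \bar R].

(* [same_law] only speaks of the events that counts have given values, hence the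
   expansion of the exponential moment over these values. *)
Definition exp_count (k : 'I_M -> nat) : R := expR (a * \sum_m (k m)%:R).

(** With [pickle_inv], each vector of counts is met at exactly one [p], so that at most one term of
    the series is nonzero at a given point. *)
Definition exp_count_term (T : Type) (N : 'I_M -> T -> set R) (p : nat) (w : T) : \bar R :=
  if pickle_inv p is Some k then
    ((exp_count (k : {ffun 'I_M -> nat}))%:E * (\1_(count_event N k) w)%:E)%E
  else 0%E.

Lemma exp_count_term_ge0 T (N : 'I_M -> T -> set R) p w : (0 <= exp_count_term N p w)%E.
Proof.
by rewrite /exp_count_term; case: pickle_inv => // k; rewrite mule_ge0 ?lee_fin ?expR_ge0.
Qed.

Lemma exp_count_seriesE T (N : 'I_M -> T -> set R) w k : count_event N k w ->
  (\sum_(p <oo) exp_count_term N p w = (exp_count k)%:E)%E.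
Proof.
move=> Nk; pose k' : {ffun 'I_M -> nat} := [ffun m => k m].
have kE : k' =1 k by move=> m; rewrite ffunE.
rewrite (@nneseriesD1 _ _ (pickle k'))//; last by move=> i _; exact: exp_count_term_ge0.
rewrite eseries0 ?adde0 => [|p _ /= pk].
  rewrite /exp_count_term pickleK_inv indicE mem_set ?mule1.
    by congr (expR (a * _))%:E; apply: eq_bigr => m _; rewrite kE.
  by move=> m; rewrite Nk kE.
rewrite /exp_count_term; have := @pickle_invK {ffun 'I_M -> nat} p.
case: pickle_inv => //= k1 pk1; rewrite indicE memNset ?mule0// => Nk1.
move/eqP: pk; apply; rewrite -pk1; congr (pickle _); apply/ffunP => m.
have := Nk1 m; rewrite Nk kE => -[/eqP]; rewrite eqr_nat.
by move=> /eqP.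
Qed.

Lemma exp_count_seriesN T (N : 'I_M -> T -> set R) w :
  (forall k, ~ count_event N k w) -> (\sum_(p <oo) exp_count_term N p w = 0)%E.
Proof.
move=> nN; rewrite eseries0// => p _ _; rewrite /exp_count_term.
by case: pickle_inv => // k; rewrite indicE memNset ?mule0//; exact: nN.
Qed.

Section measurable.
Context d (T : measurableType d) (P : probability T R) (N : 'I_M -> T -> set R).
Hypothesis mN : forall m, measurable_fun setT (fun w => counting (N m w `&` B) : \bar R).

Lemma measurable_count_event k : measurable (count_event N k).
Proof.
rewrite (_ : count_event N k = \big[setI/setT]_m
    (fun w => counting (N m w `&` B) : \bar R) @^-1` [set (k m)%:R%:E]).
  apply: bigsetI_measurable => m _; rewrite -[X in measurable X]setTI.
  by apply: mN => //; exact: emeasurable_set1.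
rewrite -bigcap_seq; apply/seteqP; split => w h m; first by move=> _; exact: h.
by apply: h => /=; exact: mem_index_enum.
Qed.

Lemma measurable_exp_count_term p : measurable_fun setT (exp_count_term N p).
Proof.
rewrite /exp_count_term; case: pickle_inv => [k|]; last exact: measurable_cst.
apply: emeasurable_funM; first exact: measurable_cst.
by apply/measurable_EFinP; apply: measurable_indic; exact: measurable_count_event.
Qed.

Lemma measurable_exp_count_series :
  measurable_fun setT (fun w => \sum_(p <oo) exp_count_term N p w)%E.
Proof.
apply: measurable_nneseries => [p|p w]; last exact: exp_count_term_ge0.
exact: measurable_exp_count_term.
Qed.

Lemma integral_exp_count_series :
  (\int[P]_w \sum_(p <oo) exp_count_term N p w =
   \sum_(p <oo) if pickle_inv p is Some k then
     (exp_count (k : {ffun 'I_M -> nat}))%:E * P (count_event N k) else 0)%E.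
Proof.
rewrite integral_nneseries//; last 2 first.
  - by move=> p; exact: measurable_exp_count_term.
  - by move=> p w _; exact: exp_count_term_ge0.
apply: eq_eseriesr => p _; rewrite /exp_count_term.
case: pickle_inv => [k|]; last by rewrite integral0.
have mk := measurable_count_event k.
rewrite ge0_integralZl//; last 2 first.
  - by apply/measurable_EFinP; exact: measurable_indic.
  - by rewrite lee_fin expR_ge0.
by rewrite integral_indic// setIT.
Qed.

Hypothesis finN : {ae P, forall w, forall m, finite_set (N m w `&` B)}.

Lemma integral_expeR_total_count :
  (\int[P]_w expeR (a%:E * total_count N B w) =
   \int[P]_w \sum_(p <oo) exp_count_term N p w)%E.
Proof.
have tot0 w : (0 <= a%:E * total_count N B w)%E.
  by rewrite mule_ge0// sume_ge0.
(* The two functions differ at [-oo], which nonnegativity excludes. *)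
have er w : expeR (a%:E * total_count N B w) = er_map expR (a%:E * total_count N B w).
  by have := tot0 w; case: (a%:E * _)%E.
apply: ge0_ae_eq_integral => //.
- under eq_fun do rewrite er.
  apply: (measurableT_comp (f := er_map expR)); first exact: (@measurable_er_map _ T).
  apply: emeasurable_funM; first exact: measurable_cst.
  exact: emeasurable_sum.
- exact: measurable_exp_count_series.
- by move=> w _; exact: expeR_ge0.
- by move=> w _; apply: nneseries_ge0 => p _ _; exact: exp_count_term_ge0.
move: finN; apply: filterS => w fin _.
have /choice[k kE] : forall m, exists k : nat, counting (N m w `&` B) = k%:R%:E :> \bar R.
  by move=> m; apply: counting_lty_nat; apply/counting_lty.
rewrite (exp_count_seriesE (k := k))//.
rewrite /total_count (eq_bigr (fun m => (k m)%:R%:E)) => [|m _]; last exact: kE.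
by rewrite sumEFin.
Qed.

End measurable.
End exp_count.

(** On [T], local finiteness makes the series over count values equal to the exponential almost
    everywhere, and [same_law] carries each term to [T']. There the series is 0 wherever some count
    is infinite, so it lies below the lower limit of the truncated exponentials at every point, as
    Fatou requires. *)
Lemma hawkes_exp_moment_le (R : realType) (M : nat) (H : 'M[R]_M) (mu : 'I_M -> R)
    (h : 'I_M -> 'I_M -> R -> R) (d : measure_display) (T : measurableType d)
    (P : probability T R) (N : 'I_M -> T -> set R) (a rho u L : R) (B : set R) :
  stationary_hawkes P mu h N -> (forall i j, l1norm (h i j) = (H i j)%:E) ->
  0 <= a -> measurable B -> bounded_set B -> 0 <= L ->
  (lebesgue_measure B <= L%:E)%E -> 0 <= rho -> expR u <= rho ->
  (forall n i, linear_bound H a rho n i <= u) ->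
  (\int[P]_w expeR (a%:E * total_count N B w) <=
   (expR (\sum_m mu m * (L * (expR u - 1))))%:E)%E.
Proof.
move=> [[mu0 [mh h0]] ppN [d' [T' [P' [X [G [HC same]]]]]]] hH a0 mB bB L0 BL rho0 urho bound_u.
have mX m k : omeasurable (X m k).
  by move=> A mA; apply: (roots_measurable HC); exists k, A.
have mG m k : cluster_events (G m k) `<=` measurable.
  exact: (cluster_measurable (clusters_law HC m k)).
have mN m : measurable_fun setT (fun w => counting (N m w `&` B) : \bar R).
  exact: (ppN m).1.
have mN' m := measurable_count_birth_dates m mX mG mB.
have finN : {ae P, forall w, forall m, finite_set (N m w `&` B)}.
  apply: filter_forall => m; have [_] := ppN m.
  by apply: filterS => w; apply.
rewrite (integral_expeR_total_count a0 mN finN) (integral_exp_count_series a P mN).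
rewrite [leLHS](_ : _ = \int[P']_w \sum_(p <oo) exp_count_term a B (birth_dates X G) p w)%E.
  apply: (@fatou_le _ _ _ P' (fun K w => (expR (truncated_total a B X G K w))%:E)) => //.
  - move=> K; apply/measurable_EFinP; apply: measurableT_comp => //.
    exact: (measurable_truncated_total HC).
  - exact: measurable_exp_count_series.
  - by move=> w; apply: nneseries_ge0 => p _ _; exact: exp_count_term_ge0.
  - move=> w; have [[k Nk]|nN] := pselect (exists k, count_event B (birth_dates X G) k w).
      rewrite (exp_count_seriesE _ Nk).
      have [K0 K0P] := count_le_truncated_total a0 Nk.
      by apply: (le_limn_einf (K := K0)) => K KK; rewrite lee_fin ler_expR K0P.
    rewrite exp_count_seriesN; last by move=> k Nk; apply: nN; exists k.
    by apply: (le_limn_einf (K := 0%N)) => K _; rewrite lee_fin expR_ge0.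
  - move=> K; exact: (exp_truncated_total_le HC mu0 mh h0 hH a0 mB L0 BL rho0 urho bound_u).
rewrite (integral_exp_count_series a P' mN'); apply: eq_eseriesr => p _.
case: pickle_inv => // k; congr (_ * _)%E.
exact: (same M id (fun=> B) k (fun=> conj mB bB)).
Qed.

(** * Explicit constants and conclusion *)

Lemma linear_boundE (R : realType) (M : nat) (H : 'M[R]_M) (a rho : R) n i :
  linear_bound H a rho n i = a * \sum_(k < n) rho ^+ k * \sum_l (H ^+ k) i l.
Proof.
elim: n i => [|n IH] i; first by rewrite big_ord0 mulr0.
rewrite /= big_ord_recl expr0 mul1r mulrDr; congr (_ + _).
  rewrite (bigD1 i)//= big1 ?addr0 => [|l /negbTE li]; first by rewrite mxE eqxx mulr1.
  by rewrite mxE eq_sym li.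
rewrite (eq_bigr (fun j => a * \sum_(k < n) H i j * (rho ^+ k * \sum_l (H ^+ k) j l))); last first.
  by move=> j _; rewrite IH mulrCA mulr_sumr.
rewrite -mulr_sumr mulrCA; congr (_ * _); rewrite exchange_big mulr_sumr /=.
apply: eq_bigr => k _; rewrite /bump /= add1n exprS -mulrA; congr (_ * _).
rewrite (eq_bigr (fun j => rho ^+ k * \sum_l (H i j * (H ^+ k) j l))); last first.
  by move=> j _; rewrite mulrCA; congr (_ * _); rewrite mulr_sumr.
rewrite -mulr_sumr; congr (_ * _); rewrite exchange_big /=; apply: eq_bigr => l _.
by rewrite exprS mxE.
Qed.

Lemma sum_row_le_opnorm_inf (R : realType) (M : nat) (A : 'M[R]_M) i :
  \sum_j A i j <= opnorm_inf A.
Proof.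
apply: (@le_trans _ _ (\sum_j `|A i j|)); first by apply: ler_sum => j _; exact: ler_norm.
exact: (@le_bigmax _ _ _ 0 (fun i => \sum_j `|A i j|) i).
Qed.

(** The summand 1 is the power 0 of [H], to which the bound on [opnorm_inf] does not apply. For the
    others, [rho * r] is the midpoint [q] of [r] and 1, and the geometric series gives
    [K / (1 - q) = 2 * K / (1 - r)]. *)
Lemma linear_bound_le (R : realType) (M : nat) (H : 'M[R]_M) (a r K : R) n i :
  0 <= a -> 0 < r < 1 -> 0 <= K ->
  (forall k, (1 <= k)%N -> opnorm_inf (H ^+ k) <= K * r ^+ k) ->
  linear_bound H a ((1 + r) / (2 * r)) n i <= a * (1 + 2 * K / (1 - r)).
Proof.
move=> a0 /andP[r0 r1] K0 HK; rewrite linear_boundE ler_wpM2l//.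
set rho := (1 + r) / (2 * r); pose q := (1 + r) / 2.
have rhor : rho * r = q by rewrite /rho /q; field; lra.
have q0 : 0 <= q by rewrite /q; lra.
have q1 : q < 1 by rewrite /q; lra.
have rho0 : 0 <= rho by rewrite /rho divr_ge0//; lra.
have B0 : 0 <= 2 * K / (1 - r) by rewrite divr_ge0//; lra.
case: n => [|n]; first by rewrite big_ord0; lra.
rewrite big_ord_recl expr0 mul1r lerD//.
  rewrite (bigD1 i)//= big1 ?addr0 => [|l /negbTE li]; first by rewrite mxE eqxx.
  by rewrite mxE eq_sym li.
apply: (@le_trans _ _ (\sum_(k < n) K * q ^+ k)).
  apply: ler_sum => k _; rewrite !lift0.
  apply: (@le_trans _ _ (rho ^+ k.+1 * (K * r ^+ k.+1))).
    rewrite ler_wpM2l ?exprn_ge0//.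
    by apply: le_trans (sum_row_le_opnorm_inf _ _) (HK _ _).
  (* One factor [q] is given up, so that the sum starts at [q ^+ 0] and yields the stated
     constant. *)
  rewrite mulrCA -exprMn rhor ler_wpM2l// exprS ler_piMl ?exprn_ge0//.
  exact: ltW.
rewrite -mulr_sumr [leRHS](_ : _ = K * (1 - q)^-1); last by rewrite /q; field; lra.
rewrite ler_wpM2l// -[leRHS]mul1r ler_pdivlMr ?subr_gt0//.
rewrite mulrC; have := subrX1 q n => E.
have -> : (1 - q) * \sum_(k < n) q ^+ k = 1 - q ^+ n by rewrite -opprB mulNr -E opprB.
by rewrite gerBl exprn_ge0.
Qed.

Lemma growth_gt1 (R : realType) (r : R) : 0 < r < 1 -> 1 < (1 + r) / (2 * r).
Proof. by move=> /andP[r0 r1]; rewrite ltr_pdivlMr ?mulr_gt0//; lra. Qed.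

Lemma denom_gt0 (R : realType) (r K : R) :
  0 < r < 1 -> 0 <= K -> 0 < 1 + 2 * K / (1 - r).
Proof.
move=> /andP[r0 r1] K0; have : 0 <= 2 * K / (1 - r) by rewrite divr_ge0//; lra.
lra.
Qed.

Lemma xi_rK_gt0 (R : realType) (r K : R) : 0 < r < 1 -> 0 <= K -> 0 < xi_rK r K.
Proof. by move=> r01 K0; rewrite divr_gt0 ?denom_gt0// ln_gt0// growth_gt1. Qed.

Lemma hawkes_exp_moment_interval (R : realType) (M : nat) (H : 'M[R]_M) (r K : R)
    (d : measure_display) (T : measurableType d) (P : probability T R)
    (mu : 'I_M -> R) (h : 'I_M -> 'I_M -> R -> R) (N : 'I_M -> T -> set R)
    (B : set R) (s L u : R) :
  0 < r < 1 -> 0 <= K ->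
  (forall n : nat, (1 <= n)%N -> opnorm_inf (H ^+ n) <= K * r ^+ n) ->
  stationary_hawkes P mu h N -> (forall i j, l1norm (h i j) = (H i j)%:E) ->
  measurable B -> 0 < L -> B `<=` `[s, s + L[ -> 0 <= u <= 1 ->
  (\int[P]_w expeR ((u * xi_rK r K)%:E * total_count N B w) <=
   (expR ((((1 + r) / (2 * r)) `^ u - 1) * L * \sum_(m < M) mu m))%:E)%E.
Proof.
move=> r01 K0 HK HN hH mB L0 BsL /andP[u0 u1].
set rho := (1 + r) / (2 * r); have rho1 : 1 < rho by exact: growth_gt1.
have rho0 : 0 < rho by exact: lt_trans rho1.
have powE : rho `^ u = expR (u * ln rho) by rewrite /powR gt_eqF.
have a0 : 0 <= u * xi_rK r K by rewrite mulr_ge0// ltW// xi_rK_gt0.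
have bB : bounded_set B.
  exists (`|s| + L); split; first by rewrite num_real.
  move=> y ny x /BsL /=; rewrite in_itv /= => /andP[sx xsL].
  rewrite (le_trans _ (ltW ny))// ler_norml.
  have := ler_norm s; have := ler_norm (- s); rewrite normrN => s1 s2.
  by apply/andP; split; lra.
have BL : (lebesgue_measure B <= L%:E)%E.
  apply: (@le_trans _ _ (lebesgue_measure (`[s, s + L[%classic : set R))).
    by apply: le_measure; rewrite ?inE.
  by rewrite lebesgue_measure_itv /= lte_fin ltrDl L0 -EFinD addrAC subrr add0r.
(* This is where [u <= 1] enters: [rho] to the power [u] stays below [rho]. *)
have urho : expR (u * ln rho) <= rho.
  rewrite -[leRHS]lnK ?posrE// ler_expR -[leRHS]mul1r ler_wpM2r//.
  by rewrite ltW// ln_gt0.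
(* The denominator of [xi_rK] cancels the bound of [linear_bound_le] and leaves exactly
   [u * ln rho], which takes the place of the bound called [u] in the previous lemmas. *)
have bound_u n i : linear_bound H (u * xi_rK r K) rho n i <= u * ln rho.
  apply: (le_trans (linear_bound_le n i a0 r01 K0 HK)).
  by rewrite /xi_rK -/rho -mulrA divfK// gt_eqF// denom_gt0.
apply: (le_trans (hawkes_exp_moment_le HN hH a0 mB bB (ltW L0) BL (ltW rho0) urho bound_u)).
rewrite lee_fin ler_expR powE -mulr_suml mulrC [X in X * _]mulrC.
by [].
Qed.

Theorem theorem1 (R : realType) (M : nat) (H : 'M[R]_M)
    (M_gt0 : (0 < M)%N) (H_ge0 : forall i j, 0 <= H i j)
    (rhoH : spectral_radius H < 1) :
  (exists xi : R, 0 < xi /\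
     forall (d : measure_display) (T : measurableType d) (P : probability T R)
       (mu : 'I_M -> R) (h : 'I_M -> 'I_M -> R -> R) (N : 'I_M -> T -> set R),
       stationary_hawkes P mu h N ->
       (forall i j, l1norm (h i j) = (H i j)%:E) ->
       forall B : set R, measurable B -> bounded_set B ->
         (\int[P]_w expeR (xi%:E * total_count N B w) < +oo)%E)
  /\
  (forall r K : R, 0 < r < 1 -> 0 <= K ->
     (forall n : nat, (1 <= n)%N -> opnorm_inf (H ^+ n) <= K * r ^+ n) ->
     forall (d : measure_display) (T : measurableType d) (P : probability T R)
       (mu : 'I_M -> R) (h : 'I_M -> 'I_M -> R -> R) (N : 'I_M -> T -> set R),
       stationary_hawkes P mu h N ->
       (forall i j, l1norm (h i j) = (H i j)%:E) ->
       forall (B : set R) (s L : R), measurable B -> 0 < L ->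
         B `<=` `[s, s + L[ ->
         forall u : R, 0 <= u <= 1 ->
           (\int[P]_w expeR ((u * xi_rK r K)%:E * total_count N B w) <=
            (expR ((((1 + r) / (2 * r)) `^ u - 1) * L * \sum_(m < M) mu m))%:E)%E).
Proof.
split; last first.
  move=> r K r01 K0 HK d T P mu h N HN hH B s L mB L0 BsL u u01.
  exact: hawkes_exp_moment_interval HN hH mB L0 BsL u01.
(* [r] and [K] are obtained from [H] alone, hence so is [xi], before any process is given. *)
have [r [K [r01 K0 HK]]] := spectral_radius_lt1_powers M_gt0 rhoH.
exists (xi_rK r K); split; first exact: xi_rK_gt0.
move=> d T P mu h N HN hH B mB /pinfty_ex_gt0[b b0 Bb].
(* The additional length 1 puts the right end [b] inside the half-open interval. *)
have BsL : B `<=` `[- b, - b + (2 * b + 1)[.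
  move=> x /Bb /=; rewrite ler_norml in_itv /= => /andP[bx xb].
  by rewrite bx /=; lra.
have L0 : 0 < 2 * b + 1 by lra.
have u01 : 0 <= (1 : R) <= 1 by rewrite ler01 lexx.
have := hawkes_exp_moment_interval r01 K0 (fun n _ => HK n) HN hH mB L0 BsL u01.
rewrite mul1r => /le_lt_trans; apply; exact: ltry.
Qed.
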